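(* Fix an integer $n\ge0$ and $T>0$. Let $\Phi$ be the solution of the $\ell_0$-periodic Kuramoto–Sivashinsky problem $$\Phi_\tau+4\Phi_{\eta\eta\eta\eta}+\Phi_{\eta\eta}+\tfrac12(\Phi_\eta)^2=0,\qquad\Phi(0)=\Phi_0,$$ with $\Phi_0$ regular enough that $\Psi:=\Phi_\eta\in C([0,T];H^{n+4}_\sharp)\cap C^1([0,T];L^2)$ and $\Psi_\tau\in C([0,T];H^{n+2}_\sharp)$. Then there exist $\varepsilon_1=\varepsilon_1(n,T)\in(0,1)$ and $K_n>0$ with the following property. Let $0<\varepsilon\le\varepsilon_1$ and $T_1\le T$, and let $\zeta\in\mathscr Y_n(T_1)$ have zero mean in $\eta$ and $\zeta(0,\cdot)=0$. If $\zeta$ solves on $[0,T_1]$ $$\partial_\tau\big(B_\varepsilon\zeta\big)+H_\varepsilon(\Psi_\tau)=S\zeta+M_\varepsilon\big((\Psi^2)_\eta\big)+\varepsilon F_\varepsilon\big((\zeta^2)_\eta\big)+2F_\varepsilon\big((\Psi\zeta)_\eta\big),\qquad(\ast)$$ then $$\sup_{\tau\in[0,T_1]}\int_{-\ell_0/2}^{\ell_0/2}|D^n\zeta(\tau,\cdot)|^2d\eta+\varepsilon\sup_{\tau\in[0,T_1]}\int_{-\ell_0/2}^{\ell_0/2}|D^{n+1}\zeta(\tau,\cdot)|^2d\eta\le K_n .$$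
   Context: Fix $\ell_0>0$. Functions are $\ell_0$-periodic on $[-\ell_0/2,\ell_0/2]$, and $D=D_\eta$. $\{w_k\}$ is the orthonormal eigenbasis of $D_{\eta\eta}$ with periodic boundary conditions, $D_{\eta\eta}w_k=-\lambda_kw_k$, $\lambda_0=0$, $\lambda_{2j-1}=\lambda_{2j}=4\pi^2j^2/\ell_0^2$. $H^s_\sharp$ is the periodic Sobolev space. An operator with symbol $(c_k)$ acts by $\widehat{(\mathscr Cf)}(k)=c_k\widehat f(k)$. With $X_{\varepsilon,k}=\sqrt{1+4\varepsilon\lambda_k}$, the operators $B_\varepsilon,F_\varepsilon,H_\varepsilon,M_\varepsilon$ have the symbols $$b_{\varepsilon,k}=X_{\varepsilon,k}^2+(1+\varepsilon)X_{\varepsilon,k}-1-\varepsilon,\qquad f_{\varepsilon,k}=\tfrac14(X_{\varepsilon,k}^3-3X_{\varepsilon,k}^2-4(1+\varepsilon)X_{\varepsilon,k}+4+4\varepsilon),$$ $$h_{\varepsilon,k}=\tfrac1\varepsilon(X_{\varepsilon,k}^2+(1+\varepsilon)X_{\varepsilon,k}-2-\varepsilon),\qquad m_{\varepsilon,k}=\tfrac1{4\varepsilon}(X_{\varepsilon,k}^3-3X_{\varepsilon,k}^2-4(1+\varepsilon)X_{\varepsilon,k}+6+4\varepsilon),$$ and $S=-4D^4-D^2$. For $T_1>0$, $$\mathscr Y_n(T_1)=\{\zeta\in C([0,T_1];H^{\max(4,2n)}_\sharp)\cap C^1([0,T_1];L^2):\ \zeta_\tau\in C([0,T_1];H^{\max(2,n+1)}_\sharp)\}.$$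 *)

(* Defs.v *)
From Stdlib Require Import Reals Lra Lia ClassicalEpsilon.
Open Scope R_scope.

(* Riemann integral of f on [a,b] (0 if f is not Riemann integrable;
   well defined since RiemannInt does not depend on the proof). *)
Definition Rint (f : R -> R) (a b : R) : R :=
  epsilon (inhabits 0) (fun l => exists pr : Riemann_integrable f a b, RiemannInt pr = l).

(* Sum of a convergent series (0 if it diverges). *)
Definition series_lim (u : nat -> R) : R :=
  epsilon (inhabits 0) (fun l => Un_cv (fun N => sum_f_R0 u N) l).

(* Classical derivative in eta (0 where not derivable) and its iterates D^n. *)
Definition dx (f : R -> R) : R -> R :=
  fun x => epsilon (inhabits 0) (fun l => derivable_pt_lim f x l).
Definition dxn (n : nat) (f : R -> R) : R -> R := Nat.iter n dx f.

(* index j with lambda_{2j-1} = lambda_{2j} = 4 pi^2 j^2 / l0^2 *)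
Definition jidx (k : nat) : nat := Nat.div (S k) 2.

(* lambda_k, eigenvalues of -D_{eta eta} with periodic b.c. *)
Definition lam (l0 : R) (k : nat) : R :=
  4 * PI ^ 2 * (INR (jidx k)) ^ 2 / l0 ^ 2.

(* orthonormal eigenbasis w_k *)
Definition wk (l0 : R) (k : nat) (x : R) : R :=
  match k with
  | O => / sqrt l0
  | _ => if Nat.odd k
         then sqrt (2 / l0) * cos (2 * PI * INR (jidx k) * x / l0)
         else sqrt (2 / l0) * sin (2 * PI * INR (jidx k) * x / l0)
  end.

Definition fcoef (l0 : R) (f : R -> R) (k : nat) : R :=
  Rint (fun x => f x * wk l0 k x) (- l0 / 2) (l0 / 2).

Definition periodic (l0 : R) (f : R -> R) : Prop := forall x, f (x + l0) = f x.

Definition L2norm2 (l0 : R) (f : R -> R) : R :=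
  Rint (fun x => (f x) ^ 2) (- l0 / 2) (l0 / 2).

Definition hs_term (l0 : R) (s : nat) (f : R -> R) (k : nat) : R :=
  (1 + lam l0 k) ^ s * (fcoef l0 f k) ^ 2.
Definition Hs_norm2 (l0 : R) (s : nat) (f : R -> R) : R :=
  series_lim (hs_term l0 s f).

(* f in H^s_sharp (represented by its continuous periodic representative;
   all H^s used here have s >= 2, hence embed in continuous functions) *)
Definition In_Hs (l0 : R) (s : nat) (f : R -> R) : Prop :=
  periodic l0 f /\ (forall x, continuity_pt f x) /\
  exists l, Un_cv (fun N => sum_f_R0 (hs_term l0 s f) N) l.

Definition CtHs (l0 : R) (s : nat) (a b : R) (u : R -> R -> R) : Prop :=
  (forall t, a <= t <= b -> In_Hs l0 s (u t)) /\
  (forall t0, a <= t0 <= b -> forall e, 0 < e -> exists d, 0 < d /\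
     forall t, a <= t <= b -> Rabs (t - t0) < d ->
       Hs_norm2 l0 s (fun x => u t x - u t0 x) < e).

Definition C1tL2 (l0 : R) (a b : R) (u ut : R -> R -> R) : Prop :=
  (forall t0, a <= t0 <= b -> forall e, 0 < e -> exists d, 0 < d /\
     forall t, a <= t <= b -> 0 < Rabs (t - t0) < d ->
       L2norm2 l0 (fun x => (u t x - u t0 x) / (t - t0) - ut t0 x) < e) /\
  (forall t0, a <= t0 <= b -> forall e, 0 < e -> exists d, 0 < d /\
     forall t, a <= t <= b -> Rabs (t - t0) < d ->
       L2norm2 l0 (fun x => ut t x - ut t0 x) < e).

Definition Yn (l0 : R) (n : nat) (T1 : R) (zeta zetat : R -> R -> R) : Prop :=
  CtHs l0 (Nat.max 4 (2 * n)) 0 T1 zeta /\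
  C1tL2 l0 0 T1 zeta zetat /\
  CtHs l0 (Nat.max 2 (n + 1)) 0 T1 zetat.

Definition Xe (l0 eps : R) (k : nat) : R := sqrt (1 + 4 * eps * lam l0 k).

Definition b_sym (l0 eps : R) (k : nat) : R :=
  let X := Xe l0 eps k in X ^ 2 + (1 + eps) * X - 1 - eps.
Definition f_sym (l0 eps : R) (k : nat) : R :=
  let X := Xe l0 eps k in / 4 * (X ^ 3 - 3 * X ^ 2 - 4 * (1 + eps) * X + 4 + 4 * eps).
Definition h_sym (l0 eps : R) (k : nat) : R :=
  let X := Xe l0 eps k in / eps * (X ^ 2 + (1 + eps) * X - 2 - eps).
Definition m_sym (l0 eps : R) (k : nat) : R :=
  let X := Xe l0 eps k in / (4 * eps) * (X ^ 3 - 3 * X ^ 2 - 4 * (1 + eps) * X + 6 + 4 * eps).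
(* S = -4 D^4 - D^2 ; D^2 has symbol -lambda_k *)
Definition s_sym (l0 : R) (k : nat) : R := - 4 * (lam l0 k) ^ 2 + lam l0 k.

Definition KS_solution (l0 T : R) (Phi Psi : R -> R -> R) : Prop :=
  (forall t, 0 <= t <= T -> periodic l0 (Phi t)) /\
  (forall t x, 0 <= t <= T -> derivable_pt_lim (Phi t) x (Psi t x)) /\
  exists Phit : R -> R -> R,
    (forall x t0, 0 <= t0 <= T -> forall e, 0 < e -> exists d, 0 < d /\
       forall t, 0 <= t <= T -> 0 < Rabs (t - t0) < d ->
         Rabs ((Phi t x - Phi t0 x) / (t - t0) - Phit t0 x) < e) /\
    (forall t x, 0 <= t <= T ->
       Phit t x + 4 * dxn 3 (Psi t) x + dx (Psi t) x + / 2 * (Psi t x) ^ 2 = 0).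

(** Equation (star) written on the Fourier side (operators act by symbols):
    d_tau(B_eps zeta) + H_eps(Psi_tau) = S zeta + M_eps((Psi^2)_eta)
       + eps F_eps((zeta^2)_eta) + 2 F_eps((Psi zeta)_eta)   on [0,T1]. *)
Definition eq_star (l0 eps T1 : R) (Psi Psit zeta zetat : R -> R -> R) : Prop :=
  forall t k, 0 <= t <= T1 ->
    b_sym l0 eps k * fcoef l0 (zetat t) k + h_sym l0 eps k * fcoef l0 (Psit t) k
    = s_sym l0 k * fcoef l0 (zeta t) k
      + m_sym l0 eps k * fcoef l0 (dx (fun x => (Psi t x) ^ 2)) k
      + eps * f_sym l0 eps k * fcoef l0 (dx (fun x => (zeta t x) ^ 2)) k
      + 2 * f_sym l0 eps k * fcoef l0 (dx (fun x => Psi t x * zeta t x)) k.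

(* Main.v *)
Require Import Defs.
From Stdlib Require Import Reals Lra Lia Psatz ZArith ClassicalEpsilon FunctionalExtensionality.
From Coquelicot Require Import Coquelicot.
Open Scope R_scope.

(** Let [z_k] be the Fourier coefficients of [zeta], [W_k = 1 + lambda_k], and consider the energy
    [E = sum_k W_k^n b_k z_k^2], which dominates both terms of the estimate because
    [b_k >= 1] and [b_k >= eps W_k].  For [eps <= 1] the symbols satisfy [s <= - 3 W^2 + 16],
    [0 <= h <= 8 W], [m^2 <= 256 W^3], [f^2 <= 1600 W^3] and [f^2 <= 100 + 6400 eps^3 W^3].
    Pairing the equation with [W_k^n z_k] and using Young's inequality leaves a multiple of the
    dissipation [D = ||zeta||^2_{n+2}] to absorb the terms containing [zeta^2] and [Psi zeta].
    By the product estimate [||f g||_{n+2} <= C (||f||_{n+2} ||g||_{n+1} + ||f||_{n+1} ||g||_{n+2})]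
    the quadratic term contributes at most [C eps^2 ||zeta||^2_{n+1} D <= C eps E D].  Hence
    [E' <= K (1 + E)], with [K] independent of [eps], as long as [eps E] is small, and a continuity
    argument starting from [E(0) = 0] bounds [E] by [exp ((K + 1) T)] on the whole interval.
    The product estimate is proved for trigonometric polynomials with the Leibniz rule and the
    embedding of [H^1] into the bounded functions, and passes to the limit. *)

(** * Integrals and series *)

(** Three difficulties shape the proof. The symbol [f] grows like [eps^(3/2) lambda^(3/2)] and the
    derivative adds half a power of [lambda], so both products have exactly the order of the
    dissipation and can be absorbed only through small coefficients. For [Psi * zeta], whose
    coefficient carries no [eps], [f^2] is split: the growing part brings [eps^3], the bounded part
    is beaten by adding a large constant [kp] to the Young weight, at the price of a larger [K]. For
    [zeta^2] smallness needs a bound on [eps * E], hence the continuity argument. This dictates the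
    order of choice: [C0] and the bounds [P], [P'] on [Psi] and its time derivative; then [kp], [K]
    and [M = exp ((K + 1) * T)]; only then [eps1], so nothing is circular. Finally, [E] is an
    infinite series that is never differentiated in time: only its partial sums are, with increments
    controlled uniformly in the number of terms, and [bootstrap] works with their supremum. *)

Definition cts (f : R -> R) : Prop := forall x, continuity_pt f x.

Lemma cts_continuous (f : R -> R) (x : R) : cts f -> continuous f x.
Proof. intros H. apply continuity_pt_filterlim, H. Qed.

Lemma cts_const (c : R) : cts (fun _ => c).
Proof. intro x. apply continuity_pt_const. intros a b. reflexivity. Qed.

Lemma cts_id : cts (fun x => x).
Proof. intro x. apply derivable_continuous_pt, derivable_pt_id. Qed.

Lemma cts_plus (f g : R -> R) : cts f -> cts g -> cts (fun x => f x + g x).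
Proof. intros Hf Hg x. now apply (continuity_pt_plus f g). Qed.

Lemma cts_minus (f g : R -> R) : cts f -> cts g -> cts (fun x => f x - g x).
Proof. intros Hf Hg x. now apply (continuity_pt_minus f g). Qed.

Lemma cts_opp (f : R -> R) : cts f -> cts (fun x => - f x).
Proof. intros Hf x. now apply (continuity_pt_opp f). Qed.

Lemma cts_mult (f g : R -> R) : cts f -> cts g -> cts (fun x => f x * g x).
Proof. intros Hf Hg x. now apply (continuity_pt_mult f g). Qed.

Lemma cts_div_const (f : R -> R) (c : R) : cts f -> cts (fun x => f x / c).
Proof. intros Hf. apply (cts_mult f (fun _ => / c) Hf (cts_const _)). Qed.

Lemma cts_pow (f : R -> R) (n : nat) : cts f -> cts (fun x => f x ^ n).
Proof.
  intros Hf. induction n as [|n IH]; simpl.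
  - apply cts_const.
  - now apply cts_mult.
Qed.

Lemma cts_comp (f g : R -> R) : cts f -> cts g -> cts (fun x => g (f x)).
Proof. intros Hf Hg x. apply (continuity_pt_comp f g); [apply Hf | apply Hg]. Qed.

Lemma cts_cos (f : R -> R) : cts f -> cts (fun x => cos (f x)).
Proof. intros Hf. apply (cts_comp f cos Hf). intro x. apply continuity_cos. Qed.

Lemma cts_sin (f : R -> R) : cts f -> cts (fun x => sin (f x)).
Proof. intros Hf. apply (cts_comp f sin Hf). intro x. apply continuity_sin. Qed.

Lemma cts_sum (f : nat -> R -> R) (N : nat) :
  (forall k, cts (f k)) -> cts (fun x => sum_f_R0 (fun k => f k x) N).
Proof.
  intros Hf. induction N as [|N IH]; simpl.
  - apply Hf.
  - now apply cts_plus.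
Qed.

Lemma derivable_cts (f f' : R -> R) : (forall x, derivable_pt_lim f x (f' x)) -> cts f.
Proof.
  intros H x. apply derivable_continuous_pt. exists (f' x). apply H.
Qed.

Create HintDb cts.
#[global] Hint Resolve cts_const cts_id cts_plus cts_minus cts_opp cts_mult cts_div_const cts_pow
  cts_cos cts_sin cts_sum : cts.

Lemma cts_ex_RInt (f : R -> R) (a b : R) : cts f -> ex_RInt f a b.
Proof.
  intros H. apply (ex_RInt_continuous (V := R_CompleteNormedModule)).
  intros z _. now apply cts_continuous.
Qed.

(** Continuity supplies one integrability proof, which makes the [epsilon] in [Rint] meaningful; the
    value does not depend on which proof the choice picks. *)
Lemma Rint_RInt (f : R -> R) (a b : R) : cts f -> Rint f a b = RInt f a b.
Proof.
  intros H. unfold Rint.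
  pose proof (ex_RInt_Reals_0 f a b (cts_ex_RInt f a b H)) as pr.
  assert (He : exists l, exists pr : Riemann_integrable f a b, RiemannInt pr = l)
    by (exists (RiemannInt pr), pr; reflexivity).
  apply epsilon_spec with (i := inhabits 0) in He.
  destruct He as [pr' Hl]. rewrite <- Hl. symmetry. apply RInt_Reals.
Qed.

Lemma RInt_plus_cts (f g : R -> R) (a b : R) : cts f -> cts g ->
  RInt (fun x => f x + g x) a b = RInt f a b + RInt g a b.
Proof. intros. apply (RInt_plus (V := R_CompleteNormedModule)); now apply cts_ex_RInt. Qed.

Lemma RInt_minus_cts (f g : R -> R) (a b : R) : cts f -> cts g ->
  RInt (fun x => f x - g x) a b = RInt f a b - RInt g a b.
Proof. intros. apply (RInt_minus (V := R_CompleteNormedModule)); now apply cts_ex_RInt. Qed.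

Lemma RInt_scal_cts (f : R -> R) (c a b : R) : cts f ->
  RInt (fun x => c * f x) a b = c * RInt f a b.
Proof. intros. apply (RInt_scal (V := R_CompleteNormedModule)); now apply cts_ex_RInt. Qed.

Lemma RInt_const_R (c a b : R) : RInt (fun _ => c) a b = c * (b - a).
Proof. rewrite RInt_const. unfold scal; simpl; unfold mult; simpl. ring. Qed.

Lemma RInt_ext_all (f g : R -> R) (a b : R) : (forall x, f x = g x) -> RInt f a b = RInt g a b.
Proof. intros H. apply RInt_ext. intros; apply H. Qed.

Lemma RInt_sum_cts (f : nat -> R -> R) (a b : R) (N : nat) : (forall k, cts (f k)) ->
  RInt (fun x => sum_f_R0 (fun k => f k x) N) a b = sum_f_R0 (fun k => RInt (f k) a b) N.
Proof.
  intros Hf. induction N as [|N IH]; simpl.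
  - reflexivity.
  - rewrite (RInt_plus_cts _ (f (S N))), IH by auto with cts. reflexivity.
Qed.

Lemma RInt_le_cts (f g : R -> R) (a b : R) : a <= b -> cts f -> cts g ->
  (forall x, a <= x <= b -> f x <= g x) -> RInt f a b <= RInt g a b.
Proof.
  intros Hab Hf Hg H. apply RInt_le; auto using cts_ex_RInt.
  intros x Hx. apply H. lra.
Qed.

Lemma RInt_ge0_cts (f : R -> R) (a b : R) : a <= b -> cts f ->
  (forall x, a <= x <= b -> 0 <= f x) -> 0 <= RInt f a b.
Proof.
  intros Hab Hf H. replace 0 with (RInt (fun _ => 0) a b).
  - apply RInt_le_cts; auto with cts.
  - rewrite RInt_const_R. apply Rmult_0_l.
Qed.

Lemma RInt_Chasles_cts (f : R -> R) (a b c : R) : cts f ->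
  RInt f a b + RInt f b c = RInt f a c.
Proof.
  intros Hf. apply (RInt_Chasles (V := R_CompleteNormedModule)); now apply cts_ex_RInt.
Qed.

Lemma RInt_derivative (f f' : R -> R) (a b : R) :
  (forall x, derivable_pt_lim f x (f' x)) -> cts f' -> RInt f' a b = f b - f a.
Proof.
  intros Hd Hc. apply is_RInt_unique.
  apply (is_RInt_derive (V := R_CompleteNormedModule) f f').
  - intros x _. apply is_derive_Reals, Hd.
  - intros x _. now apply cts_continuous.
Qed.

Lemma sum_mult_l (u : nat -> R) (c : R) (N : nat) :
  sum_f_R0 (fun k => c * u k) N = c * sum_f_R0 u N.
Proof. induction N as [|N IH]; simpl; [ring | rewrite IH; ring]. Qed.

Lemma sum_nonneg (u : nat -> R) (N : nat) : (forall k, 0 <= u k) -> 0 <= sum_f_R0 u N.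
Proof. intros H. induction N as [|N IH]; simpl; [apply H | specialize (H (S N)); lra]. Qed.

Lemma sum_le_compat (u v : nat -> R) (N : nat) :
  (forall k, u k <= v k) -> sum_f_R0 u N <= sum_f_R0 v N.
Proof. intros H. induction N as [|N IH]; simpl; [apply H | specialize (H (S N)); lra]. Qed.

Lemma sum_le_index (u : nat -> R) (N M : nat) : (forall k, 0 <= u k) -> (N <= M)%nat ->
  sum_f_R0 u N <= sum_f_R0 u M.
Proof.
  intros H HNM. induction HNM as [|M HNM IH]; simpl; [lra | specialize (H (S M)); lra].
Qed.

Lemma sum_Cauchy_Schwarz (u v : nat -> R) (N : nat) :
  sum_f_R0 (fun k => u k * v k) N ^ 2
  <= sum_f_R0 (fun k => u k ^ 2) N * sum_f_R0 (fun k => v k ^ 2) N.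
Proof.
  induction N as [|N IH]; cbn [sum_f_R0]; [nra |].
  set (s := sum_f_R0 (fun k => u k * v k) N) in *.
  assert (Ha : 0 <= sum_f_R0 (fun k => u k ^ 2) N) by (apply sum_nonneg; intro; apply pow2_ge_0).
  assert (Hb : 0 <= sum_f_R0 (fun k => v k ^ 2) N) by (apply sum_nonneg; intro; apply pow2_ge_0).
  set (a := sum_f_R0 (fun k => u k ^ 2) N) in *. set (b := sum_f_R0 (fun k => v k ^ 2) N) in *.
  generalize (u (S N)) (v (S N)). intros p q.
  (* With the sums written as squares [al^2] and [be^2], the induction hypothesis reads
     [|s| <= al * be], and the cross term [2 s p q] is absorbed by [(al |q| - be |p|)^2 >= 0]. *)
  rewrite <- (pow2_sqrt a Ha), <- (pow2_sqrt b Hb) in *.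
  generalize (sqrt_pos a) (sqrt_pos b) IH. generalize (sqrt a) (sqrt b). intros al be Hal Hbe Hs.
  assert (Hs2 : Rabs s <= al * be).
  { apply Rsqr_incr_0_var; [| nra]. rewrite <- Rsqr_abs. unfold Rsqr. lra. }
  assert (Hs3 : s * (p * q) <= (al * be) * (Rabs p * Rabs q)).
  { apply Rle_trans with (Rabs (s * (p * q))); [apply Rle_abs |].
    rewrite !Rabs_mult. apply Rmult_le_compat_r; [| lra].
    apply Rmult_le_pos; apply Rabs_pos. }
  assert (Hp : Rabs p ^ 2 = p ^ 2) by apply pow2_abs.
  assert (Hq : Rabs q ^ 2 = q ^ 2) by apply pow2_abs.
  rewrite <- Hp, <- Hq. replace ((s + p * q) ^ 2) with (s ^ 2 + 2 * (s * (p * q)) + p ^ 2 * q ^ 2) by ring.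
  rewrite <- Hp, <- Hq.
  pose proof (pow2_ge_0 (al * Rabs q - be * Rabs p)). nra.
Qed.

Lemma sum_lim (u : nat -> nat -> R) (l : nat -> R) (N : nat) :
  (forall k, Un_cv (fun m => u m k) (l k)) ->
  Un_cv (fun m => sum_f_R0 (u m) N) (sum_f_R0 l N).
Proof.
  intros H. induction N as [|N IH]; simpl.
  - apply H.
  - now apply (CV_plus (fun m => sum_f_R0 (u m) N)).
Qed.

Lemma Un_cv_le_const (u : nat -> R) (l c : R) : Un_cv u l -> (forall n, u n <= c) -> l <= c.
Proof.
  intros Hu H. destruct (Rle_dec l c) as [|Hn]; [assumption |].
  destruct (Hu (l - c) ltac:(lra)) as [N HN].
  specialize (HN N (le_n _)). specialize (H N). unfold Rdist in HN.
  apply Rabs_def2 in HN. lra.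
Qed.

Lemma series_lim_cv (u : nat -> R) (l : R) :
  Un_cv (fun N => sum_f_R0 u N) l -> series_lim u = l.
Proof.
  intros H. unfold series_lim.
  assert (He : exists l, Un_cv (fun N => sum_f_R0 u N) l) by now exists l.
  apply epsilon_spec with (i := inhabits 0) in He. cbv beta in He.
  exact (UL_sequence _ _ _ He H).
Qed.

Lemma series_lim_spec (u : nat -> R) (B : R) :
  (forall k, 0 <= u k) -> (forall N, sum_f_R0 u N <= B) ->
  Un_cv (fun N => sum_f_R0 u N) (series_lim u).
Proof.
  intros Hu HB.
  destruct (growing_cv (fun N => sum_f_R0 u N)) as [l Hl].
  - intro N. simpl. specialize (Hu (S N)). lra.
  - exists B. intros y [N ->]. apply HB.
  - now rewrite (series_lim_cv u l Hl).
Qed.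

Lemma sum_le_series_lim (u : nat -> R) (B : R) (N : nat) :
  (forall k, 0 <= u k) -> (forall N, sum_f_R0 u N <= B) -> sum_f_R0 u N <= series_lim u.
Proof.
  intros Hu HB. pose proof (series_lim_spec u B Hu HB) as Hl.
  apply (growing_ineq (fun N => sum_f_R0 u N)); [| assumption].
  intro M. simpl. specialize (Hu (S M)). lra.
Qed.

Lemma series_lim_le (u : nat -> R) (B : R) :
  (forall k, 0 <= u k) -> (forall N, sum_f_R0 u N <= B) -> series_lim u <= B.
Proof.
  intros Hu HB. exact (Un_cv_le_const _ _ _ (series_lim_spec u B Hu HB) HB).
Qed.

Lemma dx_eq (f : R -> R) (x l : R) : derivable_pt_lim f x l -> dx f x = l.
Proof.
  intros H. unfold dx.
  assert (He : exists l, derivable_pt_lim f x l) by now exists l.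
  apply epsilon_spec with (i := inhabits 0) in He. cbv beta in He.
  exact (uniqueness_limite f x _ _ He H).
Qed.

(** * The eigenbasis *)

Lemma jidx_odd (i : nat) : jidx (S (2 * i)) = S i.
Proof.
  unfold jidx. replace (S (S (2 * i))) with (S i * 2)%nat by lia. now apply Nat.div_mul.
Qed.

Lemma jidx_even (i : nat) : jidx (S (S (2 * i))) = S i.
Proof.
  unfold jidx. replace (S (S (S (2 * i)))) with (1 + S i * 2)%nat by lia.
  now rewrite Nat.div_add.
Qed.

Lemma odd_S_double (i : nat) : Nat.odd (S (2 * i)) = true.
Proof. rewrite Nat.odd_succ. apply Nat.even_spec. now exists i. Qed.

Lemma odd_SS_double (i : nat) : Nat.odd (S (S (2 * i))) = false.
Proof. rewrite Nat.odd_succ, Nat.even_succ, <- Nat.negb_even. apply Bool.negb_false_iff, Nat.even_spec. now exists i. Qed.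

(** The constant mode, then the cosine at [S (2 * i)] and the sine at [S (S (2 * i))], both of
    frequency [S i]: this case split removes [Nat.odd] and [Nat.div] from the basis. *)
Lemma mode_cases (P : nat -> Prop) :
  P O -> (forall i, P (S (2 * i))) -> (forall i, P (S (S (2 * i)))) -> forall k, P k.
Proof.
  intros H0 H1 H2 k. destruct (Nat.Even_or_Odd k) as [[i ->] | [i ->]].
  - destruct i as [|i]; [assumption |].
    replace (2 * S i)%nat with (S (S (2 * i))) by lia. apply H2.
  - replace (2 * i + 1)%nat with (S (2 * i)) by lia. apply H1.
Qed.

(* The mode spanned by the derivative of [wk l0 k]: the sine and cosine of a frequency are swapped. *)
Definition partner (k : nat) : nat :=
  match k with
  | O => O
  | S i => if Nat.odd k then S k else i
  end.

Lemma partner_odd (i : nat) : partner (S (2 * i)) = S (S (2 * i)).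
Proof. unfold partner. now rewrite odd_S_double. Qed.

Lemma partner_even (i : nat) : partner (S (S (2 * i))) = S (2 * i).
Proof. unfold partner. now rewrite odd_SS_double. Qed.

Lemma partner_involutive (k : nat) : partner (partner k) = k.
Proof.
  pattern k. apply mode_cases; [reflexivity | |]; intro i; now rewrite ?partner_odd, ?partner_even, ?partner_odd.
Qed.

(** The indices up to [2 * N] consist of the constant mode and complete cosine-sine pairs, so
    [partner] permutes them. This is why many partial sums below stop at an even index. *)
Lemma sum_partner (u : nat -> R) (N : nat) :
  sum_f_R0 (fun k => u (partner k)) (2 * N) = sum_f_R0 u (2 * N).
Proof.
  induction N as [|N IH]; [reflexivity |].
  replace (2 * S N)%nat with (S (S (2 * N))) by lia.
  cbn [sum_f_R0]. rewrite IH, partner_odd, partner_even. ring.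
Qed.

Section Basis.
Context (l0 : R) (l0_pos : 0 < l0).

Definition freq (k : nat) : R := 2 * PI * INR (jidx k) / l0.

(** In a real basis the derivative is not diagonal; it mixes each cosine-sine pair. The sign is the
    one for which the derivative of [wk k] is [dsym k] times [wk (partner k)]. *)
Definition dsym (k : nat) : R := if Nat.odd k then - freq k else freq k.

Definition weight (k : nat) : R := 1 + lam l0 k.
Local Notation W := weight.

Lemma lam_freq (k : nat) : lam l0 k = freq k ^ 2.
Proof. unfold lam, freq. field. lra. Qed.

Lemma dsym_sqr (k : nat) : dsym k ^ 2 = lam l0 k.
Proof. rewrite lam_freq. unfold dsym. destruct (Nat.odd k); ring. Qed.

Lemma lam_ge0 (k : nat) : 0 <= lam l0 k.
Proof. rewrite lam_freq. apply pow2_ge_0. Qed.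

Lemma W_ge1 (k : nat) : 1 <= W k.
Proof. unfold W. pose proof (lam_ge0 k). lra. Qed.

Lemma W_pow_ge1 (s k : nat) : 1 <= W k ^ s.
Proof. apply pow_R1_Rle, W_ge1. Qed.

Lemma jidx_partner (k : nat) : jidx (partner k) = jidx k.
Proof.
  pattern k. apply mode_cases; [reflexivity | |]; intro i;
    now rewrite ?partner_odd, ?partner_even, jidx_odd, jidx_even.
Qed.

Lemma lam_partner (k : nat) : lam l0 (partner k) = lam l0 k.
Proof. unfold lam. now rewrite jidx_partner. Qed.

Lemma W_partner (k : nat) : W (partner k) = W k.
Proof. unfold W. now rewrite lam_partner. Qed.

(** Skew-symmetry of the derivative on each pair; for the constant mode both sides vanish with the
    frequency. *)
Lemma dsym_partner (k : nat) : dsym (partner k) = - dsym k.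
Proof.
  unfold dsym, freq. rewrite jidx_partner. pattern k. apply mode_cases.
  - cbn. unfold Rdiv. ring.
  - intro i. rewrite partner_odd, odd_S_double, odd_SS_double. ring.
  - intro i. rewrite partner_even, odd_S_double, odd_SS_double. ring.
Qed.

Lemma wk_cos (i : nat) (x : R) :
  wk l0 (S (2 * i)) x = sqrt (2 / l0) * cos (2 * PI * INR (S i) * x / l0).
Proof. unfold wk. now rewrite odd_S_double, jidx_odd. Qed.

Lemma wk_sin (i : nat) (x : R) :
  wk l0 (S (S (2 * i))) x = sqrt (2 / l0) * sin (2 * PI * INR (S i) * x / l0).
Proof. unfold wk. now rewrite odd_SS_double, jidx_even. Qed.

Lemma cts_wk (k : nat) : cts (wk l0 k).
Proof.
  pattern k. apply mode_cases.
  - apply cts_const.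
  - intro i. rewrite (functional_extensionality _ _ (wk_cos i)). auto 10 with cts.
  - intro i. rewrite (functional_extensionality _ _ (wk_sin i)). auto 10 with cts.
Qed.

Lemma wk_bound (k : nat) (x : R) : Rabs (wk l0 k x) <= sqrt (2 / l0).
Proof.
  assert (Hp : 0 <= sqrt (2 / l0)) by apply sqrt_pos.
  pattern k. apply mode_cases.
  - cbn. rewrite Rabs_pos_eq.
    + rewrite <- sqrt_inv. apply sqrt_le_1_alt. unfold Rdiv.
      assert (0 < / l0) by now apply Rinv_0_lt_compat. lra.
    + left. apply Rinv_0_lt_compat, sqrt_lt_R0, l0_pos.
  - intro i. rewrite wk_cos, Rabs_mult, Rabs_pos_eq by assumption.
    rewrite <- (Rmult_1_r (sqrt _)) at 2. apply Rmult_le_compat_l; [assumption |].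
    apply Rabs_le, COS_bound.
  - intro i. rewrite wk_sin, Rabs_mult, Rabs_pos_eq by assumption.
    rewrite <- (Rmult_1_r (sqrt _)) at 2. apply Rmult_le_compat_l; [assumption |].
    apply Rabs_le, SIN_bound.
Qed.

Lemma wk_derivative (k : nat) (x : R) :
  derivable_pt_lim (wk l0 k) x (dsym k * wk l0 (partner k) x).
Proof.
  revert x. pattern k. apply mode_cases.
  - intro x. cbn. unfold dsym, freq. cbn. unfold Rdiv. rewrite Rmult_0_r, !Rmult_0_l.
    apply derivable_pt_lim_const.
  - intros i x. rewrite (functional_extensionality _ _ (wk_cos i)), partner_odd, wk_sin.
    unfold dsym, freq. rewrite odd_S_double, jidx_odd. apply is_derive_Reals.
    generalize (INR (S i)). intro m. auto_derive; [trivial | unfold Rdiv; ring].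
  - intros i x. rewrite (functional_extensionality _ _ (wk_sin i)), partner_even, wk_cos.
    unfold dsym, freq. rewrite odd_SS_double, jidx_even. apply is_derive_Reals.
    generalize (INR (S i)). intro m. auto_derive; [trivial | unfold Rdiv; ring].
Qed.

Lemma cos_shift_Z (y : R) (z : Z) : cos (y + 2 * IZR z * PI) = cos y.
Proof.
  destruct (Z.le_gt_cases 0 z) as [Hz | Hz].
  - rewrite <- (Z2Nat.id z Hz), <- INR_IZR_INZ. apply cos_period.
  - set (k := Z.to_nat (- z)).
    rewrite <- (cos_period (y + 2 * IZR z * PI) k). f_equal.
    unfold k. rewrite INR_IZR_INZ, Z2Nat.id, opp_IZR by lia. ring.
Qed.

Lemma sin_shift_Z (y : R) (z : Z) : sin (y + 2 * IZR z * PI) = sin y.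
Proof.
  rewrite <- !cos_shift. rewrite <- (cos_shift_Z (PI / 2 - y) (- z)), opp_IZR. f_equal. ring.
Qed.

Lemma wk_periodic (k : nat) : periodic l0 (wk l0 k).
Proof.
  intro x. pattern k. apply mode_cases.
  - reflexivity.
  - intro i. rewrite !wk_cos. f_equal.
    rewrite <- (cos_shift_Z (2 * PI * INR (S i) * x / l0) (Z.of_nat (S i))), <- INR_IZR_INZ.
    f_equal. field. lra.
  - intro i. rewrite !wk_sin. f_equal.
    rewrite <- (sin_shift_Z (2 * PI * INR (S i) * x / l0) (Z.of_nat (S i))), <- INR_IZR_INZ.
    f_equal. field. lra.
Qed.

Definition period_int (f : R -> R) : R := RInt f (- l0 / 2) (l0 / 2).
Local Notation pint := period_int.

(** For [z <> 0] a primitive takes equal values at the two ends of the period, whose arguments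
    differ by [2 * z * PI]. *)
Lemma pint_cos (z : Z) :
  pint (fun x => cos (2 * PI * IZR z * x / l0)) = if Z.eq_dec z 0 then l0 else 0.
Proof.
  unfold pint. destruct (Z.eq_dec z 0) as [-> | Hz].
  - rewrite (RInt_ext_all _ (fun _ => 1)).
    + rewrite RInt_const_R. field.
    + intro x. replace (2 * PI * 0 * x / l0) with 0 by (unfold Rdiv; ring). apply cos_0.
  - assert (IZR z <> 0) by now apply not_0_IZR.
    rewrite (RInt_derivative (fun x => l0 / (2 * PI * IZR z) * sin (2 * PI * IZR z * x / l0))).
    + replace (2 * PI * IZR z * (l0 / 2) / l0)
        with (2 * PI * IZR z * (- l0 / 2) / l0 + 2 * IZR z * PI) by (field; lra).
      rewrite sin_shift_Z. ring.
    + intro x. apply is_derive_Reals. auto_derive; [trivial |].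
      unfold Rdiv. field. repeat split; trivial; try lra. apply PI_neq0.
    + auto 10 with cts.
Qed.

Lemma pint_sin (z : Z) : pint (fun x => sin (2 * PI * IZR z * x / l0)) = 0.
Proof.
  unfold pint. destruct (Z.eq_dec z 0) as [-> | Hz].
  - rewrite (RInt_ext_all _ (fun _ => 0)).
    + rewrite RInt_const_R. apply Rmult_0_l.
    + intro x. replace (2 * PI * 0 * x / l0) with 0 by (unfold Rdiv; ring). apply sin_0.
  - assert (IZR z <> 0) by now apply not_0_IZR.
    rewrite (RInt_derivative (fun x => - l0 / (2 * PI * IZR z) * cos (2 * PI * IZR z * x / l0))).
    + replace (2 * PI * IZR z * (l0 / 2) / l0)
        with (2 * PI * IZR z * (- l0 / 2) / l0 + 2 * IZR z * PI) by (field; lra).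
      rewrite cos_shift_Z. ring.
    + intro x. apply is_derive_Reals. auto_derive; [trivial |].
      unfold Rdiv. field. repeat split; trivial; try lra. apply PI_neq0.
    + auto 10 with cts.
Qed.

(** Frequencies range over the integers so that the family is closed under the shifts [p + q] and
    [p - q] of the product-to-sum formulas. *)
Definition cosz (z : Z) (x : R) : R := cos (2 * PI * IZR z * x / l0).
Local Notation cz := cosz.
Definition sinz (z : Z) (x : R) : R := sin (2 * PI * IZR z * x / l0).
Local Notation sz := sinz.

Lemma cts_cz (z : Z) : cts (cz z).
Proof. unfold cz. auto 10 with cts. Qed.
Lemma cts_sz (z : Z) : cts (sz z).
Proof. unfold sz. auto 10 with cts. Qed.
Local Hint Resolve cts_cz cts_sz cts_wk : cts.

Lemma wk_cz (i : nat) : wk l0 (S (2 * i)) = fun x => sqrt (2 / l0) * cz (Z.of_nat (S i)) x.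
Proof.
  apply functional_extensionality. intro x. rewrite wk_cos. unfold cz. now rewrite <- INR_IZR_INZ.
Qed.
Lemma wk_sz (i : nat) : wk l0 (S (S (2 * i))) = fun x => sqrt (2 / l0) * sz (Z.of_nat (S i)) x.
Proof.
  apply functional_extensionality. intro x. rewrite wk_sin. unfold sz. now rewrite <- INR_IZR_INZ.
Qed.

Lemma cz_add (p q : Z) (x : R) : cz (p + q) x = cz p x * cz q x - sz p x * sz q x.
Proof.
  unfold cz, sz. rewrite plus_IZR, <- cos_plus. f_equal. field. lra.
Qed.
Lemma cz_sub (p q : Z) (x : R) : cz (p - q) x = cz p x * cz q x + sz p x * sz q x.
Proof.
  unfold cz, sz. rewrite minus_IZR, <- cos_minus. f_equal. field. lra.
Qed.
Lemma sz_add (p q : Z) (x : R) : sz (p + q) x = sz p x * cz q x + cz p x * sz q x.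
Proof.
  unfold cz, sz. rewrite plus_IZR, <- sin_plus. f_equal. field. lra.
Qed.
Lemma sz_sub (p q : Z) (x : R) : sz (p - q) x = sz p x * cz q x - cz p x * sz q x.
Proof.
  unfold cz, sz. rewrite minus_IZR, <- sin_minus. f_equal. field. lra.
Qed.

Lemma pint_plus (f g : R -> R) : cts f -> cts g -> pint (fun x => f x + g x) = pint f + pint g.
Proof. apply RInt_plus_cts. Qed.
Lemma pint_minus (f g : R -> R) : cts f -> cts g -> pint (fun x => f x - g x) = pint f - pint g.
Proof. apply RInt_minus_cts. Qed.
Lemma pint_scal (f : R -> R) (c : R) : cts f -> pint (fun x => c * f x) = c * pint f.
Proof. apply RInt_scal_cts. Qed.
Lemma pint_ext (f g : R -> R) : (forall x, f x = g x) -> pint f = pint g.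
Proof. apply RInt_ext_all. Qed.
Lemma pint_le (f g : R -> R) : cts f -> cts g ->
  (forall x, - l0 / 2 <= x <= l0 / 2 -> f x <= g x) -> pint f <= pint g.
Proof. apply RInt_le_cts. lra. Qed.
Lemma pint_const (c : R) : pint (fun _ => c) = c * l0.
Proof. unfold pint. rewrite RInt_const_R. field. Qed.
Lemma pint_ge0 (f : R -> R) : cts f -> (forall x, 0 <= f x) -> 0 <= pint f.
Proof. intros. apply RInt_ge0_cts; auto. lra. Qed.

Lemma pint_cz (z : Z) : pint (cz z) = if Z.eq_dec z 0 then l0 else 0.
Proof. apply pint_cos. Qed.
Lemma pint_sz (z : Z) : pint (sz z) = 0.
Proof. apply pint_sin. Qed.

Lemma pint_cz_cz (p q : Z) : pint (fun x => cz p x * cz q x) = / 2 * (pint (cz (p - q)) + pint (cz (p + q))).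
Proof.
  rewrite <- pint_plus, <- pint_scal by auto with cts. apply pint_ext.
  intro x. rewrite cz_sub, cz_add. field.
Qed.
Lemma pint_sz_sz (p q : Z) : pint (fun x => sz p x * sz q x) = / 2 * (pint (cz (p - q)) - pint (cz (p + q))).
Proof.
  rewrite <- pint_minus, <- pint_scal by auto with cts. apply pint_ext.
  intro x. rewrite cz_sub, cz_add. field.
Qed.
Lemma pint_sz_cz (p q : Z) : pint (fun x => sz p x * cz q x) = 0.
Proof.
  rewrite <- (pint_ext (fun x => / 2 * (sz (p - q) x + sz (p + q) x))).
  - rewrite pint_scal, pint_plus, !pint_sz by auto with cts. ring.
  - intro x. rewrite sz_sub, sz_add. field.
Qed.

Lemma sqrt_2l_mult (a b : R) : sqrt (2 / l0) * a * (sqrt (2 / l0) * b) = 2 / l0 * (a * b).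
Proof.
  assert (H : sqrt (2 / l0) * sqrt (2 / l0) = 2 / l0).
  { apply sqrt_sqrt. left. apply Rdiv_lt_0_compat; lra. }
  rewrite <- H at 3. ring.
Qed.

Lemma wk_orthonormal (j k : nat) :
  pint (fun x => wk l0 j x * wk l0 k x) = if Nat.eq_dec j k then 1 else 0.
Proof.
  assert (H0 : forall i, pint (fun x => wk l0 0 x * wk l0 (S (2 * i)) x) = 0).
  { intro i. rewrite wk_cz. cbn [wk].
    rewrite pint_scal, pint_scal, pint_cz by auto with cts.
    destruct (Z.eq_dec _ 0); [lia | ring]. }
  assert (H0' : forall i, pint (fun x => wk l0 0 x * wk l0 (S (S (2 * i))) x) = 0).
  { intro i. rewrite wk_sz. cbn [wk].
    rewrite pint_scal, pint_scal, pint_sz by auto with cts. ring. }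
  assert (Hsc : forall i m, pint (fun x => wk l0 (S (S (2 * i))) x * wk l0 (S (2 * m)) x) = 0).
  { intros i m. rewrite wk_cz, wk_sz.
    rewrite (pint_ext _ (fun x => 2 / l0 * (sz (Z.of_nat (S i)) x * cz (Z.of_nat (S m)) x))).
    - rewrite pint_scal, pint_sz_cz by auto with cts. ring.
    - intro x. apply sqrt_2l_mult. }
  assert (Hcomm : forall f g, pint (fun x => f x * g x) = pint (fun x => g x * f x))
    by (intros; apply pint_ext; intro; ring).
  revert k. pattern j. apply mode_cases.
  - intro k. pattern k. apply mode_cases.
    + cbn [wk]. rewrite pint_const, <- Rinv_mult, sqrt_sqrt by lra.
      destruct (Nat.eq_dec 0 0); [field; lra | lia].
    + intro i. apply H0.
    + intro i. apply H0'.
  - intros i k. pattern k. apply mode_cases.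
    + rewrite Hcomm. apply H0.
    + intro m. rewrite !wk_cz.
      rewrite (pint_ext _ (fun x => 2 / l0 * (cz (Z.of_nat (S i)) x * cz (Z.of_nat (S m)) x)))
        by (intro x; apply sqrt_2l_mult).
      rewrite pint_scal, pint_cz_cz, !pint_cz by auto with cts.
      (* The sum of the frequencies is positive, so only their difference can vanish; it contributes
         [l0 / 2], which the factor [2 / l0] normalises. *)
      destruct (Z.eq_dec (Z.of_nat (S i) + Z.of_nat (S m)) 0); [lia |].
      destruct (Z.eq_dec _ 0); destruct (Nat.eq_dec _ _); try lia; field; lra.
    + intro m. rewrite Hcomm, Hsc. destruct (Nat.eq_dec _ _); [lia | reflexivity].
  - intros i k. pattern k. apply mode_cases.
    + rewrite Hcomm. apply H0'.
    + intro m. rewrite Hsc. destruct (Nat.eq_dec _ _); [lia | reflexivity].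
    + intro m. rewrite !wk_sz.
      rewrite (pint_ext _ (fun x => 2 / l0 * (sz (Z.of_nat (S i)) x * sz (Z.of_nat (S m)) x)))
        by (intro x; apply sqrt_2l_mult).
      rewrite pint_scal, pint_sz_sz, !pint_cz by auto with cts.
      destruct (Z.eq_dec (Z.of_nat (S i) + Z.of_nat (S m)) 0); [lia |].
      destruct (Z.eq_dec _ 0); destruct (Nat.eq_dec _ _); try lia; field; lra.
Qed.

Notation fc := (fcoef l0).

Lemma fcoef_pint (f : R -> R) (k : nat) : cts f -> fc f k = pint (fun x => f x * wk l0 k x).
Proof. intros. apply Rint_RInt. auto with cts. Qed.

Lemma fcoef_scal (f : R -> R) (c : R) (k : nat) : cts f -> fc (fun x => c * f x) k = c * fc f k.
Proof.
  intros Hf. rewrite !fcoef_pint, <- pint_scal by auto with cts.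
  apply pint_ext. intro; ring.
Qed.

Lemma fcoef_minus (f g : R -> R) (k : nat) : cts f -> cts g ->
  fc (fun x => f x - g x) k = fc f k - fc g k.
Proof.
  intros Hf Hg. rewrite !fcoef_pint, <- pint_minus by auto with cts.
  apply pint_ext. intro; ring.
Qed.

Definition trig_sum (a : nat -> R) (N : nat) (x : R) : R := sum_f_R0 (fun k => a k * wk l0 k x) N.
Local Notation tp := trig_sum.

Lemma cts_tp (a : nat -> R) (N : nat) : cts (tp a N).
Proof. unfold tp. auto with cts. Qed.
Local Hint Resolve cts_tp : cts.

Lemma pint_mult_tp (f : R -> R) (a : nat -> R) (N : nat) : cts f ->
  pint (fun x => f x * tp a N x) = sum_f_R0 (fun k => a k * fc f k) N.
Proof.
  intros Hf. rewrite (pint_ext _ (fun x => sum_f_R0 (fun k => a k * (f x * wk l0 k x)) N)).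
  - unfold pint. rewrite (RInt_sum_cts (fun k x => a k * (f x * wk l0 k x))) by auto with cts.
    apply sum_eq. intros k _. rewrite fcoef_pint by assumption. now apply pint_scal; auto with cts.
  - intro x. unfold tp. rewrite <- sum_mult_l. apply sum_eq. intros; ring.
Qed.

Lemma fcoef_tp (a : nat -> R) (N k : nat) : fc (tp a N) k = if le_dec k N then a k else 0.
Proof.
  rewrite fcoef_pint by auto with cts.
  rewrite (pint_ext _ (fun x => wk l0 k x * tp a N x)) by (intro; ring).
  rewrite pint_mult_tp by auto with cts.
  rewrite (sum_eq _ (fun i => a i * (if Nat.eq_dec k i then 1 else 0))).
  - induction N as [|N IH]; cbn [sum_f_R0].
    + destruct (Nat.eq_dec k 0) as [-> |]; destruct (le_dec _ _); try lia; ring.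
    + rewrite IH. destruct (Nat.eq_dec k (S N)) as [-> |];
        repeat destruct (le_dec _ _); try lia; ring.
  - intros i _. now rewrite fcoef_pint, wk_orthonormal by auto with cts.
Qed.

Lemma pint_sqr_tp (a : nat -> R) (N : nat) :
  pint (fun x => tp a N x ^ 2) = sum_f_R0 (fun k => a k ^ 2) N.
Proof.
  rewrite (pint_ext _ (fun x => tp a N x * tp a N x)) by (intro; ring).
  rewrite pint_mult_tp by auto with cts. apply sum_eq. intros k Hk.
  rewrite fcoef_tp. destruct (le_dec _ _); [ring | lia].
Qed.

(** Pythagoras for the orthogonal projection onto the first modes. A nonnegative left side gives
    [Bessel]; a small left side gives Parseval. *)
Lemma pint_sqr_sub_tp (f : R -> R) (N : nat) : cts f ->
  pint (fun x => (f x - tp (fc f) N x) ^ 2) = pint (fun x => f x ^ 2) - sum_f_R0 (fun k => fc f k ^ 2) N.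
Proof.
  intros Hf.
  rewrite (pint_ext _ (fun x => f x ^ 2 + ((-2) * (f x * tp (fc f) N x) + tp (fc f) N x ^ 2)))
    by (intro; ring).
  rewrite pint_plus, pint_plus, pint_scal, pint_mult_tp, pint_sqr_tp by auto with cts.
  rewrite (sum_eq (fun k => fc f k * fc f k) (fun k => fc f k ^ 2)) by (intros; ring). ring.
Qed.

Lemma Bessel (f : R -> R) (N : nat) : cts f ->
  sum_f_R0 (fun k => fc f k ^ 2) N <= pint (fun x => f x ^ 2).
Proof.
  intros Hf. pose proof (pint_sqr_sub_tp f N Hf) as H.
  assert (0 <= pint (fun x => (f x - tp (fc f) N x) ^ 2)).
  { apply pint_ge0; auto with cts. intro; apply pow2_ge_0. }
  lra.
Qed.

Lemma fcoef_sqr_le (f : R -> R) (k : nat) : cts f -> fc f k ^ 2 <= pint (fun x => f x ^ 2).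
Proof.
  intros Hf. apply Rle_trans with (sum_f_R0 (fun k => fc f k ^ 2) k); [| now apply Bessel].
  destruct k; cbn [sum_f_R0]; [lra |].
  pose proof (sum_nonneg (fun k => fc f k ^ 2) k ltac:(intro; apply pow2_ge_0)). lra.
Qed.

Lemma fcoef_abs_le (f : R -> R) (k : nat) (e : R) : cts f -> (forall x, Rabs (f x) <= e) ->
  Rabs (fc f k) <= e * sqrt (2 / l0) * l0.
Proof.
  intros Hf He. assert (Hs := sqrt_pos (2 / l0)).
  assert (Hb : forall x, Rabs (f x * wk l0 k x) <= e * sqrt (2 / l0)).
  { intro x. rewrite Rabs_mult.
    apply Rmult_le_compat; auto using Rabs_pos, wk_bound. }
  rewrite fcoef_pint by assumption. rewrite <- pint_const. apply Rabs_le. split.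
  - rewrite pint_const, Ropp_mult_distr_l, <- pint_const.
    apply pint_le; auto with cts. intros x _. specialize (Hb x). apply Rabs_le_between in Hb. lra.
  - apply pint_le; auto with cts. intros x _. specialize (Hb x). apply Rabs_le_between in Hb. lra.
Qed.

(** Termwise differentiation produces the modes [partner k]; reindexing by this involution is
    legitimate because the sum stops at [2 * N]. *)
Lemma tp_derivative (a : nat -> R) (N : nat) (x : R) :
  derivable_pt_lim (tp a (2 * N)) x (tp (fun k => dsym (partner k) * a (partner k)) (2 * N) x).
Proof.
  assert (H : forall M, derivable_pt_lim (tp a M) x
    (sum_f_R0 (fun k => a k * (dsym k * wk l0 (partner k) x)) M)).
  { induction M as [|M IH].
    - apply (derivable_pt_lim_scal (wk l0 0) (a 0%nat)), wk_derivative.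
    - apply (derivable_pt_lim_plus (tp a M) (fun y => a (S M) * wk l0 (S M) y)); [assumption |].
      apply (derivable_pt_lim_scal (wk l0 (S M)) (a (S M))), wk_derivative. }
  replace (tp _ (2 * N) x) with (sum_f_R0 (fun k => a k * (dsym k * wk l0 (partner k) x)) (2 * N)).
  - apply H.
  - unfold tp. rewrite <- sum_partner. apply sum_eq. intros k _. rewrite partner_involutive. ring.
Qed.

(** Integration by parts: [f * wk k] takes equal values at both ends of the period, so its
    derivative integrates to zero. *)
Lemma fcoef_derivative (f f' : R -> R) (k : nat) : periodic l0 f ->
  (forall x, derivable_pt_lim f x (f' x)) -> cts f' -> fc f' k = - dsym k * fc f (partner k).
Proof.
  intros Hp Hd Hc. pose proof (derivable_cts f f' Hd) as Hf.
  rewrite !fcoef_pint by assumption.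
  assert (H : pint (fun x => f' x * wk l0 k x + f x * (dsym k * wk l0 (partner k) x)) = 0).
  { unfold pint. rewrite (RInt_derivative (fun x => f x * wk l0 k x)).
    - replace (l0 / 2) with (- l0 / 2 + l0) by field. rewrite Hp, wk_periodic. ring.
    - intro x. apply (derivable_pt_lim_mult f (wk l0 k)); [apply Hd | apply wk_derivative].
    - auto with cts. }
  rewrite pint_plus in H by auto with cts.
  rewrite (pint_ext (fun x => f x * (dsym k * wk l0 (partner k) x))
             (fun x => dsym k * (f x * wk l0 (partner k) x))), pint_scal in H by (auto with cts; intro; ring).
  lra.
Qed.

End Basis.

(** * Completeness of the eigenbasis *)

Section Completeness.
Context (l0 : R) (l0_pos : 0 < l0).
Notation fc := (fcoef l0).
Notation pint := (period_int l0).
Notation W := (weight l0).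
Notation cz := (cosz l0).
Notation sz := (sinz l0).
Notation tp := (trig_sum l0).
Notation dsym := (dsym l0).
Local Hint Resolve cts_cz cts_sz cts_wk cts_tp : cts.

(** The algebra generated by the first cosine and sine. Closure under products, which is not
    apparent for the sums [trig_sum], is built in; it serves both the density argument and the
    product estimates. *)
Inductive tpoly : (R -> R) -> Prop :=
| tpoly_const (c : R) : tpoly (fun _ => c)
| tpoly_cos : tpoly (cz 1)
| tpoly_sin : tpoly (sz 1)
| tpoly_plus (p q : R -> R) : tpoly p -> tpoly q -> tpoly (fun x => p x + q x)
| tpoly_mult (p q : R -> R) : tpoly p -> tpoly q -> tpoly (fun x => p x * q x).

Lemma tpoly_cts (p : R -> R) : tpoly p -> cts p.
Proof. induction 1; auto with cts. Qed.

Lemma tpoly_pow (p : R -> R) (m : nat) : tpoly p -> tpoly (fun x => p x ^ m).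
Proof.
  intros Hp. induction m as [|m IH]; [apply (tpoly_const 1) | now apply (tpoly_mult p)].
Qed.

Lemma cz_0 (x : R) : cz 0 x = 1.
Proof. unfold cosz. replace (2 * PI * 0 * x / l0) with 0 by (unfold Rdiv; ring). apply cos_0. Qed.
Lemma sz_0 (x : R) : sz 0 x = 0.
Proof. unfold sinz. replace (2 * PI * 0 * x / l0) with 0 by (unfold Rdiv; ring). apply sin_0. Qed.
Lemma cz_opp (z : Z) (x : R) : cz (- z) x = cz z x.
Proof.
  unfold cosz. rewrite opp_IZR, <- cos_neg. f_equal. unfold Rdiv. ring.
Qed.
Lemma sz_opp (z : Z) (x : R) : sz (- z) x = - sz z x.
Proof.
  unfold sinz. rewrite opp_IZR, <- sin_neg. f_equal. unfold Rdiv. ring.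
Qed.

Lemma tpoly_scal (p : R -> R) (c : R) : tpoly p -> tpoly (fun x => c * p x).
Proof. intros. apply (tpoly_mult (fun _ => c)); [apply tpoly_const | assumption]. Qed.

Lemma tpoly_cz_sz (n : nat) : tpoly (cz (Z.of_nat n)) /\ tpoly (sz (Z.of_nat n)).
Proof.
  induction n as [|n [IHc IHs]].
  - cbn [Z.of_nat]. rewrite (functional_extensionality _ _ cz_0), (functional_extensionality _ _ sz_0).
    split; apply tpoly_const.
  - rewrite Nat2Z.inj_succ. unfold Z.succ.
    rewrite (functional_extensionality _ _ (cz_add l0 l0_pos (Z.of_nat n) 1)).
    rewrite (functional_extensionality _ _ (sz_add l0 l0_pos (Z.of_nat n) 1)).
    split.
    + replace (fun x => cz (Z.of_nat n) x * cz 1 x - sz (Z.of_nat n) x * sz 1 x)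
        with (fun x => cz (Z.of_nat n) x * cz 1 x + (-1) * (sz (Z.of_nat n) x * sz 1 x))
        by (apply functional_extensionality; intro; ring).
      apply tpoly_plus; [| apply tpoly_scal]; apply tpoly_mult; auto using tpoly_cos, tpoly_sin.
    + apply tpoly_plus; apply tpoly_mult; auto using tpoly_cos, tpoly_sin.
Qed.

Lemma tpoly_wk (k : nat) : tpoly (wk l0 k).
Proof.
  pattern k. apply mode_cases.
  - apply (tpoly_const (/ sqrt l0)).
  - intro i. rewrite wk_cz by assumption. apply tpoly_scal, tpoly_cz_sz.
  - intro i. rewrite wk_sz by assumption. apply tpoly_scal, tpoly_cz_sz.
Qed.

Lemma tpoly_tp (a : nat -> R) (N : nat) : tpoly (tp a N).
Proof.
  induction N as [|N IH].
  - apply (tpoly_scal (wk l0 0)), tpoly_wk.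
  - apply (tpoly_plus (tp a N) (fun x => a (S N) * wk l0 (S N) x)); [assumption |].
    apply tpoly_scal, tpoly_wk.
Qed.

Lemma tpoly_periodic (p : R -> R) : tpoly p -> periodic l0 p.
Proof.
  induction 1 as [c | | | p q _ IHp _ IHq | p q _ IHp _ IHq]; intro x.
  - reflexivity.
  - unfold cosz. rewrite <- (cos_shift_Z (2 * PI * 1 * x / l0) 1). f_equal. field. lra.
  - unfold sinz. rewrite <- (sin_shift_Z (2 * PI * 1 * x / l0) 1). f_equal. field. lra.
  - now rewrite IHp, IHq.
  - now rewrite IHp, IHq.
Qed.

Lemma tpoly_derivative (p : R -> R) : tpoly p ->
  exists p', tpoly p' /\ forall x, derivable_pt_lim p x (p' x).
Proof.
  induction 1 as [c | | | p q Hp [p' [Hp' Dp]] Hq [q' [Hq' Dq]] | p q Hp [p' [Hp' Dp]] Hq [q' [Hq' Dq]]].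
  - exists (fun _ => 0). split; [apply tpoly_const | intro; apply derivable_pt_lim_const].
  - exists (fun x => - (2 * PI / l0) * sz 1 x). split; [apply tpoly_scal, tpoly_sin |].
    intro x. apply is_derive_Reals. unfold cosz, sinz. auto_derive; [trivial | unfold Rdiv; ring].
  - exists (fun x => (2 * PI / l0) * cz 1 x). split; [apply tpoly_scal, tpoly_cos |].
    intro x. apply is_derive_Reals. unfold cosz, sinz. auto_derive; [trivial | unfold Rdiv; ring].
  - exists (fun x => p' x + q' x). split; [now apply tpoly_plus |].
    intro x. now apply (derivable_pt_lim_plus p q).
  - exists (fun x => p' x * q x + p x * q' x).
    split; [apply tpoly_plus; now apply tpoly_mult |].
    intro x. now apply (derivable_pt_lim_mult p q).
Qed.

(** Stated over all integer frequencies rather than over basis indices, so that multiplying [h] by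
    [cz 1] or [sz 1] merely shifts [z] by one. *)
Definition orthogonal_to_modes (h : R -> R) : Prop :=
  forall z, pint (fun x => h x * cz z x) = 0 /\ pint (fun x => h x * sz z x) = 0.

Lemma orthogonal_of_fcoef (h : R -> R) : cts h -> (forall k, fc h k = 0) -> orthogonal_to_modes h.
Proof.
  intros Hh H.
  assert (Hs : sqrt (2 / l0) <> 0).
  { apply Rgt_not_eq, sqrt_lt_R0, Rdiv_lt_0_compat; lra. }
  assert (Hn : forall n, pint (fun x => h x * cz (Z.of_nat n) x) = 0
                    /\ pint (fun x => h x * sz (Z.of_nat n) x) = 0).
  { intros [|i].
    - split.
      + apply (Rmult_eq_reg_l (/ sqrt l0)); [| apply Rinv_neq_0_compat, Rgt_not_eq, sqrt_lt_R0, l0_pos].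
        rewrite Rmult_0_r, <- pint_scal, <- (H O), fcoef_pint by auto with cts.
        apply pint_ext. intro x. cbn [Z.of_nat wk]. rewrite cz_0. ring.
      + rewrite (pint_ext l0 _ (fun _ => 0)); [rewrite pint_const; ring |].
        intro x. cbn [Z.of_nat]. rewrite sz_0. ring.
    - split; apply (Rmult_eq_reg_l (sqrt (2 / l0))); trivial;
        rewrite Rmult_0_r, <- pint_scal by auto with cts.
      + rewrite <- (H (S (2 * i))), fcoef_pint, wk_cz by assumption. apply pint_ext. intro; ring.
      + rewrite <- (H (S (S (2 * i)))), fcoef_pint, wk_sz by assumption. apply pint_ext. intro; ring. }
  intro z. destruct (Z.le_gt_cases 0 z) as [Hz | Hz].
  - rewrite <- (Z2Nat.id z Hz). apply Hn.
  - destruct (Hn (Z.to_nat (- z))) as [H1 H2]. rewrite Z2Nat.id in H1, H2 by lia. split.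
    + rewrite <- H1. apply pint_ext. intro x. now rewrite cz_opp.
    + apply (Rmult_eq_reg_l (-1)); [| lra]. rewrite Rmult_0_r, <- H2, <- pint_scal by auto with cts.
      apply pint_ext. intro x. rewrite sz_opp. ring.
Qed.

(** Multiplication by a generator turns the mode [z] into a combination of the modes [z - 1] and
    [z + 1]. Quantifying over [h] lets the product case apply the second hypothesis to [h * p]. *)
Lemma orthogonal_mult_tpoly (q h : R -> R) : tpoly q -> cts h -> orthogonal_to_modes h ->
  orthogonal_to_modes (fun x => h x * q x).
Proof.
  intros Hq. revert h. induction Hq as [c | | | p q Hp IHp Hq IHq | p q Hp IHp Hq IHq]; intros h Hh H z.
  - destruct (H z) as [H1 H2]. split.
    + rewrite (pint_ext l0 _ (fun x => c * (h x * cz z x))) by (intro; ring).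
      rewrite pint_scal, H1 by auto with cts. ring.
    + rewrite (pint_ext l0 _ (fun x => c * (h x * sz z x))) by (intro; ring).
      rewrite pint_scal, H2 by auto with cts. ring.
  - destruct (H (z - 1)%Z) as [H1 H2]. destruct (H (z + 1)%Z) as [H3 H4]. split.
    + rewrite (pint_ext l0 _ (fun x => / 2 * (h x * cz (z - 1) x + h x * cz (z + 1) x)))
        by (intro; rewrite cz_sub, cz_add by assumption; field).
      rewrite pint_scal, pint_plus, H1, H3 by auto with cts. ring.
    + rewrite (pint_ext l0 _ (fun x => / 2 * (h x * sz (z - 1) x + h x * sz (z + 1) x)))
        by (intro; rewrite sz_sub, sz_add by assumption; field).
      rewrite pint_scal, pint_plus, H2, H4 by auto with cts. ring.
  - destruct (H (z - 1)%Z) as [H1 H2]. destruct (H (z + 1)%Z) as [H3 H4]. split.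
    + rewrite (pint_ext l0 _ (fun x => / 2 * (h x * sz (z + 1) x - h x * sz (z - 1) x)))
        by (intro; rewrite sz_sub, sz_add by assumption; field).
      rewrite pint_scal, pint_minus, H2, H4 by auto with cts. ring.
    + rewrite (pint_ext l0 _ (fun x => / 2 * (h x * cz (z - 1) x - h x * cz (z + 1) x)))
        by (intro; rewrite cz_sub, cz_add by assumption; field).
      rewrite pint_scal, pint_minus, H1, H3 by auto with cts. ring.
  - apply tpoly_cts in Hp, Hq.
    destruct (IHp h Hh H z) as [H1 H2]. destruct (IHq h Hh H z) as [H3 H4]. split.
    + rewrite (pint_ext l0 _ (fun x => h x * p x * cz z x + h x * q x * cz z x)) by (intro; ring).
      rewrite pint_plus, H1, H3 by auto with cts. ring.
    + rewrite (pint_ext l0 _ (fun x => h x * p x * sz z x + h x * q x * sz z x)) by (intro; ring).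
      rewrite pint_plus, H2, H4 by auto with cts. ring.
  - apply tpoly_cts in Hp.
    destruct (IHq (fun x => h x * p x) ltac:(auto with cts) (IHp h Hh H) z) as [H1 H2]. split.
    + rewrite <- H1. apply pint_ext. intro; ring.
    + rewrite <- H2. apply pint_ext. intro; ring.
Qed.

Lemma pint_shift (h : R -> R) (a : R) : cts h -> periodic l0 h -> RInt h a (a + l0) = pint h.
Proof.
  intros Hc Hp. unfold period_int.
  assert (Hs : RInt h (l0 / 2) (a + l0) = RInt h (- l0 / 2) a).
  { replace (l0 / 2) with (1 * (- l0 / 2) + l0) by field.
    replace (a + l0) with (1 * a + l0) by ring.
    rewrite <- (RInt_comp_lin (V := R_CompleteNormedModule)) by now apply cts_ex_RInt.
    apply RInt_ext_all. intro x. unfold scal; simpl; unfold mult; simpl.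
    rewrite !Rmult_1_l. apply Hp. }
  pose proof (RInt_Chasles_cts h (- l0 / 2) a (l0 / 2) Hc).
  pose proof (RInt_Chasles_cts h a (l0 / 2) (a + l0) Hc). lra.
Qed.

(* Otherwise [h > 0] near [x0]; then [h] integrates to 0 against the powers of the trigonometric
   polynomial [1 + cos (mu (x - x0)) - cos (mu delta)], which exceeds a constant [r > 1] near [x0]
   and is at most 1 in absolute value away from [x0]. *)
Lemma orthogonal_not_pos (h : R -> R) (x0 : R) : cts h -> periodic l0 h ->
  orthogonal_to_modes h -> h x0 <= 0.
Proof.
  intros Hc Hp Ho. destruct (Rle_dec (h x0) 0) as [| Hpos]; [assumption | exfalso].
  set (c := h x0 / 2). assert (Hc0 : 0 < c) by (unfold c; lra).
  destruct (Hc x0 c Hc0) as [d0 [Hd0 Hnear]].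
  (* The bound [l0 / 4] keeps the neighbourhood inside the half period around [x0], where the cosine
     decreases with the distance. *)
  set (d := Rmin (d0 / 2) (l0 / 4)).
  assert (Hd : 0 < d) by (apply Rmin_glb_lt; lra).
  assert (Hdl : d <= l0 / 4) by apply Rmin_r.
  assert (Hdd : d < d0) by (pose proof (Rmin_l (d0 / 2) (l0 / 4)); fold d in H; lra).
  assert (Hh : forall x, Rabs (x - x0) <= d -> c <= h x).
  { intros x Hx. destruct (Req_dec x x0) as [-> | Hne]; [unfold c; lra |].
    assert (Hlt : Rdist (h x) (h x0) < c).
    { apply Hnear. split; [split; [exact I | congruence] |]. simpl. unfold Rdist. lra. }
    unfold Rdist in Hlt. apply Rabs_def2 in Hlt. unfold c in *. lra. }
  set (mu := 2 * PI / l0). pose proof PI_RGT_0 as HPI.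
  assert (Hmu : 0 < mu) by (apply Rdiv_lt_0_compat; lra).
  assert (Hmul : mu * l0 = 2 * PI) by (unfold mu; field; lra).
  set (q := fun x => 1 + (cos (mu * x0) * cz 1 x + sin (mu * x0) * sz 1 x) + - cos (mu * d)).
  assert (Hq : tpoly q).
  { apply (tpoly_plus (fun x => 1 + (cos (mu * x0) * cz 1 x + sin (mu * x0) * sz 1 x)));
      [| apply tpoly_const].
    apply (tpoly_plus (fun _ => 1)); [apply tpoly_const |].
    apply tpoly_plus; apply tpoly_scal; [apply tpoly_cos | apply tpoly_sin]. }
  assert (Hqx : forall x, q x = 1 + cos (mu * Rabs (x - x0)) - cos (mu * d)).
  { intro x. unfold q, cosz, sinz.
    replace (cos (mu * Rabs (x - x0))) with (cos (mu * x - mu * x0)).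
    - rewrite cos_minus. replace (2 * PI * 1 * x / l0) with (mu * x) by (unfold mu; field; lra). ring.
    - unfold Rabs. destruct (Rcase_abs _); [rewrite <- cos_neg |]; f_equal; ring. }
  set (r := 1 + cos (mu * (d / 2)) - cos (mu * d)).
  assert (Hmd : mu * d <= PI) by nra.
  assert (Hr : 1 < r).
  { unfold r. assert (cos (mu * d) < cos (mu * (d / 2))); [| lra].
    apply cos_decreasing_1; nra. }
  assert (Hcos : forall s t, 0 <= s <= t -> t <= l0 / 2 -> cos (mu * t) <= cos (mu * s)).
  { intros s t Hst Ht. apply cos_decr_1; nra. }
  destruct (continuity_ab_maj (fun x => Rabs (h x)) (x0 - l0 / 2) (x0 + l0 / 2)) as [xm [HM _]];
    [lra | |].
  { intros x _. apply (continuity_pt_comp h Rabs); [apply Hc | apply Rcontinuity_abs]. }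
  set (M := Rabs (h xm)) in *. assert (HM0 : 0 <= M) by apply Rabs_pos.
  assert (Hint : forall m, c * r ^ m * d <= M * l0).
  { intro m.
    assert (Hqm : cts (fun x => h x * q x ^ m)) by (apply tpoly_cts in Hq; auto with cts).
    assert (H0 : pint (fun x => h x * q x ^ m) = 0).
    { destruct (orthogonal_mult_tpoly (fun x => q x ^ m) h (tpoly_pow q m Hq) Hc Ho 0%Z) as [H1 _].
      rewrite <- H1. apply pint_ext. intro x. rewrite cz_0. ring. }
    rewrite <- (pint_shift _ (x0 - l0 / 2)) in H0; trivial.
    2: { intro x. cbv beta. rewrite (tpoly_periodic q Hq x), Hp. reflexivity. }
    replace (x0 - l0 / 2 + l0) with (x0 + l0 / 2) in H0 by field.
    rewrite <- (RInt_Chasles_cts _ _ (x0 - d / 2) _ Hqm),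
      <- (RInt_Chasles_cts _ (x0 - d / 2) (x0 + d / 2) _ Hqm) in H0.
    (* Within distance [d] both [h] and [q] are nonnegative; beyond it [|q| <= 1]. The negative
       contribution is thus at most [M] per unit length, whatever the power [m]. *)
    assert (Hlow : forall x, x0 - l0 / 2 <= x <= x0 + l0 / 2 -> - M <= h x * q x ^ m).
    { intros x Hx. assert (Hxl : Rabs (x - x0) <= l0 / 2) by (apply Rabs_le; lra).
      specialize (HM x Hx). cbv beta in HM.
      destruct (Rle_dec (Rabs (x - x0)) d) as [Hin | Hout].
      - specialize (Hh x Hin).
        assert (0 <= q x ^ m).
        { apply pow_le. rewrite Hqx.
          pose proof (Hcos (Rabs (x - x0)) d (conj (Rabs_pos _) Hin) ltac:(lra)). lra. }
        assert (0 <= h x * q x ^ m) by (apply Rmult_le_pos; lra). lra.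
      - assert (Hq1 : Rabs (q x) <= 1).
        { apply Rabs_le. rewrite Hqx.
          pose proof (Hcos d (Rabs (x - x0)) ltac:(lra) Hxl).
          pose proof (COS_bound (mu * Rabs (x - x0))). pose proof (COS_bound (mu * d)). lra. }
        assert (Ha : Rabs (h x * q x ^ m) <= M).
        { rewrite Rabs_mult, <- RPow_abs.
          assert (Rabs (q x) ^ m <= 1).
          { rewrite <- (pow1 m). apply pow_incr. split; [apply Rabs_pos | assumption]. }
          assert (0 <= Rabs (q x) ^ m) by (apply pow_le, Rabs_pos).
          pose proof (Rabs_pos (h x)). nra. }
        apply Rabs_le_between in Ha. lra. }
    assert (H1 : RInt (fun _ => - M) (x0 - l0 / 2) (x0 - d / 2)
      <= RInt (fun x => h x * q x ^ m) (x0 - l0 / 2) (x0 - d / 2)).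
    { apply RInt_le_cts; auto with cts; [lra |]. intros x Hx. apply Hlow. lra. }
    assert (H2 : RInt (fun _ => - M) (x0 + d / 2) (x0 + l0 / 2)
      <= RInt (fun x => h x * q x ^ m) (x0 + d / 2) (x0 + l0 / 2)).
    { apply RInt_le_cts; auto with cts; [lra |]. intros x Hx. apply Hlow. lra. }
    assert (H3 : RInt (fun _ => c * r ^ m) (x0 - d / 2) (x0 + d / 2)
      <= RInt (fun x => h x * q x ^ m) (x0 - d / 2) (x0 + d / 2)).
    { apply RInt_le_cts; auto with cts; [lra |]. intros x Hx.
      assert (Hxd : Rabs (x - x0) <= d / 2) by (apply Rabs_le; lra).
      specialize (Hh x ltac:(lra)). apply Rmult_le_compat; [lra | | assumption |].
      - apply pow_le. lra.
      - apply pow_incr. split; [lra |]. rewrite Hqx. unfold r.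
        pose proof (Hcos (Rabs (x - x0)) (d / 2) (conj (Rabs_pos _) Hxd) ltac:(lra)). lra. }
    rewrite RInt_const_R in H1, H2, H3.
    assert (M * d >= 0) by nra. nra. }
  (* By Bernoulli's inequality [r^m >= 1 + m (r - 1)], so any [m] above this threshold makes
     [c * r^m * d] exceed [M * l0]. *)
  set (b := M * l0 / (c * d * (r - 1))).
  destruct (archimed b) as [Hb _].
  assert (Hcd : 0 < c * d * (r - 1)) by (repeat apply Rmult_lt_0_compat; lra).
  assert (Hb0 : 0 <= b) by (apply Rle_mult_inv_pos; nra).
  assert (Hup : (0 <= up b)%Z) by (apply le_IZR; lra).
  specialize (Hint (Z.to_nat (up b))).
  pose proof (poly (Z.to_nat (up b)) (r - 1) ltac:(lra)) as Hpoly.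
  rewrite INR_IZR_INZ, Z2Nat.id in Hpoly by assumption.
  replace (1 + (r - 1)) with r in Hpoly by ring.
  assert (HbM : b * (c * d * (r - 1)) = M * l0) by (unfold b; field; lra).
  assert (c * d * (1 + IZR (up b) * (r - 1)) <= c * d * r ^ Z.to_nat (up b)).
  { apply Rmult_le_compat_l; [nra | assumption]. }
  assert (0 < c * d) by nra.
  assert (b * (c * d * (r - 1)) < IZR (up b) * (c * d * (r - 1))) by (apply Rmult_lt_compat_r; lra).
  lra.
Qed.

(** The one-sided statement is applied to [h] and to [- h]. This uniqueness is what identifies a
    continuous function with the sum of its Fourier series. *)
Lemma fcoef_zero (h : R -> R) (x : R) : cts h -> periodic l0 h -> (forall k, fc h k = 0) -> h x = 0.
Proof.
  intros Hc Hp H.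
  pose proof (orthogonal_not_pos h x Hc Hp (orthogonal_of_fcoef h Hc H)).
  assert (- h x <= 0); [| lra].
  apply (orthogonal_not_pos (fun y => - h y)); auto with cts.
  - intro y. now rewrite Hp.
  - apply orthogonal_of_fcoef; auto with cts. intro k.
    rewrite <- (Rmult_0_r (-1)), <- (H k), <- fcoef_scal by assumption.
    f_equal. apply functional_extensionality. intro; ring.
Qed.
End Completeness.

(** * Fourier series in Sobolev spaces *)

Section Fourier.
Context (l0 : R) (l0_pos : 0 < l0).
Notation fc := (fcoef l0).
Notation pint := (period_int l0).
Notation W := (weight l0).
Notation tp := (trig_sum l0).
Notation dsym := (dsym l0).
Local Hint Resolve cts_wk cts_tp : cts.

Lemma W_pos (k : nat) : 0 < W k.
Proof. pose proof (W_ge1 l0 l0_pos k). lra. Qed.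

(** The product of consecutive integers is chosen so that the reciprocals telescope in [sum_inv_W].
    It follows from [k <= 2 * jidx k] and [2 < PI], which give [k^2 <= lambda_k l0^2]. *)
Lemma W_lower (k : nat) : / (6 * (1 + l0 ^ 2)) * (INR (S k) * INR (S (S k))) <= W k.
Proof.
  assert (Hj : INR k <= 2 * INR (jidx k)).
  { replace 2 with (INR 2) by reflexivity. rewrite <- mult_INR. apply le_INR. unfold jidx.
    pose proof (Nat.div_mod_eq (S k) 2). pose proof (Nat.mod_upper_bound (S k) 2). lia. }
  pose proof (pos_INR k) as Hk. pose proof PI2_1 as HPI.
  assert (Hl : INR k <= 2 * PI * INR (jidx k)) by nra.
  assert (Hl2 : INR k ^ 2 <= lam l0 k * l0 ^ 2).
  { unfold lam.
    replace (4 * PI ^ 2 * INR (jidx k) ^ 2 / l0 ^ 2 * l0 ^ 2) with ((2 * PI * INR (jidx k)) ^ 2)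
      by (field; lra).
    apply pow_incr. lra. }
  rewrite !S_INR. unfold weight. pose proof (lam_ge0 l0 l0_pos k).
  apply (Rmult_le_reg_l (6 * (1 + l0 ^ 2))); [nra |].
  rewrite <- Rmult_assoc, Rinv_r, Rmult_1_l by nra.
  assert (0 <= l0 ^ 2 * 1) by nra. nra.
Qed.

Lemma sum_inv_W (N : nat) : sum_f_R0 (fun k => / W k) N <= 6 * (1 + l0 ^ 2).
Proof.
  set (c := 6 * (1 + l0 ^ 2)). assert (Hc : 0 < c) by (unfold c; nra).
  apply Rle_trans with (c * (1 - / INR (S (S N)))).
  - assert (Hk : forall k, / W k <= c * (/ INR (S k) - / INR (S (S k)))).
    { intro k. assert (H1 : 0 < INR (S k)) by apply lt_0_INR, Nat.lt_0_succ.
      assert (H2 : 0 < INR (S (S k))) by apply lt_0_INR, Nat.lt_0_succ.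
      replace (c * (/ INR (S k) - / INR (S (S k)))) with (/ (/ c * (INR (S k) * INR (S (S k))))).
      - apply Rinv_le_contravar; [| apply W_lower].
        apply Rmult_lt_0_compat; [now apply Rinv_0_lt_compat | nra].
      - rewrite (S_INR (S k)) in *. field. lra. }
    induction N as [|N IH]; cbn [sum_f_R0].
    + specialize (Hk O). change (INR 1) with 1 in Hk. lra.
    + specialize (Hk (S N)). lra.
  - assert (0 < / INR (S (S N))) by (apply Rinv_0_lt_compat, lt_0_INR, Nat.lt_0_succ). nra.
Qed.

(** A Sobolev bound expressed on partial sums and on bare coefficient sequences: it needs no value
    of a series, and it applies before a function with these coefficients is known to exist. *)
Definition hs_le (s : nat) (a : nat -> R) (B : R) : Prop :=
  forall N, sum_f_R0 (fun k => W k ^ s * a k ^ 2) N <= B.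

Lemma hs_le_term_ge0 (s : nat) (a : nat -> R) (k : nat) : 0 <= W k ^ s * a k ^ 2.
Proof.
  apply Rmult_le_pos; [apply pow_le; left; apply W_pos | apply pow2_ge_0].
Qed.

Lemma hs_le_ge0 (s : nat) (a : nat -> R) (B : R) : hs_le s a B -> 0 <= B.
Proof. intros H. eapply Rle_trans; [| apply (H O)]. apply hs_le_term_ge0. Qed.

Lemma hs_le_mono (s r : nat) (a : nat -> R) (B : R) : (r <= s)%nat -> hs_le s a B -> hs_le r a B.
Proof.
  intros Hrs H N. eapply Rle_trans; [| apply (H N)]. apply sum_le_compat. intro k.
  apply Rmult_le_compat_r; [apply pow2_ge_0 |]. apply Rle_pow; [now apply W_ge1 | assumption].
Qed.

(** Cauchy-Schwarz with the weights [W^(1/2)] and [W^(-1/2)]: in one dimension [1 / W] is summable,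
    so coefficients of class [H^1] are absolutely summable. *)
Lemma sum_abs_le (a : nat -> R) (B : R) (N : nat) : hs_le 1 a B ->
  sum_f_R0 (fun k => Rabs (a k)) N ^ 2 <= B * (6 * (1 + l0 ^ 2)).
Proof.
  intros H.
  rewrite (sum_eq _ (fun k => sqrt (W k) * Rabs (a k) * sqrt (/ W k))).
  2: { intros k _. rewrite sqrt_inv. field. apply Rgt_not_eq, sqrt_lt_R0, W_pos. }
  eapply Rle_trans; [apply sum_Cauchy_Schwarz |].
  apply Rmult_le_compat.
  - apply sum_nonneg; intro; apply pow2_ge_0.
  - apply sum_nonneg; intro; apply pow2_ge_0.
  - eapply Rle_trans; [| apply (H N)]. apply sum_le_compat. intro k.
    rewrite Rpow_mult_distr, pow2_sqrt, pow2_abs by (left; apply W_pos). lra.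
  - eapply Rle_trans; [| apply (sum_inv_W N)]. apply sum_le_compat. intro k.
    rewrite pow2_sqrt; [lra |]. left. apply Rinv_0_lt_compat, W_pos.
Qed.

Definition unif_lim (u : nat -> R -> R) (g : R -> R) : Prop :=
  forall e, 0 < e -> exists N0, forall N x, (N0 <= N)%nat -> Rabs (u N x - g x) < e.

Lemma unif_lim_CVU (u : nat -> R -> R) (g : R -> R) (x : R) (r : posreal) :
  unif_lim u g -> CVU u g x r.
Proof.
  intros H e He. destruct (H e He) as [N0 HN]. exists N0. intros N y HNN _.
  rewrite Rabs_minus_sym. now apply HN.
Qed.

Lemma unif_lim_cts (u : nat -> R -> R) (g : R -> R) :
  unif_lim u g -> (forall N, cts (u N)) -> cts g.
Proof.
  intros H Hu x. assert (Hr : 0 < 1) by lra.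
  apply (CVU_continuity u g x (mkposreal 1 Hr)).
  - now apply unif_lim_CVU.
  - intros N y _. apply Hu.
  - unfold Boule. simpl. rewrite Rminus_diag, Rabs_R0. lra.
Qed.

Lemma unif_lim_Un_cv (u : nat -> R -> R) (g : R -> R) (x : R) :
  unif_lim u g -> Un_cv (fun N => u N x) (g x).
Proof. intros H e He. destruct (H e He) as [N0 HN]. exists N0. intros. now apply HN. Qed.

Lemma unif_lim_double (u : nat -> R -> R) (g : R -> R) :
  unif_lim u g -> unif_lim (fun N => u (2 * N)%nat) g.
Proof. intros H e He. destruct (H e He) as [N0 HN]. exists N0. intros N x HNN. apply HN. lia. Qed.

Lemma unif_lim_fcoef (u : nat -> R -> R) (g : R -> R) (k : nat) :
  unif_lim u g -> (forall N, cts (u N)) -> Un_cv (fun N => fc (u N) k) (fc g k).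
Proof.
  intros H Hu e He. pose proof (unif_lim_cts u g H Hu) as Hg.
  assert (Hc : 0 < sqrt (2 / l0) * l0).
  { apply Rmult_lt_0_compat; [apply sqrt_lt_R0, Rdiv_lt_0_compat |]; lra. }
  destruct (H (e / (sqrt (2 / l0) * l0) / 2)) as [N0 HN].
  { repeat apply Rdiv_lt_0_compat; lra. }
  exists N0. intros N HNN. unfold Rdist. rewrite <- fcoef_minus by auto.
  apply Rle_lt_trans with (e / (sqrt (2 / l0) * l0) / 2 * sqrt (2 / l0) * l0).
  - apply fcoef_abs_le; auto with cts. intro x. left. apply HN. lia.
  - replace (e / (sqrt (2 / l0) * l0) / 2 * sqrt (2 / l0) * l0) with (e / 2); [lra |].
    field. split; [| apply Rgt_not_eq, sqrt_lt_R0, Rdiv_lt_0_compat]; lra.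
Qed.

(** Weierstrass test: the basis is uniformly bounded and the coefficients are absolutely summable.
    Uniform convergence then lets the coefficients of the partial sums pass to the limit. *)
Lemma fourier_sum (a : nat -> R) (B : R) : hs_le 1 a B ->
  exists g, unif_lim (tp a) g /\ cts g /\ periodic l0 g /\ forall k, fc g k = a k.
Proof.
  intros H. set (u := fun k => Rabs (a k)).
  assert (Hu0 : forall k, 0 <= u k) by (intro; apply Rabs_pos).
  set (A := sqrt (2 / l0)). assert (HA : 0 < A) by (apply sqrt_lt_R0, Rdiv_lt_0_compat; lra).
  (* The leading 1 converts the bound on the square: [s <= 1 + s^2]. *)
  assert (HuB : forall N, sum_f_R0 u N <= 1 + B * (6 * (1 + l0 ^ 2))).
  { intro N. pose proof (sum_abs_le a B N H) as Hs. fold u in Hs.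
    pose proof (sum_nonneg u N Hu0). nra. }
  pose proof (series_lim_spec u _ Hu0 HuB) as Hlim.
  assert (HS : forall N, sum_f_R0 u N <= series_lim u)
    by (intro; now apply sum_le_series_lim with (1 := Hu0) (2 := HuB)).
  assert (Hd : forall x N m, Rabs (tp a (N + m) x - tp a N x)
                 <= A * (sum_f_R0 u (N + m) - sum_f_R0 u N)).
  { intros x N m. induction m as [|m IH].
    - rewrite Nat.add_0_r, !Rminus_diag, Rabs_R0. lra.
    - replace (N + S m)%nat with (S (N + m)) by lia. unfold trig_sum in *. cbn [sum_f_R0].
      set (t := a (S (N + m)) * wk l0 (S (N + m)) x).
      assert (Ht : Rabs t <= A * u (S (N + m))).
      { unfold t, u. rewrite Rabs_mult, Rmult_comm. apply Rmult_le_compat_r; [apply Rabs_pos |].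
        now apply wk_bound. }
      replace (sum_f_R0 (fun k => a k * wk l0 k x) (N + m) + t - sum_f_R0 (fun k => a k * wk l0 k x) N)
        with (sum_f_R0 (fun k => a k * wk l0 k x) (N + m) - sum_f_R0 (fun k => a k * wk l0 k x) N + t)
        by ring.
      eapply Rle_trans; [apply Rabs_triang |]. lra. }
  assert (Hd' : forall x N M, (N <= M)%nat -> Rabs (tp a M x - tp a N x) <= A * (series_lim u - sum_f_R0 u N)).
  { intros x N M HNM. replace M with (N + (M - N))%nat by lia.
    eapply Rle_trans; [apply Hd |]. apply Rmult_le_compat_l; [lra |].
    specialize (HS (N + (M - N))%nat). lra. }
  assert (Htail : forall e, 0 < e -> exists N0, forall N, (N0 <= N)%nat -> A * (series_lim u - sum_f_R0 u N) < e).
  { intros e He. destruct (Hlim (e / A)) as [N0 HN]; [now apply Rdiv_lt_0_compat |].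
    exists N0. intros N HNN. specialize (HN N HNN). unfold Rdist in HN. apply Rabs_def2 in HN.
    assert (A * (e / A) = e) by (field; lra). nra. }
  assert (Hcv : forall x, exists l, Un_cv (fun N => tp a N x) l).
  { intro x. destruct (Rcomplete.R_complete (fun N => tp a N x)) as [l Hl]; [| now exists l].
    intros e He. destruct (Htail (e / 2)) as [N0 HN]; [lra |]. exists N0. intros N M HNN HMM.
    pose proof (Hd' x N0 N HNN) as H1. pose proof (Hd' x N0 M HMM) as H2.
    specialize (HN N0 (le_n _)). unfold Rdist.
    replace (tp a N x - tp a M x) with ((tp a N x - tp a N0 x) + - (tp a M x - tp a N0 x)) by ring.
    eapply Rle_lt_trans; [apply Rabs_triang |]. rewrite Rabs_Ropp. lra. }
  set (g := fun x => series_lim (fun k => a k * wk l0 k x)).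
  assert (Hg : forall x, Un_cv (fun N => tp a N x) (g x)).
  { intro x. destruct (Hcv x) as [l Hl]. unfold g. now rewrite (series_lim_cv _ l). }
  assert (Hunif : unif_lim (tp a) g).
  { intros e He. destruct (Htail (e / 2)) as [N0 HN]; [lra |]. exists N0. intros N x HNN.
    apply Rle_lt_trans with (e / 2); [| lra].
    assert (Hc : Un_cv (fun m => Rabs (tp a N x - tp a (N + m) x)) (Rabs (tp a N x - g x))).
    { apply (cv_cvabs (fun m => tp a N x - tp a (N + m) x)).
      apply (CV_minus (fun _ => tp a N x)).
      - intros d Hd0. exists O. intros. unfold Rdist. rewrite Rminus_diag, Rabs_R0. lra.
      - intros d Hd0. destruct (Hg x d Hd0) as [N1 HN1]. exists N1. intros m Hm. apply HN1. lia. }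
    apply (Un_cv_le_const _ _ _ Hc). intro m. rewrite Rabs_minus_sym.
    left. eapply Rle_lt_trans; [apply Hd'; lia | now apply HN]. }
  exists g. split; [assumption |]. split; [apply (unif_lim_cts _ _ Hunif); auto with cts |]. split.
  - intro x. unfold g. f_equal. apply functional_extensionality. intro k. now rewrite wk_periodic.
  - intro k. eapply UL_sequence; [apply (unif_lim_fcoef _ _ k Hunif); auto with cts |].
    intros e He. exists k. intros N HN. rewrite fcoef_tp by assumption.
    destruct (le_dec k N); [| lia]. unfold Rdist. rewrite Rminus_diag, Rabs_R0. lra.
Qed.

(** The sum [g] of the series is continuous, periodic and has the coefficients of [f], so [g - f]
    vanishes by completeness. *)
Lemma fourier_unif (f : R -> R) (B : R) : periodic l0 f -> cts f -> hs_le 1 (fc f) B ->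
  unif_lim (tp (fc f)) f.
Proof.
  intros Hp Hc H. destruct (fourier_sum _ B H) as [g [Hu [Hg [Hgp Hgk]]]].
  replace f with g at 2; [assumption |].
  apply functional_extensionality. intro x. apply Rminus_diag_uniq.
  apply (fcoef_zero l0 l0_pos (fun y => g y - f y)); auto with cts.
  - intro y. now rewrite Hp, Hgp.
  - intro k. rewrite fcoef_minus by assumption. rewrite Hgk. ring.
Qed.

Lemma Parseval_le (f : R -> R) (B1 B : R) : periodic l0 f -> cts f -> hs_le 1 (fc f) B1 ->
  hs_le 0 (fc f) B -> pint (fun x => f x ^ 2) <= B.
Proof.
  intros Hp Hc H1 H0. apply Rnot_lt_le. intro Hlt.
  (* The supposed excess per unit length. A uniform error of [sqrt (e / 2)] makes the projection
     error at most half the excess, contradicting Pythagoras. *)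
  set (e := (pint (fun x => f x ^ 2) - B) / l0).
  assert (He : 0 < e) by (apply Rdiv_lt_0_compat; lra).
  destruct (fourier_unif f B1 Hp Hc H1 (sqrt (e / 2))) as [N HN]; [apply sqrt_lt_R0; lra |].
  pose proof (pint_sqr_sub_tp l0 l0_pos f N Hc) as Hid.
  assert (Hle : pint (fun x => (f x - tp (fc f) N x) ^ 2) <= e / 2 * l0).
  { rewrite <- pint_const by assumption. apply pint_le; auto with cts. intros x _.
    rewrite <- (pow2_sqrt (e / 2)) by lra. rewrite <- (pow2_abs (f x - _)).
    apply pow_incr. split; [apply Rabs_pos |]. rewrite Rabs_minus_sym. left. now apply HN. }
  specialize (H0 N). rewrite (sum_eq _ (fun k => fc f k ^ 2)) in H0 by (intros; cbn; ring).
  assert (e * l0 = pint (fun x => f x ^ 2) - B) by (unfold e; field; lra). nra.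
Qed.

(** A derivative costs one power of the weight, since [dsym^2 = lambda <= W]. The sum is first
    enlarged to the index [2 * N] so that [partner] can be undone. *)
Lemma hs_le_derivative (s : nat) (a : nat -> R) (B : R) : hs_le (S s) a B ->
  hs_le s (fun k => dsym (partner k) * a (partner k)) B.
Proof.
  intros H N. eapply Rle_trans; [| apply (H (2 * N)%nat)].
  eapply Rle_trans; [apply sum_le_index with (M := (2 * N)%nat); [intro k; apply (hs_le_term_ge0 s (fun k => dsym (partner k) * a (partner k))) | lia] |].
  rewrite (sum_eq _ (fun k => W (partner k) ^ s * (dsym (partner k) * a (partner k)) ^ 2))
    by (intros; now rewrite W_partner).
  rewrite (sum_partner (fun k => W k ^ s * (dsym k * a k) ^ 2)). apply sum_le_compat. intro k.
  rewrite Rpow_mult_distr, dsym_sqr by assumption. cbn [pow].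
  replace (W k * W k ^ s * (a k * (a k * 1))) with (W k ^ s * (W k * a k ^ 2)) by ring.
  apply Rmult_le_compat_l; [apply pow_le; left; apply W_pos |].
  apply Rmult_le_compat_r; [apply pow2_ge_0 | unfold weight; lra].
Qed.

(** Class [H^2] puts the differentiated coefficients in [H^1], so both the partial sums and their
    derivatives converge uniformly, and differentiation commutes with the limit. *)
Lemma fourier_derivative (f : R -> R) (B : R) : periodic l0 f -> cts f -> hs_le 2 (fc f) B ->
  (forall x, derivable_pt_lim f x (dx f x)) /\ cts (dx f) /\ periodic l0 (dx f) /\
  forall k, fc (dx f) k = dsym (partner k) * fc f (partner k).
Proof.
  intros Hp Hc H.
  destruct (fourier_sum _ B (hs_le_derivative _ _ _ H)) as [g [Hu [Hg [Hgp Hgk]]]].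
  pose proof (fourier_unif f B Hp Hc (hs_le_mono 2 1 _ _ ltac:(lia) H)) as Hf.
  assert (Hd : forall x, derivable_pt_lim f x (g x)).
  { intro x. assert (Hr : 0 < 1) by lra.
    apply (CVU_derivable (fun N => tp (fc f) (2 * N)) _ f g x (mkposreal 1 Hr)
             (unif_lim_CVU _ _ x _ (unif_lim_double _ _ Hu))).
    - intros y _. apply (unif_lim_Un_cv _ _ y (unif_lim_double _ _ Hf)).
    - intros n y _. now apply tp_derivative.
    - unfold Boule. simpl. rewrite Rminus_diag, Rabs_R0. lra. }
  assert (Hdx : dx f = g) by (apply functional_extensionality; intro x; apply dx_eq, Hd).
  rewrite Hdx. auto.
Qed.

(** The hypothesis at level [S m] keeps one order in reserve at every stage: the function about to
    be differentiated is in [H^2]. A general [r] carries all the levels through the induction. *)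
Lemma fourier_dxn (m : nat) (f : R -> R) (B : R) : periodic l0 f -> cts f -> hs_le (S m) (fc f) B ->
  periodic l0 (dxn m f) /\ cts (dxn m f) /\
  forall r B', hs_le (m + r) (fc f) B' -> hs_le r (fc (dxn m f)) B'.
Proof.
  intros Hp Hc. induction m as [|m IH]; intros H.
  - auto.
  - destruct (IH (hs_le_mono _ _ _ _ (Nat.le_succ_diag_r _) H)) as [Hpm [Hcm Hm]].
    assert (H2 : hs_le 2 (fc (dxn m f)) B).
    { apply Hm. now replace (m + 2)%nat with (S (S m)) by lia. }
    destruct (fourier_derivative _ B Hpm Hcm H2) as [_ [Hcd [Hpd Hk]]].
    change (dxn (S m) f) with (dx (dxn m f)). repeat split; trivial.
    intros r B' HB'. rewrite (functional_extensionality _ _ Hk).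
    apply hs_le_derivative, Hm. now replace (m + S r)%nat with (S m + r)%nat by lia.
Qed.

End Fourier.

(** * Products *)

Section Products.
Context (l0 : R) (l0_pos : 0 < l0).
Notation fc := (fcoef l0).
Notation pint := (period_int l0).
Notation W := (weight l0).
Notation tp := (trig_sum l0).
Notation dsym := (dsym l0).
Notation hs_le := (hs_le l0).
Notation tpoly := (tpoly l0).
Local Hint Resolve cts_wk cts_tp tpoly_cts : cts.

(** The Sobolev norm on the physical side, suited to the Leibniz rule. As [dx] is a chosen value, it
    is used only on trigonometric polynomials, where all derivatives exist; [sob_tp] and [fcoef_sob]
    compare it with the Fourier side. *)
Fixpoint sob (s : nat) (f : R -> R) : R :=
  match s with
  | O => pint (fun x => f x ^ 2)
  | S s => pint (fun x => f x ^ 2) + sob s (dx f)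
  end.

Lemma tpoly_dx (p : R -> R) : tpoly p -> tpoly (dx p) /\ forall x, derivable_pt_lim p x (dx p x).
Proof.
  intros Hp. destruct (tpoly_derivative l0 p Hp) as [p' [Hp' Hd]].
  replace (dx p) with p'; [auto |].
  apply functional_extensionality. intro x. symmetry. apply dx_eq, Hd.
Qed.

Lemma dx_plus (p q : R -> R) : tpoly p -> tpoly q ->
  dx (fun x => p x + q x) = fun x => dx p x + dx q x.
Proof.
  intros Hp Hq. apply functional_extensionality. intro x. apply dx_eq.
  apply (derivable_pt_lim_plus p q); now apply tpoly_dx.
Qed.

Lemma dx_mult (p q : R -> R) : tpoly p -> tpoly q ->
  dx (fun x => p x * q x) = fun x => dx p x * q x + p x * dx q x.
Proof.
  intros Hp Hq. apply functional_extensionality. intro x. apply dx_eq.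
  apply (derivable_pt_lim_mult p q); now apply tpoly_dx.
Qed.

Lemma pint_sqr_ge0 (f : R -> R) : cts f -> 0 <= pint (fun x => f x ^ 2).
Proof. intros. apply pint_ge0; auto with cts. intro; apply pow2_ge_0. Qed.

Lemma sob_ge0 (s : nat) (p : R -> R) : tpoly p -> 0 <= sob s p.
Proof.
  revert p. induction s as [|s IH]; intros p Hp; cbn [sob].
  - apply pint_sqr_ge0. eauto with cts.
  - pose proof (pint_sqr_ge0 p ltac:(eauto with cts)). pose proof (IH _ (proj1 (tpoly_dx p Hp))). lra.
Qed.

Lemma sob_S (s : nat) (p : R -> R) : tpoly p -> sob s p <= sob (S s) p.
Proof.
  revert p. induction s as [|s IH]; intros p Hp.
  - cbn [sob]. pose proof (sob_ge0 0 _ (proj1 (tpoly_dx p Hp))). cbn [sob] in *. lra.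
  - change (pint (fun x => p x ^ 2) + sob s (dx p) <= pint (fun x => p x ^ 2) + sob (S s) (dx p)).
    pose proof (IH _ (proj1 (tpoly_dx p Hp))). lra.
Qed.

Lemma sob_0_le (s : nat) (p : R -> R) : tpoly p -> sob 0 p <= sob s p.
Proof.
  intros Hp. induction s as [|s IH]; [lra | eapply Rle_trans; [apply IH | now apply sob_S]].
Qed.

Lemma sob_dx_le (s : nat) (p : R -> R) : tpoly p -> sob s (dx p) <= sob (S s) p.
Proof. intros Hp. cbn [sob]. pose proof (pint_sqr_ge0 p ltac:(eauto with cts)). lra. Qed.

Lemma pint_sqr_plus (p q : R -> R) : cts p -> cts q ->
  pint (fun x => (p x + q x) ^ 2) <= 2 * pint (fun x => p x ^ 2) + 2 * pint (fun x => q x ^ 2).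
Proof.
  intros Hp Hq. rewrite <- !pint_scal, <- pint_plus by auto with cts.
  apply pint_le; auto with cts. intros x _. pose proof (pow2_ge_0 (p x - q x)). nra.
Qed.

Lemma sob_plus (s : nat) (p q : R -> R) : tpoly p -> tpoly q ->
  sob s (fun x => p x + q x) <= 2 * sob s p + 2 * sob s q.
Proof.
  revert p q. induction s as [|s IH]; intros p q Hp Hq;
    pose proof (pint_sqr_plus p q ltac:(eauto with cts) ltac:(eauto with cts)) as H; cbn [sob].
  - assumption.
  - rewrite dx_plus by assumption.
    pose proof (IH _ _ (proj1 (tpoly_dx p Hp)) (proj1 (tpoly_dx q Hq))). lra.
Qed.

Lemma sup_le_sob1 (p : R -> R) (x : R) : tpoly p -> - l0 / 2 <= x <= l0 / 2 ->
  p x ^ 2 <= (/ l0 + 1) * sob 1 p.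
Proof.
  intros Hp Hx. destruct (tpoly_dx p Hp) as [Hp' Hd].
  assert (Hc : cts p) by eauto with cts. assert (Hc' : cts (dx p)) by eauto with cts.
  set (F := fun t => p t ^ 2 + dx p t ^ 2).
  assert (HF : cts F) by (unfold F; auto with cts).
  assert (HF0 : forall t, 0 <= F t) by (intro t; unfold F; pose proof (pow2_ge_0 (p t)); pose proof (pow2_ge_0 (dx p t)); lra).
  assert (HFI : pint F = sob 1 p) by (unfold F; rewrite pint_plus by auto with cts; reflexivity).
  assert (Hsub : forall a b, - l0 / 2 <= a -> a <= b -> b <= l0 / 2 -> RInt F a b <= sob 1 p).
  { intros a b Ha Hab Hb. rewrite <- HFI. unfold period_int.
    rewrite <- (RInt_Chasles_cts F (- l0 / 2) a (l0 / 2) HF), <- (RInt_Chasles_cts F a b (l0 / 2) HF).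
    pose proof (RInt_ge0_cts F (- l0 / 2) a Ha HF ltac:(auto)).
    pose proof (RInt_ge0_cts F b (l0 / 2) Hb HF ltac:(auto)). lra. }
  assert (Hsq : forall a b, p b ^ 2 - p a ^ 2 = RInt (fun t => dx p t * p t + p t * dx p t) a b).
  { intros a b. rewrite (RInt_derivative (fun t => p t * p t)); [ring | | auto with cts].
    intro t. now apply (derivable_pt_lim_mult p p). }
  (* The increment of [p^2] between [x] and [y] is the integral of [2 p p'], bounded by that of
     [p^2 + p'^2]. Averaging over [y] then gives the constant [/ l0 + 1]. *)
  assert (Hxy : forall y, - l0 / 2 <= y <= l0 / 2 -> p x ^ 2 - sob 1 p <= p y ^ 2).
  { intros y Hy. destruct (Rle_dec y x) as [Hyx | Hyx].
    - pose proof (Hsub y x ltac:(lra) Hyx ltac:(lra)).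
      assert (RInt (fun t => dx p t * p t + p t * dx p t) y x <= RInt F y x).
      { apply RInt_le_cts; auto with cts. intros t _. unfold F. pose proof (pow2_ge_0 (p t - dx p t)). nra. }
      rewrite <- Hsq in H0. lra.
    - pose proof (Hsub x y ltac:(lra) ltac:(lra) ltac:(lra)).
      assert (RInt (fun t => (-1) * (dx p t * p t + p t * dx p t)) x y <= RInt F x y).
      { apply RInt_le_cts; auto with cts; [lra |]. intros t _. unfold F. pose proof (pow2_ge_0 (p t + dx p t)). nra. }
      rewrite RInt_scal_cts, <- Hsq in H0 by auto with cts. lra. }
  assert (Hint : pint (fun _ => p x ^ 2 - sob 1 p) <= pint (fun y => p y ^ 2))
    by (apply pint_le; auto with cts).
  rewrite pint_const in Hint by assumption.
  pose proof (sob_S 0 p Hp) as H01. change (sob 0 p) with (pint (fun y => p y ^ 2)) in H01.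
  apply (Rmult_le_reg_l l0); [assumption |].
  replace (l0 * ((/ l0 + 1) * sob 1 p)) with ((1 + l0) * sob 1 p) by (field; lra). nra.
Qed.

Lemma pint_sqr_mult (p q : R -> R) : tpoly p -> cts q ->
  pint (fun x => (p x * q x) ^ 2) <= (/ l0 + 1) * sob 1 p * pint (fun x => q x ^ 2).
Proof.
  intros Hp Hq. rewrite <- pint_scal by auto with cts.
  apply pint_le; eauto with cts. intros x Hx. rewrite Rpow_mult_distr.
  apply Rmult_le_compat_r; [apply pow2_ge_0 | now apply sup_le_sob1].
Qed.

(** Each Leibniz term has at most one differentiated factor; the other one is estimated in the
    supremum norm. *)
Lemma sob_mult_1 (p q : R -> R) : tpoly p -> tpoly q ->
  sob 1 (fun x => p x * q x) <= 4 * (/ l0 + 1) * (sob 1 p * sob 1 q).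
Proof.
  intros Hp Hq. pose proof (tpoly_dx p Hp) as [Hp' _]. pose proof (tpoly_dx q Hq) as [Hq' _].
  assert (Cp : cts p) by eauto with cts. assert (Cq : cts q) by eauto with cts.
  assert (Cp' : cts (dx p)) by eauto with cts. assert (Cq' : cts (dx q)) by eauto with cts.
  pose proof (pint_sqr_mult q p Hq Cp) as H1.
  pose proof (pint_sqr_mult q (dx p) Hq Cp') as H2.
  pose proof (pint_sqr_mult p (dx q) Hp Cq') as H3.
  pose proof (pint_sqr_plus (fun x => q x * dx p x) (fun x => p x * dx q x)
    ltac:(auto with cts) ltac:(auto with cts)) as H4.
  change (sob 1 (fun x => p x * q x)) with
    (pint (fun x => (p x * q x) ^ 2) + pint (fun x => dx (fun x => p x * q x) x ^ 2)).
  rewrite dx_mult by assumption.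
  rewrite (pint_ext l0 _ (fun x => (q x * p x) ^ 2)) by (intro; ring).
  rewrite (pint_ext l0 (fun x => (dx p x * q x + p x * dx q x) ^ 2)
    (fun x => (q x * dx p x + p x * dx q x) ^ 2)) by (intro; ring).
  pose proof (pint_sqr_ge0 p Cp). pose proof (pint_sqr_ge0 q Cq).
  pose proof (pint_sqr_ge0 (dx p) Cp'). pose proof (pint_sqr_ge0 (dx q) Cq').
  cbn [sob] in *.
  set (P := pint (fun x => p x ^ 2)) in *. set (P' := pint (fun x => dx p x ^ 2)) in *.
  set (Q := pint (fun x => q x ^ 2)) in *. set (Q' := pint (fun x => dx q x ^ 2)) in *.
  assert (HK : 0 < / l0 + 1) by (pose proof (Rinv_0_lt_compat l0 l0_pos); lra).
  set (K := / l0 + 1) in *.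
  assert (0 <= K * ((Q + Q') * P)) by (apply Rmult_le_pos; nra).
  assert (0 <= K * ((P + P') * Q)) by (apply Rmult_le_pos; nra). nra.
Qed.

(** [Hstep] turns the algebra property at order [r] into a tame estimate at order [S r], which in
    turn implies the algebra property there. The factor 3 collects 1 from the undifferentiated
    product and 2 from [sob_plus]. Tameness matters: each term contains only one top norm, so for
    [zeta^2] the dissipation enters linearly. *)
Lemma sob_mult (s : nat) : exists C, 0 <= C /\ forall p q, tpoly p -> tpoly q ->
  sob (S s) (fun x => p x * q x) <= C * (sob (S s) p * sob (S s) q) /\
  sob (S (S s)) (fun x => p x * q x)
    <= 3 * C * (sob (S (S s)) p * sob (S s) q + sob (S s) p * sob (S (S s)) q).
Proof.
  assert (Hstep : forall r C, 0 <= C ->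
    (forall p q, tpoly p -> tpoly q -> sob r (fun x => p x * q x) <= C * (sob r p * sob r q)) ->
    forall p q, tpoly p -> tpoly q -> sob (S r) (fun x => p x * q x)
      <= 3 * C * (sob (S r) p * sob r q + sob r p * sob (S r) q)).
  { intros r C HC H p q Hp Hq.
    destruct (tpoly_dx p Hp) as [Hp' _]. destruct (tpoly_dx q Hq) as [Hq' _].
    change (sob (S r) (fun x => p x * q x)) with
      (sob 0 (fun x => p x * q x) + sob r (dx (fun x => p x * q x))).
    rewrite dx_mult by assumption.
    pose proof (sob_0_le r _ (tpoly_mult l0 p q Hp Hq)) as H1.
    pose proof (H p q Hp Hq) as H2. pose proof (H _ q Hp' Hq) as H3. pose proof (H p _ Hp Hq') as H4.
    pose proof (sob_plus r _ _ (tpoly_mult l0 _ q Hp' Hq) (tpoly_mult l0 p _ Hp Hq')) as H5.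
    pose proof (sob_ge0 r p Hp). pose proof (sob_ge0 r q Hq).
    pose proof (sob_S r p Hp). pose proof (sob_dx_le r p Hp). pose proof (sob_dx_le r q Hq).
    pose proof (sob_ge0 r _ Hp'). pose proof (sob_ge0 r _ Hq').
    assert (Hmono : forall a b c d, 0 <= a <= b -> 0 <= c <= d -> C * (a * c) <= C * (b * d)).
    { intros. apply Rmult_le_compat_l; [assumption |]. apply Rmult_le_compat; lra. }
    pose proof (Hmono (sob r p) (sob (S r) p) (sob r q) (sob r q) ltac:(lra) ltac:(lra)).
    pose proof (Hmono (sob r (dx p)) (sob (S r) p) (sob r q) (sob r q) ltac:(lra) ltac:(lra)).
    pose proof (Hmono (sob r p) (sob r p) (sob r (dx q)) (sob (S r) q) ltac:(lra) ltac:(lra)).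
    pose proof (Hmono 0 (sob r p) 0 (sob (S r) q) ltac:(lra) ltac:(lra)).
    lra. }
  assert (Halg : exists C, 0 <= C /\ forall p q, tpoly p -> tpoly q ->
    sob (S s) (fun x => p x * q x) <= C * (sob (S s) p * sob (S s) q)).
  { induction s as [|s [C [HC IH]]].
    - exists (4 * (/ l0 + 1)). split; [pose proof (Rinv_0_lt_compat l0 l0_pos); lra |].
      intros. now apply sob_mult_1.
    - exists (6 * C). split; [lra |]. intros p q Hp Hq.
      pose proof (Hstep _ C HC IH p q Hp Hq).
      pose proof (sob_ge0 (S s) p Hp). pose proof (sob_ge0 (S s) q Hq).
      pose proof (sob_S (S s) p Hp). pose proof (sob_S (S s) q Hq).
      assert (C * (sob (S (S s)) p * sob (S s) q) <= C * (sob (S (S s)) p * sob (S (S s)) q)).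
      { apply Rmult_le_compat_l; [assumption |]. apply Rmult_le_compat_l; lra. }
      assert (C * (sob (S s) p * sob (S (S s)) q) <= C * (sob (S (S s)) p * sob (S (S s)) q)).
      { apply Rmult_le_compat_l; [assumption |]. apply Rmult_le_compat_r; lra. }
      lra. }
  destruct Halg as [C [HC H]]. exists C. split; [assumption |].
  intros p q Hp Hq. split; [now apply H | now apply Hstep].
Qed.

(** Induction on [W^(s+1) = W^s + W^s lambda], whose first part is at least 1. *)
Lemma sob_tp (s : nat) (a : nat -> R) (N : nat) :
  sob s (tp a (2 * N)) <= sum_f_R0 (fun k => W k ^ s * a k ^ 2) (2 * N).
Proof.
  revert a. induction s as [|s IH]; intro a.
  - cbn [sob]. rewrite pint_sqr_tp by assumption. right. apply sum_eq. intros. cbn; ring.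
  - change (sob (S s) (tp a (2 * N))) with
      (pint (fun x => tp a (2 * N) x ^ 2) + sob s (dx (tp a (2 * N)))).
    rewrite pint_sqr_tp by assumption.
    replace (dx (tp a (2 * N))) with (tp (fun k => dsym (partner k) * a (partner k)) (2 * N)).
    2: { apply functional_extensionality. intro x. symmetry. now apply dx_eq, tp_derivative. }
    eapply Rle_trans; [apply Rplus_le_compat_l, IH |].
    rewrite (sum_eq (fun k => W k ^ s * _) (fun k => W (partner k) ^ s * (dsym (partner k) * a (partner k)) ^ 2))
      by (intros; now rewrite W_partner).
    rewrite (sum_partner (fun k => W k ^ s * (dsym k * a k) ^ 2)), <- sum_plus.
    apply sum_le_compat. intro k. rewrite Rpow_mult_distr, dsym_sqr by assumption.
    pose proof (W_pow_ge1 l0 l0_pos s k) as HW. pose proof (pow2_ge_0 (a k)).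
    replace (W k ^ S s) with (W k ^ s + W k ^ s * lam l0 k) by (cbn [pow]; unfold weight; ring). nra.
Qed.

(** Splitting [W^(s+1)] as [W^s + W^s lambda] gives one sum for [p] and one for [dx p], each at most
    [2^s] times the norm of order [S s]; hence the doubling at each order. *)
Lemma fcoef_sob (s : nat) (p : R -> R) (N : nat) : tpoly p ->
  sum_f_R0 (fun k => W k ^ s * fc p k ^ 2) (2 * N) <= 2 ^ s * sob s p.
Proof.
  revert p. induction s as [|s IH]; intros p Hp.
  - cbn [sob]. rewrite (sum_eq _ (fun k => fc p k ^ 2)) by (intros; cbn; ring).
    pose proof (Bessel l0 l0_pos p (2 * N) ltac:(eauto with cts)). cbn. cbn in H. lra.
  - destruct (tpoly_dx p Hp) as [Hp' Hd].
    rewrite (sum_eq _ (fun k => W k ^ s * fc p k ^ 2 + W k ^ s * fc (dx p) (partner k) ^ 2)).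
    + rewrite sum_plus.
      rewrite (sum_eq (fun k => W k ^ s * fc (dx p) (partner k) ^ 2)
        (fun k => W (partner k) ^ s * fc (dx p) (partner k) ^ 2)) by (intros; now rewrite W_partner).
      rewrite (sum_partner (fun k => W k ^ s * fc (dx p) k ^ 2)).
      pose proof (IH p Hp). pose proof (IH _ Hp').
      assert (H2 : 0 <= 2 ^ s) by (apply pow_le; lra).
      pose proof (Rmult_le_compat_l _ _ _ H2 (sob_S s p Hp)).
      pose proof (Rmult_le_compat_l _ _ _ H2 (sob_dx_le s p Hp)).
      rewrite <- tech_pow_Rmult. lra.
    + intros k _. rewrite (fcoef_derivative l0 l0_pos p (dx p)) by eauto using tpoly_periodic with cts.
      rewrite partner_involutive, !Rpow_mult_distr, dsym_partner by assumption.
      replace ((- - dsym k) ^ 2) with (dsym k ^ 2) by ring. rewrite dsym_sqr by assumption.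
      cbn [pow]. unfold weight. ring.
Qed.

Lemma tp_bound (a : nat -> R) (B : R) (N : nat) (x : R) : hs_le 1 a B ->
  Rabs (tp a N x) <= sqrt (2 / l0) * (1 + B * (6 * (1 + l0 ^ 2))).
Proof.
  intros H. pose proof (sum_abs_le l0 l0_pos a B N H) as Hs.
  pose proof (sum_nonneg (fun k => Rabs (a k)) N ltac:(intro; apply Rabs_pos)).
  apply Rle_trans with (sqrt (2 / l0) * sum_f_R0 (fun k => Rabs (a k)) N).
  - unfold trig_sum. eapply Rle_trans; [apply Rsum_abs |]. rewrite <- sum_mult_l.
    apply sum_le_compat. intro k. rewrite Rabs_mult, Rmult_comm.
    apply Rmult_le_compat_r; [apply Rabs_pos | now apply wk_bound].
  - apply Rmult_le_compat_l; [apply sqrt_pos | nra].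
Qed.

Lemma unif_lim_mult (u v : nat -> R -> R) (f g : R -> R) (M : R) :
  unif_lim u f -> unif_lim v g -> (forall N x, Rabs (u N x) <= M) -> (forall N x, Rabs (v N x) <= M) ->
  unif_lim (fun N x => u N x * v N x) (fun x => f x * g x).
Proof.
  intros Hu Hv Mu Mv e He.
  assert (HM : 0 <= M) by (eapply Rle_trans; [apply Rabs_pos | apply (Mu O 0)]).
  assert (Mf : forall x, Rabs (f x) <= M).
  { intro x. apply (Un_cv_le_const (fun N => Rabs (u N x))); [| intro; apply Mu].
    apply (cv_cvabs (fun N => u N x)). now apply (unif_lim_Un_cv u). }
  assert (Hd : 0 < e / (2 * (M + 1))) by (apply Rdiv_lt_0_compat; lra).
  destruct (Hu _ Hd) as [N1 H1]. destruct (Hv _ Hd) as [N2 H2]. exists (max N1 N2). intros N x HN.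
  specialize (H1 N x ltac:(lia)). specialize (H2 N x ltac:(lia)).
  replace (u N x * v N x - f x * g x) with ((u N x - f x) * v N x + f x * (v N x - g x)) by ring.
  eapply Rle_lt_trans; [apply Rabs_triang |]. rewrite !Rabs_mult.
  assert (Rabs (u N x - f x) * Rabs (v N x) <= e / (2 * (M + 1)) * M)
    by (apply Rmult_le_compat; auto using Rabs_pos; lra).
  assert (Rabs (f x) * Rabs (v N x - g x) <= M * (e / (2 * (M + 1))))
    by (apply Rmult_le_compat; auto using Rabs_pos; lra).
  assert (e / (2 * (M + 1)) * (2 * (M + 1)) = e) by (field; lra). lra.
Qed.

Lemma fcoef_mult_bound (s : nat) : exists C, 0 <= C /\ forall f g F1 F2 G1 G2,
  periodic l0 f -> cts f -> periodic l0 g -> cts g ->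
  hs_le (S s) (fc f) F1 -> hs_le (S (S s)) (fc f) F2 -> hs_le (S s) (fc g) G1 -> hs_le (S (S s)) (fc g) G2 ->
  hs_le (S (S s)) (fc (fun x => f x * g x)) (C * (F2 * G1 + F1 * G2)).
Proof.
  destruct (sob_mult s) as [C [HC Hmult]].
  exists (2 ^ S (S s) * (3 * C)).
  assert (H2 : 0 <= 2 ^ S (S s)) by (apply pow_le; lra).
  split; [apply Rmult_le_pos; lra |].
  intros f g F1 F2 G1 G2 Pf Cf Pg Cg HF1 HF2 HG1 HG2 N.
  assert (Hf : hs_le 1 (fc f) F1) by (apply (hs_le_mono l0 l0_pos (S s)); [lia | assumption]).
  assert (Hg : hs_le 1 (fc g) G1) by (apply (hs_le_mono l0 l0_pos (S s)); [lia | assumption]).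
  set (p := fun M => tp (fc f) (2 * M)). set (q := fun M => tp (fc g) (2 * M)).
  assert (Tp : forall M, tpoly (p M)) by (intro; now apply tpoly_tp).
  assert (Tq : forall M, tpoly (q M)) by (intro; now apply tpoly_tp).
  assert (Hpq : unif_lim (fun M x => p M x * q M x) (fun x => f x * g x)).
  { set (K := 1 + (F1 + G1) * (6 * (1 + l0 ^ 2))).
    assert (0 <= F1) by (eapply hs_le_ge0; eassumption). assert (0 <= G1) by (eapply hs_le_ge0; eassumption).
    assert (0 <= 6 * (1 + l0 ^ 2)) by nra.
    apply unif_lim_mult with (M := sqrt (2 / l0) * K).
    - apply (unif_lim_double (tp (fc f))). now apply fourier_unif with (B := F1).
    - apply (unif_lim_double (tp (fc g))). now apply fourier_unif with (B := G1).
    - intros M x. eapply Rle_trans; [apply tp_bound, Hf |].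
      apply Rmult_le_compat_l; [apply sqrt_pos | unfold K; nra].
    - intros M x. eapply Rle_trans; [apply tp_bound, Hg |].
      apply Rmult_le_compat_l; [apply sqrt_pos | unfold K; nra]. }
  (* The truncation [N] of the norm is fixed while the approximation index [M] tends to infinity, so
     only finitely many coefficients must converge; the bound is uniform in [M]. *)
  assert (Hlim : Un_cv (fun M => sum_f_R0 (fun k => W k ^ S (S s) * fc (fun x => p M x * q M x) k ^ 2) N)
    (sum_f_R0 (fun k => W k ^ S (S s) * fc (fun x => f x * g x) k ^ 2) N)).
  { apply sum_lim. intro k.
    apply (CV_mult (fun _ => W k ^ S (S s))).
    - intros e He. exists O. intros. unfold Rdist. rewrite Rminus_diag, Rabs_R0. lra.
    - assert (Hk : Un_cv (fun M => fc (fun x => p M x * q M x) k) (fc (fun x => f x * g x) k)).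
      { apply (unif_lim_fcoef l0 l0_pos (fun M x => p M x * q M x)); [assumption |].
        intro M. pose proof (tpoly_cts _ _ (Tp M)). pose proof (tpoly_cts _ _ (Tq M)). auto with cts. }
      cbn [pow]. apply CV_mult; [assumption |]. apply CV_mult; [assumption |].
      intros e He. exists O. intros. unfold Rdist. rewrite Rminus_diag, Rabs_R0. lra. }
  apply (Un_cv_le_const _ _ _ Hlim). intro M.
  pose proof (tpoly_mult l0 _ _ (Tp M) (Tq M)) as Tpq.
  eapply Rle_trans; [apply sum_le_index with (M := (2 * N)%nat);
    [intro k; apply (hs_le_term_ge0 l0 l0_pos _ (fc (fun x => p M x * q M x))) | lia] |].
  eapply Rle_trans; [now apply fcoef_sob |].
  rewrite Rmult_assoc. apply Rmult_le_compat_l; [assumption |].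
  eapply Rle_trans; [now apply Hmult |]. apply Rmult_le_compat_l; [lra |].
  assert (Bp : forall r B, hs_le r (fc f) B -> sob r (p M) <= B)
    by (intros r B H; eapply Rle_trans; [apply sob_tp | apply H]).
  assert (Bq : forall r B, hs_le r (fc g) B -> sob r (q M) <= B)
    by (intros r B H; eapply Rle_trans; [apply sob_tp | apply H]).
  apply Rplus_le_compat; apply Rmult_le_compat; auto using sob_ge0.
Qed.

End Products.

(** * Differential inequalities *)

(** Real induction by a supremum. At [t = a] the hypothesis of the first premise is vacuous, so this
    premise also provides the base case. *)
Lemma interval_induction (P : R -> Prop) (a b : R) : a <= b ->
  (forall t, a <= t <= b -> (forall s, a <= s < t -> P s) -> P t) ->
  (forall t, a <= t < b -> (forall s, a <= s <= t -> P s) ->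
     exists d, 0 < d /\ forall s, t < s < t + d -> s <= b -> P s) ->
  forall t, a <= t <= b -> P t.
Proof.
  intros Hab Hclosed Hopen.
  set (S := fun t => a <= t <= b /\ forall s, a <= s <= t -> P s).
  assert (HSa : S a).
  { split; [lra |]. intros s Hs. apply Hclosed; [lra | intros; lra]. }
  destruct (completeness S) as [m [Hub Hlub]].
  - exists b. intros t [Ht _]. lra.
  - now exists a.
  - assert (Ham : a <= m) by now apply Hub.
    assert (Hmb : m <= b) by (apply Hlub; intros t [Ht _]; lra).
    assert (Hlt : forall s, a <= s < m -> P s).
    { intros s Hs. apply Classical_Prop.NNPP. intro Hn.
      assert (m <= s); [| lra]. apply Hlub. intros t [Ht HP].
      apply Rnot_lt_le. intro Hst. apply Hn, HP. lra. }
    assert (HPm : forall s, a <= s <= m -> P s).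
    { intros s Hs. apply Hclosed; [lra |]. intros r Hr. apply Hlt. lra. }
    destruct (Req_dec m b) as [-> | Hne]; [assumption | exfalso].
    destruct (Hopen m ltac:(lra) HPm) as [d [Hd HP]].
    set (t := Rmin (m + d / 2) b).
    assert (Ht : m < t <= b) by (split; [apply Rmin_glb_lt; lra | apply Rmin_r]).
    assert (Ht2 : t <= m + d / 2) by apply Rmin_l.
    assert (t <= m); [| lra]. apply Hub. split; [lra |]. intros s Hs.
    destruct (Rle_dec s m); [apply HPm; lra | apply HP; lra].
Qed.

(* One-sided at the end points of the interval. *)
Definition wder (A B : R) (f : R -> R) (l t0 : R) : Prop :=
  forall e, 0 < e -> exists d, 0 < d /\ forall t, A <= t <= B -> Rabs (t - t0) < d ->
    Rabs (f t - f t0 - l * (t - t0)) <= e * Rabs (t - t0).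

Lemma wder_lipschitz (A B : R) (f : R -> R) (l t0 : R) : wder A B f l t0 ->
  exists d, 0 < d /\ forall t, A <= t <= B -> Rabs (t - t0) < d ->
    Rabs (f t - f t0) <= (Rabs l + 1) * Rabs (t - t0).
Proof.
  intros H. destruct (H 1 ltac:(lra)) as [d [Hd H1]]. exists d. split; [assumption |].
  intros t Ht Htd. specialize (H1 t Ht Htd).
  replace (f t - f t0) with (f t - f t0 - l * (t - t0) + l * (t - t0)) by ring.
  eapply Rle_trans; [apply Rabs_triang |]. rewrite (Rabs_mult l). lra.
Qed.

Lemma wder_plus (A B : R) (f g : R -> R) (l m t0 : R) :
  wder A B f l t0 -> wder A B g m t0 -> wder A B (fun t => f t + g t) (l + m) t0.
Proof.
  intros Hf Hg e He.
  destruct (Hf (e / 2) ltac:(lra)) as [d1 [Hd1 H1]]. destruct (Hg (e / 2) ltac:(lra)) as [d2 [Hd2 H2]].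
  exists (Rmin d1 d2). split; [now apply Rmin_glb_lt |]. intros t Ht Htd.
  specialize (H1 t Ht (Rlt_le_trans _ _ _ Htd (Rmin_l _ _))).
  specialize (H2 t Ht (Rlt_le_trans _ _ _ Htd (Rmin_r _ _))).
  replace (f t + g t - (f t0 + g t0) - (l + m) * (t - t0))
    with ((f t - f t0 - l * (t - t0)) + (g t - g t0 - m * (t - t0))) by ring.
  eapply Rle_trans; [apply Rabs_triang |]. lra.
Qed.

Lemma wder_scal (A B : R) (f : R -> R) (c l t0 : R) :
  wder A B f l t0 -> wder A B (fun t => c * f t) (c * l) t0.
Proof.
  intros Hf e He. pose proof (Rabs_pos c) as Hc.
  destruct (Hf (e / (Rabs c + 1))) as [d [Hd H]]; [apply Rdiv_lt_0_compat; lra |].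
  exists d. split; [assumption |]. intros t Ht Htd. specialize (H t Ht Htd).
  replace (c * f t - c * f t0 - c * l * (t - t0)) with (c * (f t - f t0 - l * (t - t0))) by ring.
  rewrite Rabs_mult. pose proof (Rabs_pos (t - t0)).
  apply Rle_trans with (Rabs c * (e / (Rabs c + 1) * Rabs (t - t0))).
  - now apply Rmult_le_compat_l.
  - rewrite <- Rmult_assoc. apply Rmult_le_compat_r; [assumption |].
    assert (0 < e / (Rabs c + 1)) by (apply Rdiv_lt_0_compat; lra).
    assert (e / (Rabs c + 1) * (Rabs c + 1) = e) by (field; lra). lra.
Qed.

Lemma wder_id (A B t0 : R) : wder A B (fun t => t) 1 t0.
Proof.
  intros e He. exists 1. split; [lra |]. intros t _ _.
  replace (t - t0 - 1 * (t - t0)) with 0 by ring. rewrite Rabs_R0.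
  apply Rmult_le_pos; [lra | apply Rabs_pos].
Qed.

Lemma wder_sqr (A B : R) (f : R -> R) (l t0 : R) :
  wder A B f l t0 -> wder A B (fun t => f t ^ 2) (2 * (f t0 * l)) t0.
Proof.
  intros Hf e He. destruct (wder_lipschitz A B f l t0 Hf) as [d1 [Hd1 HL]].
  set (c := 2 * f t0). pose proof (wder_scal A B f c l t0 Hf (e / 2) ltac:(lra)) as [d2 [Hd2 H2]].
  set (L := Rabs l + 1) in *. assert (HL0 : 0 < L) by (unfold L; pose proof (Rabs_pos l); lra).
  (* The increment of the square is the increment of [f] squared plus a linear part; the former is
     at most [L^2 |t - t0|^2], and [d3] makes it at most [e / 2 * |t - t0|]. *)
  set (d3 := e / (2 * L ^ 2)).
  assert (Hd3 : 0 < d3) by (apply Rdiv_lt_0_compat; [lra | nra]).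
  exists (Rmin d3 (Rmin d1 d2)). split; [repeat apply Rmin_glb_lt; assumption |]. intros t Ht Htd.
  pose proof (Rmin_l d3 (Rmin d1 d2)). pose proof (Rmin_r d3 (Rmin d1 d2)).
  pose proof (Rmin_l d1 d2). pose proof (Rmin_r d1 d2).
  specialize (HL t Ht ltac:(lra)). specialize (H2 t Ht ltac:(lra)).
  replace (f t ^ 2 - f t0 ^ 2 - 2 * (f t0 * l) * (t - t0))
    with ((f t - f t0) * (f t - f t0) + (c * f t - c * f t0 - c * l * (t - t0))) by (unfold c; ring).
  eapply Rle_trans; [apply Rabs_triang |]. rewrite Rabs_mult.
  pose proof (Rabs_pos (t - t0)). pose proof (Rabs_pos (f t - f t0)).
  assert (Rabs (f t - f t0) * Rabs (f t - f t0) <= (L * Rabs (t - t0)) * (L * Rabs (t - t0)))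
    by (apply Rmult_le_compat; lra).
  assert (L ^ 2 * Rabs (t - t0) <= e / 2).
  { replace (e / 2) with (L ^ 2 * d3) by (unfold d3; field; lra). apply Rmult_le_compat_l; [nra | lra]. }
  nra.
Qed.

Lemma wder_sum (A B : R) (f : nat -> R -> R) (l : nat -> R) (t0 : R) (N : nat) :
  (forall k, wder A B (f k) (l k) t0) ->
  wder A B (fun t => sum_f_R0 (fun k => f k t) N) (sum_f_R0 l N) t0.
Proof.
  intros H. induction N as [|N IH]; cbn [sum_f_R0]; [apply H | now apply wder_plus].
Qed.

(** Mean value inequality for a derivative that need not be continuous, by real induction with the
    slope [c + e]. Local Lipschitz continuity closes the set of good times; differentiability opens
    it. *)
Lemma wder_increment_le (A B : R) (f f' : R -> R) (a b c : R) : A <= a -> a <= b -> b <= B ->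
  (forall t, a <= t <= b -> wder A B f (f' t) t) -> (forall t, a <= t <= b -> f' t <= c) ->
  f b - f a <= c * (b - a).
Proof.
  intros HA Hab HB Hd Hc. apply Rnot_lt_le. intro Hlt.
  (* Over the whole interval this slack uses up less than half of the supposed excess. *)
  set (e := (f b - f a - c * (b - a)) / (2 * (b - a + 1))).
  assert (He : 0 < e) by (apply Rdiv_lt_0_compat; lra).
  assert (Hall : forall t, a <= t <= b -> f t - f a <= (c + e) * (t - a)).
  { apply interval_induction; [assumption | |].
    - intros t Ht Hs. destruct (Req_dec t a) as [-> | Hne]; [lra |].
      apply Rnot_lt_le. intro Hn.
      set (r := f t - f a - (c + e) * (t - a)). assert (Hr : 0 < r) by (unfold r; lra).
      destruct (wder_lipschitz A B f (f' t) t (Hd t Ht)) as [d [Hd0 HL]].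
      set (L := Rabs (f' t) + 1 + Rabs (c + e)) in *.
      assert (HL0 : 0 < L) by (unfold L; pose proof (Rabs_pos (f' t)); pose proof (Rabs_pos (c + e)); lra).
      set (u := Rmin (d / 2) (Rmin ((t - a) / 2) (r / (2 * L)))).
      assert (Hu : 0 < u).
      { repeat apply Rmin_glb_lt; try lra. apply Rdiv_lt_0_compat; lra. }
      pose proof (Rmin_l (d / 2) (Rmin ((t - a) / 2) (r / (2 * L)))).
      pose proof (Rmin_r (d / 2) (Rmin ((t - a) / 2) (r / (2 * L)))).
      pose proof (Rmin_l ((t - a) / 2) (r / (2 * L))). pose proof (Rmin_r ((t - a) / 2) (r / (2 * L))).
      fold u in H, H0.
      specialize (Hs (t - u) ltac:(lra)).
      assert (Habs : Rabs (t - u - t) = u) by (replace (t - u - t) with (- u) by ring; rewrite Rabs_Ropp; apply Rabs_pos_eq; lra).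
      specialize (HL (t - u) ltac:(lra) ltac:(lra)). rewrite Habs in HL.
      apply Rabs_le_between in HL. pose proof (Rle_abs (- (c + e))) as Hce. rewrite Rabs_Ropp in Hce.
      assert (L * u <= r / 2).
      { replace (r / 2) with (L * (r / (2 * L))) by (field; lra). apply Rmult_le_compat_l; lra. }
      unfold L, r in *. nra.
    - intros t Ht Hs. destruct (Hd t ltac:(lra) e He) as [d [Hd0 H]].
      exists d. split; [assumption |]. intros s Hst Hsb.
      specialize (H s ltac:(lra) ltac:(rewrite Rabs_pos_eq; lra)).
      rewrite (Rabs_pos_eq (s - t)) in H by lra. apply Rabs_le_between in H.
      specialize (Hs t ltac:(lra)). specialize (Hc t ltac:(lra)). nra. }
  specialize (Hall b ltac:(lra)).
  assert (e * (2 * (b - a + 1)) = f b - f a - c * (b - a)) by (unfold e; field; lra). nra.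
Qed.

Lemma wder_increment_abs_le (A B : R) (f f' : R -> R) (a b c : R) :
  A <= a -> a <= b -> b <= B ->
  (forall t, a <= t <= b -> wder A B f (f' t) t) -> (forall t, a <= t <= b -> Rabs (f' t) <= c) ->
  Rabs (f b - f a) <= c * (b - a).
Proof.
  intros HA Hab HB Hd Hc. apply Rabs_le. split.
  - assert (-1 * f b - -1 * f a <= c * (b - a)); [| lra].
    apply (wder_increment_le A B (fun t => -1 * f t) (fun t => -1 * f' t)); trivial.
    + intros t Ht. now apply wder_scal, Hd.
    + intros t Ht. specialize (Hc t Ht). apply Rabs_le_between in Hc. lra.
  - apply (wder_increment_le A B f f'); trivial.
    intros t Ht. specialize (Hc t Ht). apply Rabs_le_between in Hc. lra.
Qed.

(** The rate bound is available only below the final threshold, which real induction guarantees at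
    each time reached. The exponent [K + 1] leaves room for two errors of [/ 2], from the rate and
    from the increment, since together they are at most [1 + E]. *)
Lemma bootstrap (T1 K : R) (En Gn : nat -> R -> R) (E : R -> R) : 0 <= T1 -> 0 <= K ->
  (forall t N, 0 <= t <= T1 -> En N t <= E t) ->
  (forall t c N0, 0 <= t <= T1 -> (forall N, (N0 <= N)%nat -> En N t <= c) -> E t <= c) ->
  (forall t0 e, 0 <= t0 <= T1 -> 0 < e -> exists d, 0 < d /\
     forall t N, 0 <= t <= T1 -> Rabs (t - t0) < d ->
       Rabs (En N t - En N t0 - Gn N t0 * (t - t0)) <= e * Rabs (t - t0)) ->
  (forall t, 0 <= t <= T1 -> exists b, forall N, Rabs (Gn N t) <= b) ->
  (forall t e, 0 <= t <= T1 -> 0 <= E t -> 1 + E t <= exp ((K + 1) * T1) -> 0 < e ->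
     exists N0, forall N, (N0 <= N)%nat -> Gn N t <= K * (1 + E t) + e) ->
  (forall t, 0 <= t <= T1 -> 0 <= E t) ->
  E 0 <= 0 ->
  forall t, 0 <= t <= T1 -> 1 + E t <= exp ((K + 1) * t).
Proof.
  intros HT HK Hle Hsup Hinc HGb HG HE0 Hinit.
  apply interval_induction; [assumption | |].
  - intros t Ht Hs. destruct (Req_dec t 0) as [-> | Hne].
    + rewrite Rmult_0_r, exp_0. lra.
    + assert (E t <= exp ((K + 1) * t) - 1); [| lra].
      apply (Hsup t _ O Ht). intros N _. apply Rnot_lt_le. intro Hlt.
      (* Stepping back by [u] changes [En N] by at most [r / 2], so a violation of size [r] at [t]
         would already show at [t - u]. Each [N] may have its own bound; the supremum is taken
         afterwards. *)
      set (r := En N t - (exp ((K + 1) * t) - 1)). assert (Hr : 0 < r) by (unfold r; lra).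
      destruct (HGb t Ht) as [b Hb]. specialize (Hb N).
      destruct (Hinc t 1 Ht ltac:(lra)) as [d [Hd H]].
      assert (Hb0 : 0 <= b) by (eapply Rle_trans; [apply Rabs_pos | apply Hb]).
      set (u := Rmin (d / 2) (Rmin (t / 2) (r / (2 * (b + 1))))).
      assert (Hu : 0 < u).
      { repeat apply Rmin_glb_lt; try lra. apply Rdiv_lt_0_compat; lra. }
      pose proof (Rmin_l (d / 2) (Rmin (t / 2) (r / (2 * (b + 1))))) as M1.
      pose proof (Rmin_r (d / 2) (Rmin (t / 2) (r / (2 * (b + 1))))) as M2.
      pose proof (Rmin_l (t / 2) (r / (2 * (b + 1)))). pose proof (Rmin_r (t / 2) (r / (2 * (b + 1)))).
      fold u in M1, M2.
      assert (Habs : Rabs (t - u - t) = u) by (replace (t - u - t) with (- u) by ring; rewrite Rabs_Ropp; apply Rabs_pos_eq; lra).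
      specialize (H (t - u) N ltac:(lra) ltac:(lra)). rewrite Habs in H. apply Rabs_le_between in H.
      specialize (Hs (t - u) ltac:(lra)). pose proof (Hle (t - u) N ltac:(lra)).
      assert (exp ((K + 1) * (t - u)) <= exp ((K + 1) * t)).
      { left. apply exp_increasing. apply Rmult_lt_compat_l; lra. }
      assert ((b + 1) * u <= r / 2).
      { replace (r / 2) with ((b + 1) * (r / (2 * (b + 1)))) by (field; lra). apply Rmult_le_compat_l; lra. }
      apply Rabs_le_between in Hb. unfold r in *. nra.
  - intros t Ht Hs. specialize (Hs t ltac:(lra)).
    pose proof (HE0 t ltac:(lra)) as Et.
    destruct (HG t (/ 2) ltac:(lra) Et) as [N0 HN]; [| lra |].
    { eapply Rle_trans; [apply Hs |]. left. apply exp_increasing. apply Rmult_lt_compat_l; lra. }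
    destruct (Hinc t (/ 2) ltac:(lra) ltac:(lra)) as [d [Hd H]].
    exists d. split; [assumption |]. intros s Hst Hsb.
    assert (Hs2 : E s <= E t + (K * (1 + E t) + 1) * (s - t)).
    { apply (Hsup s _ N0 ltac:(lra)). intros N HNN. specialize (HN N HNN).
      specialize (H s N ltac:(lra) ltac:(rewrite Rabs_pos_eq; lra)).
      rewrite (Rabs_pos_eq (s - t)) in H by lra. apply Rabs_le_between in H.
      pose proof (Hle t N ltac:(lra)). nra. }
    replace ((K + 1) * s) with ((K + 1) * t + (K + 1) * (s - t)) by ring. rewrite exp_plus.
    apply Rle_trans with ((1 + E t) * (1 + (K + 1) * (s - t))); [nra |].
    apply Rmult_le_compat; trivial; [lra | nra |].
    destruct (Req_dec ((K + 1) * (s - t)) 0) as [H0 | H0]; [rewrite H0, exp_0; lra |].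
    left. now apply exp_ineq1.
Qed.

(** * Symbol bounds, the modewise energy inequality, and time increments of truncated energies *)

Section Symbols.
Context (l0 : R) (l0_pos : 0 < l0).
Notation W := (weight l0).
Notation hs_le := (hs_le l0).

Lemma Xe_sqr (eps : R) (k : nat) : 0 < eps -> Xe l0 eps k ^ 2 = 1 + 4 * eps * lam l0 k.
Proof.
  intros He. apply pow2_sqrt. pose proof (lam_ge0 l0 l0_pos k). nra.
Qed.

Lemma Xe_ge1 (eps : R) (k : nat) : 0 < eps -> 1 <= Xe l0 eps k.
Proof.
  intros He. rewrite <- sqrt_1. apply sqrt_le_1_alt. pose proof (lam_ge0 l0 l0_pos k). nra.
Qed.

Lemma Xe_sqr_le (eps : R) (k : nat) : 0 < eps <= 1 -> Xe l0 eps k ^ 2 <= 4 * W k.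
Proof.
  intros He. rewrite Xe_sqr by lra. unfold weight. pose proof (lam_ge0 l0 l0_pos k). nra.
Qed.

(** Here [b = 4 eps lambda + (1 + eps) X - eps] with [X >= 1], hence [b >= 1 + 4 eps lambda]. *)
Lemma b_sym_lower (eps : R) (k : nat) : 0 < eps <= 1 ->
  1 <= b_sym l0 eps k /\ eps * W k <= b_sym l0 eps k.
Proof.
  intros He. unfold b_sym, weight. rewrite Xe_sqr by lra.
  pose proof (Xe_ge1 eps k ltac:(lra)). pose proof (lam_ge0 l0 l0_pos k). split; nra.
Qed.

Lemma b_sym_upper (eps : R) (k : nat) : 0 < eps <= 1 -> b_sym l0 eps k <= 12 * W k.
Proof.
  intros He. unfold b_sym. pose proof (Xe_ge1 eps k ltac:(lra)). pose proof (Xe_sqr_le eps k He). nra.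
Qed.

(** The constant 16 absorbs the destabilising term [+ lambda]: the gap is
    [lambda^2 - 7 lambda + 13], a quadratic of negative discriminant. *)
Lemma s_sym_le (k : nat) : s_sym l0 k <= - 3 * W k ^ 2 + 16.
Proof.
  unfold s_sym, weight. pose proof (pow2_ge_0 (2 * lam l0 k - 7)). nra.
Qed.

(** The factor [1 / eps] cancels because [eps h = (X^2 - 1) + (1 + eps) (X - 1)], where
    [X^2 - 1 = 4 eps lambda] and [X - 1 <= 2 eps lambda]. *)
Lemma h_sym_bounds (eps : R) (k : nat) : 0 < eps <= 1 -> 0 <= h_sym l0 eps k <= 8 * W k.
Proof.
  intros He. pose proof (Xe_ge1 eps k ltac:(lra)) as HX. pose proof (Xe_sqr eps k ltac:(lra)) as H2.
  pose proof (lam_ge0 l0 l0_pos k) as HL. unfold h_sym. set (X := Xe l0 eps k) in *.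
  assert (HX1 : X - 1 <= 2 * eps * lam l0 k) by nra.
  assert (Hi : 0 < / eps) by (apply Rinv_0_lt_compat; lra). split.
  - apply Rmult_le_pos; nra.
  - apply (Rmult_le_reg_l eps); [lra |]. rewrite <- Rmult_assoc, Rinv_r, Rmult_1_l by lra.
    unfold weight. assert (eps * (X - 1) <= 1 * (X - 1)) by (apply Rmult_le_compat_r; lra). nra.
Qed.

(** The numerator vanishes at [X = 1] and factors as [(X - 1) (X^2 - 2 X - 6 - 4 eps)]. Since
    [(X - 1) / (4 eps) = lambda / (X + 1)], the singular factor disappears and [m = lambda r] with
    [r] of order [X]. *)
Lemma m_sym_sqr_le (eps : R) (k : nat) : 0 < eps <= 1 -> m_sym l0 eps k ^ 2 <= 256 * W k ^ 3.
Proof.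
  intros He. pose proof (Xe_ge1 eps k ltac:(lra)) as HX. pose proof (Xe_sqr eps k ltac:(lra)) as H2.
  pose proof (Xe_sqr_le eps k He) as H3. pose proof (lam_ge0 l0 l0_pos k) as HL.
  unfold m_sym. set (X := Xe l0 eps k) in *.
  set (r := (X ^ 2 - 2 * X - 6 - 4 * eps) / (X + 1)).
  replace (/ (4 * eps) * _) with (lam l0 k * r).
  2: { unfold r. apply (Rmult_eq_reg_l (4 * eps * (X + 1))); [| nra].
       field_simplify; [| lra | lra]. replace (4 * lam l0 k * eps) with (X ^ 2 - 1) by lra.
       replace (lam l0 k) with ((X ^ 2 - 1) / (4 * eps)) by (rewrite H2; field; lra). field. lra. }
  assert (Hr : Rabs r <= 8 * X).
  { unfold r, Rdiv. rewrite Rabs_mult, Rabs_inv, (Rabs_pos_eq (X + 1)) by lra.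
    apply (Rmult_le_reg_r (X + 1)); [lra |]. rewrite Rmult_assoc, Rinv_l, Rmult_1_r by lra.
    apply Rabs_le. nra. }
  assert (Hr2 : r ^ 2 <= 256 * W k).
  { rewrite <- pow2_abs. pose proof (Rabs_pos r). nra. }
  assert (HW : lam l0 k ^ 2 <= W k ^ 2) by (unfold weight; nra).
  rewrite Rpow_mult_distr. replace (256 * W k ^ 3) with (W k ^ 2 * (256 * W k)) by ring.
  apply Rmult_le_compat; auto using pow2_ge_0.
Qed.

(** Both follow from [|f| <= 5 X^3]. The first suffices where a factor [eps] is present; the second
    isolates a bounded part through [(1 + a)^3 <= 4 (1 + a^3)] with [a = 4 eps lambda]. *)
Lemma f_sym_sqr_le (eps : R) (k : nat) : 0 < eps <= 1 ->
  f_sym l0 eps k ^ 2 <= 1600 * W k ^ 3 /\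
  f_sym l0 eps k ^ 2 <= 100 + 6400 * eps ^ 3 * W k ^ 3.
Proof.
  intros He. pose proof (Xe_ge1 eps k ltac:(lra)) as HX. pose proof (Xe_sqr eps k ltac:(lra)) as H2.
  pose proof (Xe_sqr_le eps k He) as H3. pose proof (lam_ge0 l0 l0_pos k) as HL.
  assert (Hf : f_sym l0 eps k ^ 2 <= 25 * (Xe l0 eps k ^ 2) ^ 3).
  { unfold f_sym. set (X := Xe l0 eps k) in *.
    assert (H23 : X ^ 2 <= X ^ 3) by (apply Rle_pow; [assumption | lia]).
    assert (H13 : X <= X ^ 3) by (rewrite <- (pow_1 X) at 1; apply Rle_pow; [assumption | lia]).
    assert (Hab : Rabs (/ 4 * (X ^ 3 - 3 * X ^ 2 - 4 * (1 + eps) * X + 4 + 4 * eps)) <= 5 * X ^ 3).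
    { assert (0 <= eps * X <= X) by nra. apply Rabs_le. split; nra. }
    rewrite <- pow2_abs. replace (25 * (X ^ 2) ^ 3) with ((5 * X ^ 3) ^ 2) by ring.
    apply pow_incr. split; [apply Rabs_pos | assumption]. }
  split; (eapply Rle_trans; [apply Hf |]).
  - replace (1600 * W k ^ 3) with (25 * (4 * W k) ^ 3) by ring.
    apply Rmult_le_compat_l; [lra |]. apply pow_incr. split; [apply pow2_ge_0 | assumption].
  - rewrite H2. set (a := 4 * eps * lam l0 k). assert (Ha : 0 <= a) by (unfold a; nra).
    assert (Hconv : (1 + a) ^ 3 <= 4 * (1 + a ^ 3)).
    { replace (4 * (1 + a ^ 3)) with ((1 + a) ^ 3 + 3 * ((1 + a) * (1 - a) ^ 2)) by ring.
      pose proof (Rmult_le_pos (1 + a) _ ltac:(lra) (pow2_ge_0 (1 - a))). lra. }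
    assert (Ha3 : a ^ 3 <= 64 * eps ^ 3 * W k ^ 3).
    { replace (64 * eps ^ 3 * W k ^ 3) with ((4 * eps * W k) ^ 3) by ring.
      apply pow_incr. split; [assumption |]. unfold a, weight. nra. }
    lra.
Qed.

Lemma young (x z m : R) : 0 < m -> x * z <= / (2 * m) * x ^ 2 + m / 2 * z ^ 2.
Proof.
  intros Hm. apply (Rmult_le_reg_l (2 * m)); [lra |].
  replace (2 * m * (/ (2 * m) * x ^ 2 + m / 2 * z ^ 2)) with (x ^ 2 + (m * z) ^ 2) by (field; lra).
  pose proof (pow2_ge_0 (x - m * z)). nra.
Qed.

(* The weight of [z] in each Young inequality is [W ^ 2 / 2], so that half of the dissipation
   [- 3 W ^ 2] survives; the bounded part of [f_sym] is compensated by the extra weight [kp]. *)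
Lemma energy_term (eps kp z p c1 c2 c3 q1 q2 q3 bz : R) (k : nat) : 0 < eps <= 1 -> 0 < kp ->
  c1 ^ 2 <= W k * q1 ^ 2 -> c2 ^ 2 <= W k * q2 ^ 2 -> c3 ^ 2 <= W k * q3 ^ 2 ->
  bz + h_sym l0 eps k * p = s_sym l0 k * z + m_sym l0 eps k * c1
    + eps * f_sym l0 eps k * c2 + 2 * f_sym l0 eps k * c3 ->
  z * bz <= - (3 / 2) * (W k ^ 2 * z ^ 2) + (20 + kp / 2) * z ^ 2 + 4 * (W k ^ 2 * p ^ 2)
    + 128 * (W k ^ 2 * q1 ^ 2) + 800 * eps ^ 2 * (W k ^ 2 * q2 ^ 2)
    + (200 / kp + 12800 * eps) * (W k ^ 2 * q3 ^ 2).
Proof.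
  intros He Hkp Hc1 Hc2 Hc3 Heq.
  pose proof (W_ge1 l0 l0_pos k) as HW.
  pose proof (s_sym_le k) as Hs. pose proof (h_sym_bounds eps k He) as Hh.
  pose proof (m_sym_sqr_le eps k He) as Hm. pose proof (f_sym_sqr_le eps k He) as [Hf1 Hf2].
  set (w := W k) in *. set (h := h_sym l0 eps k) in *. set (m := m_sym l0 eps k) in *.
  set (f := f_sym l0 eps k) in *.
  assert (Hw2 : 0 < w ^ 2) by nra. pose proof (pow2_ge_0 z) as Hz.
  assert (T0 : s_sym l0 k * z ^ 2 <= (- 3 * w ^ 2 + 16) * z ^ 2) by now apply Rmult_le_compat_r.
  assert (T1 : - (h * p) * z <= 4 * (w ^ 2 * p ^ 2) + 4 * z ^ 2).
  { pose proof (young (- (h * p)) z 8 ltac:(lra)) as Y.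
    assert (h ^ 2 <= 64 * w ^ 2) by nra.
    assert (h ^ 2 * p ^ 2 <= 64 * w ^ 2 * p ^ 2) by (apply Rmult_le_compat_r; [apply pow2_ge_0 | assumption]).
    replace ((- (h * p)) ^ 2) with (h ^ 2 * p ^ 2) in Y by ring. lra. }
  (* Of the four powers of [w], three come from the symbol and one from the derivative; the Young
     denominator removes two, leaving the weight of the dissipation. *)
  assert (Hdiv : forall x A q m0, 0 <= A -> w ^ 2 <= m0 -> x ^ 2 <= A * w ^ 3 * (w * q ^ 2) ->
    / (2 * m0) * x ^ 2 <= A / 2 * (w ^ 2 * q ^ 2)).
  { intros x A q m0 HA Hm0 Hx. apply (Rmult_le_reg_l (2 * m0)); [lra |].
    rewrite <- Rmult_assoc, Rinv_r, Rmult_1_l by lra. eapply Rle_trans; [apply Hx |].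
    replace (A * w ^ 3 * (w * q ^ 2)) with (2 * w ^ 2 * (A / 2 * (w ^ 2 * q ^ 2))) by field.
    apply Rmult_le_compat_r; [| lra]. pose proof (pow2_ge_0 q). apply Rmult_le_pos; nra. }
  assert (T2 : (m * c1) * z <= 128 * (w ^ 2 * q1 ^ 2) + w ^ 2 / 2 * z ^ 2).
  { pose proof (young (m * c1) z (w ^ 2) Hw2) as Y.
    assert (D : / (2 * w ^ 2) * (m * c1) ^ 2 <= 256 / 2 * (w ^ 2 * q1 ^ 2)).
    { apply Hdiv; [lra | lra |]. rewrite Rpow_mult_distr.
      apply Rmult_le_compat; auto using pow2_ge_0. }
    lra. }
  assert (T3 : (eps * f * c2) * z <= 800 * eps ^ 2 * (w ^ 2 * q2 ^ 2) + w ^ 2 / 2 * z ^ 2).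
  { pose proof (young (eps * f * c2) z (w ^ 2) Hw2) as Y.
    assert (D : / (2 * w ^ 2) * (eps * f * c2) ^ 2 <= (1600 * eps ^ 2) / 2 * (w ^ 2 * q2 ^ 2)).
    { apply Hdiv; [nra | lra |]. rewrite !Rpow_mult_distr.
      replace (1600 * eps ^ 2 * w ^ 3 * (w * q2 ^ 2)) with (eps ^ 2 * (1600 * w ^ 3) * (w * q2 ^ 2)) by ring.
      apply Rmult_le_compat; auto using pow2_ge_0.
      - apply Rmult_le_pos; apply pow2_ge_0.
      - apply Rmult_le_compat_l; [apply pow2_ge_0 | assumption]. }
    lra. }
  assert (T4 : (2 * f * c3) * z <= (200 / kp + 12800 * eps) * (w ^ 2 * q3 ^ 2)
     + w ^ 2 / 2 * z ^ 2 + kp / 2 * z ^ 2).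
  { pose proof (young (2 * f * c3) z (w ^ 2 + kp) ltac:(lra)) as Y.
    assert (Hx : (2 * f * c3) ^ 2 <= 400 * (w * q3 ^ 2) + 25600 * eps ^ 3 * w ^ 3 * (w * q3 ^ 2)).
    { rewrite !Rpow_mult_distr.
      assert (f ^ 2 * c3 ^ 2 <= (100 + 6400 * eps ^ 3 * w ^ 3) * (w * q3 ^ 2))
        by (apply Rmult_le_compat; auto using pow2_ge_0). lra. }
    assert (Hi : 0 < / (2 * (w ^ 2 + kp))) by (apply Rinv_0_lt_compat; lra).
    pose proof (Rmult_le_compat_l _ _ _ (Rlt_le _ _ Hi) Hx) as Hx'.
    assert (Hq : 0 <= w * q3 ^ 2) by (apply Rmult_le_pos; [lra | apply pow2_ge_0]).
    (* The bounded part of [f^2] is divided by [kp], the growing part in [D2] by [w^2]: the first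
       becomes small by the choice of [kp], the second by that of [eps]. *)
    assert (D1 : / (2 * (w ^ 2 + kp)) * (400 * (w * q3 ^ 2)) <= 200 / kp * (w ^ 2 * q3 ^ 2)).
    { assert (Hik : / (2 * (w ^ 2 + kp)) <= / (2 * kp)) by (apply Rinv_le_contravar; lra).
      replace (200 / kp * (w ^ 2 * q3 ^ 2)) with (/ (2 * kp) * (400 * (w ^ 2 * q3 ^ 2))) by (field; lra).
      apply Rmult_le_compat; try lra. pose proof (pow2_ge_0 q3). nra. }
    assert (D2 : / (2 * (w ^ 2 + kp)) * (25600 * eps ^ 3 * w ^ 3 * (w * q3 ^ 2))
      <= 12800 * eps * (w ^ 2 * q3 ^ 2)).
    { apply (Rmult_le_reg_l (2 * (w ^ 2 + kp))); [lra |].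
      rewrite <- Rmult_assoc, Rinv_r, Rmult_1_l by lra.
      assert (He3 : eps ^ 3 <= eps) by (replace (eps ^ 3) with (eps * (eps * eps)) by ring; nra).
      assert (Hq2 : 0 <= w ^ 2 * q3 ^ 2) by (apply Rmult_le_pos; apply pow2_ge_0).
      replace (25600 * eps ^ 3 * w ^ 3 * (w * q3 ^ 2)) with (25600 * w ^ 2 * (w ^ 2 * q3 ^ 2) * eps ^ 3) by ring.
      apply Rle_trans with (25600 * w ^ 2 * (w ^ 2 * q3 ^ 2) * eps).
      - apply Rmult_le_compat_l; [| assumption]. apply Rmult_le_pos; lra.
      - assert (0 <= 25600 * kp * (w ^ 2 * q3 ^ 2) * eps) by (apply Rmult_le_pos; [apply Rmult_le_pos |]; lra). lra. }
    lra. }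
  replace (z * bz) with (s_sym l0 k * z ^ 2 + - (h * p) * z + (m * c1) * z + (eps * f * c2) * z + (2 * f * c3) * z).
  - lra.
  - replace bz with (s_sym l0 k * z + m * c1 + eps * f * c2 + 2 * f * c3 - h * p) by lra. ring.
Qed.

Lemma hs_le_partner (s : nat) (a : nat -> R) (B : R) : hs_le s a B -> hs_le s (fun k => a (partner k)) B.
Proof.
  intros H N. eapply Rle_trans; [| apply (H (2 * N)%nat)].
  eapply Rle_trans; [apply sum_le_index with (M := (2 * N)%nat);
    [intro k; apply (hs_le_term_ge0 l0 l0_pos s (fun k => a (partner k))) | lia] |].
  rewrite (sum_eq _ (fun k => W (partner k) ^ s * a (partner k) ^ 2)) by (intros; now rewrite W_partner).
  right. apply (sum_partner (fun k => W k ^ s * a k ^ 2)).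
Qed.

(** Young's inequality with a parameter: a large factor on the small differences, a small factor on
    the fixed data. Summed over the modes, it gives continuity of the energy rate uniformly in the
    truncation. *)
Lemma product_increment_bound (z z' z0 z0' th : R) : 0 < th <= 1 ->
  Rabs (z * z' - z0 * z0') <= / th * ((z - z0) ^ 2 + (z' - z0') ^ 2) + th * (z0 ^ 2 + z0' ^ 2).
Proof.
  intros Hth. set (a := z - z0). set (b := z' - z0').
  replace (z * z' - z0 * z0') with (a * b + a * z0' + z0 * b) by (unfold a, b; ring).
  assert (Hi : 1 <= / th) by (rewrite <- Rinv_1 at 1; apply Rinv_le_contravar; lra).
  assert (Hy : forall x y, Rabs (x * y) <= / th / 2 * x ^ 2 + th / 2 * y ^ 2).
  { intros x y. assert (E : / th / 2 = / (2 * th)) by (field; lra). rewrite E. apply Rabs_le. split.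
    - pose proof (young (- x) y th ltac:(lra)). replace ((- x) ^ 2) with (x ^ 2) in H by ring. lra.
    - apply young. lra. }
  assert (H1 : Rabs (a * b) <= / th / 2 * (a ^ 2 + b ^ 2)).
  { assert (0 <= (/ th - 1) * (a ^ 2 + b ^ 2)).
    { apply Rmult_le_pos; [lra |]. pose proof (pow2_ge_0 a). pose proof (pow2_ge_0 b). lra. }
    apply Rabs_le. pose proof (pow2_ge_0 (a - b)). pose proof (pow2_ge_0 (a + b)). nra. }
  pose proof (Hy a z0') as H2. pose proof (Hy b z0) as H3. rewrite (Rmult_comm b z0) in H3.
  pose proof (Rabs_triang (a * b + a * z0') (z0 * b)). pose proof (Rabs_triang (a * b) (a * z0')).
  assert (0 <= th / 2 * (z0 ^ 2 + z0' ^ 2)).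
  { apply Rmult_le_pos; [lra |]. pose proof (pow2_ge_0 z0). pose proof (pow2_ge_0 z0'). lra. }
  lra.
Qed.

(** The rate of each truncated energy has a modulus of continuity independent of [N], because [z]
    and [z'] are continuous in time in the weighted norm; the mean value inequality transfers this
    to the increments. *)
Lemma energy_increment (A B c : R) (r : nat) (rho : nat -> R) (z z' : R -> nat -> R) :
  0 <= c -> (forall k, 0 <= rho k <= c * W k ^ r) ->
  (forall t k, A <= t <= B -> wder A B (fun s => z s k) (z' t k) t) ->
  (forall t, A <= t <= B -> exists Z, hs_le r (z t) Z /\ hs_le r (z' t) Z) ->
  (forall t0 e, A <= t0 <= B -> 0 < e -> exists d, 0 < d /\
     forall t, A <= t <= B -> Rabs (t - t0) < d ->
       hs_le r (fun k => z t k - z t0 k) e /\ hs_le r (fun k => z' t k - z' t0 k) e) ->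
  forall t0 e, A <= t0 <= B -> 0 < e -> exists d, 0 < d /\
    forall t N, A <= t <= B -> Rabs (t - t0) < d ->
      Rabs (sum_f_R0 (fun k => rho k * z t k ^ 2) N - sum_f_R0 (fun k => rho k * z t0 k ^ 2) N
            - 2 * sum_f_R0 (fun k => rho k * (z t0 k * z' t0 k)) N * (t - t0)) <= e * Rabs (t - t0).
Proof.
  intros Hc Hrho Hder Hbd Hcont t0 e Ht0 He.
  destruct (Hbd t0 Ht0) as [Z [HZ HZ']].
  assert (HZ0 : 0 <= Z) by now apply (hs_le_ge0 l0 l0_pos r (z t0)).
  set (th := Rmin 1 (e / (2 * ((c + 1) * (2 + 2 * Z))))).
  assert (Hpos : 0 < (c + 1) * (2 + 2 * Z)) by nra.
  assert (Hth : 0 < th <= 1).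
  { split; [apply Rmin_glb_lt; [lra |]; apply Rdiv_lt_0_compat; lra | apply Rmin_l]. }
  assert (Hthe : 2 * (c * (th * (2 + 2 * Z))) <= e).
  { pose proof (Rmin_r 1 (e / (2 * ((c + 1) * (2 + 2 * Z))))) as Hr. fold th in Hr.
    apply (Rmult_le_compat_r (2 * ((c + 1) * (2 + 2 * Z)))) in Hr; [| lra].
    unfold Rdiv in Hr. rewrite Rmult_assoc, Rinv_l, Rmult_1_r in Hr by lra.
    assert (0 <= th * (2 + 2 * Z)) by nra. lra. }
  (* Closeness [th^2] compensates the factor [/ th]: the total is [th * (2 + 2 * Z)], which the
     choice of [th] makes small. *)
  destruct (Hcont t0 (th ^ 2) Ht0 ltac:(nra)) as [d [Hd Hclose]].
  exists d. split; [assumption |].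
  set (En := fun N t => sum_f_R0 (fun k => rho k * z t k ^ 2) N).
  set (Gn := fun N t => sum_f_R0 (fun k => rho k * (z t k * z' t k)) N).
  assert (HG : forall N t, A <= t <= B -> Rabs (t - t0) < d -> Rabs (2 * Gn N t - 2 * Gn N t0) <= e).
  { intros N t Ht Htd. destruct (Hclose t Ht Htd) as [H1 H2].
    replace (2 * Gn N t - 2 * Gn N t0) with (2 * (Gn N t - Gn N t0)) by ring.
    rewrite Rabs_mult, (Rabs_pos_eq 2) by lra. eapply Rle_trans; [| apply Hthe].
    apply Rmult_le_compat_l; [lra |]. unfold Gn. rewrite <- minus_sum.
    eapply Rle_trans; [apply Rsum_abs |].
    apply Rle_trans with (sum_f_R0 (fun k => c *
      (/ th * (W k ^ r * (z t k - z t0 k) ^ 2 + W k ^ r * (z' t k - z' t0 k) ^ 2)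
       + th * (W k ^ r * z t0 k ^ 2 + W k ^ r * z' t0 k ^ 2))) N).
    - apply sum_le_compat. intro k. specialize (Hrho k).
      rewrite <- Rmult_minus_distr_l, Rabs_mult, (Rabs_pos_eq (rho k)) by lra.
      eapply Rle_trans; [apply Rmult_le_compat;
        [lra | apply Rabs_pos | apply Hrho | apply (product_increment_bound _ _ _ _ th Hth)] |].
      right. ring.
    - rewrite sum_mult_l. apply Rmult_le_compat_l; [assumption |].
      rewrite sum_plus, !sum_mult_l, !sum_plus.
      specialize (H1 N). specialize (H2 N). specialize (HZ N). specialize (HZ' N).
      cbv beta in H1, H2.
      assert (Hi : 0 < / th) by (apply Rinv_0_lt_compat; lra).
      apply Rle_trans with (/ th * (th ^ 2 + th ^ 2) + th * (Z + Z)).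
      + apply Rplus_le_compat; apply Rmult_le_compat_l; lra.
      + right. field. lra. }
  intros t N Ht Htd. change (Rabs (En N t - En N t0 - 2 * Gn N t0 * (t - t0)) <= e * Rabs (t - t0)).
  set (f := fun s => En N s + - (2 * Gn N t0) * s).
  assert (Hf : forall s, A <= s <= B -> wder A B f (2 * Gn N s + - (2 * Gn N t0) * 1) s).
  { intros s Hs. apply wder_plus; [| apply wder_scal, wder_id].
    unfold En, Gn. rewrite <- sum_mult_l. apply wder_sum. intro k.
    replace (2 * (rho k * (z s k * z' s k))) with (rho k * (2 * (z s k * z' s k))) by ring.
    apply wder_scal, wder_sqr, Hder, Hs. }
  assert (Hf' : forall s, A <= s <= B -> Rabs (s - t0) < d -> Rabs (2 * Gn N s + - (2 * Gn N t0) * 1) <= e).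
  { intros s Hs Hsd. replace (2 * Gn N s + - (2 * Gn N t0) * 1) with (2 * Gn N s - 2 * Gn N t0) by ring.
    now apply HG. }
  replace (En N t - En N t0 - 2 * Gn N t0 * (t - t0)) with (f t - f t0) by (unfold f; ring).
  apply Rabs_def2 in Htd.
  destruct (Rle_dec t0 t) as [Hle | Hle].
  - rewrite (Rabs_pos_eq (t - t0)) by lra.
    apply (wder_increment_abs_le A B f (fun s => 2 * Gn N s + - (2 * Gn N t0) * 1)); try lra.
    + intros s Hs. apply Hf. lra.
    + intros s Hs. apply Hf'; [lra |]. rewrite Rabs_pos_eq; lra.
  - rewrite Rabs_minus_sym, (Rabs_minus_sym t), (Rabs_pos_eq (t0 - t)) by lra.
    apply (wder_increment_abs_le A B f (fun s => 2 * Gn N s + - (2 * Gn N t0) * 1)); try lra.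
    + intros s Hs. apply Hf. lra.
    + intros s Hs. apply Hf'; [lra |]. rewrite Rabs_minus_sym, Rabs_pos_eq; lra.
Qed.

End Symbols.

(** * The energy estimate *)

Section Energy.
Context (l0 : R) (l0_pos : 0 < l0).
Notation fc := (fcoef l0).
Notation W := (weight l0).
Notation hs_le := (hs_le l0).
Notation dsym := (dsym l0).

Lemma hs_le_weaken (s : nat) (a : nat -> R) (B B' : R) : B <= B' -> hs_le s a B -> hs_le s a B'.
Proof. intros HB H N. specialize (H N). lra. Qed.

Lemma hs_le_plus (s : nat) (a b : nat -> R) (A B : R) : hs_le s a A -> hs_le s b B ->
  hs_le s (fun k => a k + b k) (2 * A + 2 * B).
Proof.
  intros Ha Hb N. specialize (Ha N). specialize (Hb N).
  apply Rle_trans with (sum_f_R0 (fun k => 2 * (W k ^ s * a k ^ 2) + 2 * (W k ^ s * b k ^ 2)) N).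
  - apply sum_le_compat. intro k.
    assert (0 <= W k ^ s) by (apply pow_le; left; now apply W_pos).
    replace (2 * (W k ^ s * a k ^ 2) + 2 * (W k ^ s * b k ^ 2))
      with (W k ^ s * (2 * a k ^ 2 + 2 * b k ^ 2)) by ring.
    apply Rmult_le_compat_l; [assumption |]. pose proof (pow2_ge_0 (a k - b k)). nra.
  - rewrite sum_plus, !sum_mult_l. lra.
Qed.

Lemma hs_le_minus (s : nat) (a b : nat -> R) (A B : R) : hs_le s a A -> hs_le s b B ->
  hs_le s (fun k => a k - b k) (2 * A + 2 * B).
Proof.
  intros Ha Hb. apply (hs_le_plus s a (fun k => - b k)); [assumption |]. intro N.
  rewrite (sum_eq _ (fun k => W k ^ s * b k ^ 2)) by (intros; ring). apply Hb.
Qed.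

Lemma hs_norm_cv (s : nat) (f : R -> R) (B : R) : hs_le s (fc f) B ->
  Un_cv (fun N => sum_f_R0 (fun k => W k ^ s * fc f k ^ 2) N) (Hs_norm2 l0 s f).
Proof.
  intros H. apply (series_lim_spec (hs_term l0 s f) B); [| exact H].
  intro k. now apply (hs_le_term_ge0 l0 l0_pos s (fc f)).
Qed.

Lemma hs_norm_bound (s : nat) (f : R -> R) (B : R) : hs_le s (fc f) B ->
  hs_le s (fc f) (Hs_norm2 l0 s f).
Proof.
  intros H N. apply (sum_le_series_lim (hs_term l0 s f) B); [| exact H].
  intro k. now apply (hs_le_term_ge0 l0 l0_pos s (fc f)).
Qed.

Lemma In_Hs_spec (s : nat) (f : R -> R) : In_Hs l0 s f ->
  periodic l0 f /\ cts f /\ hs_le s (fc f) (Hs_norm2 l0 s f).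
Proof.
  intros [Hp [Hc [l Hl]]]. split; [assumption |]. split; [exact Hc |].
  apply (hs_norm_bound s f l). intro N.
  apply (growing_ineq (fun N => sum_f_R0 (hs_term l0 s f) N)); [| assumption].
  intro M. cbn [sum_f_R0]. pose proof (hs_le_term_ge0 l0 l0_pos s (fc f) (S M)) as Ht.
  unfold hs_term. unfold weight in Ht. lra.
Qed.

(** [Hs_norm2] is a chosen value, so its smallness is informative only once the series of the
    difference is known to converge; [hs_le_minus] supplies this. *)
Lemma CtHs_close (s : nat) (a b : R) (u : R -> R -> R) (t0 e : R) :
  CtHs l0 s a b u -> a <= t0 <= b -> 0 < e ->
  exists d, 0 < d /\ forall t, a <= t <= b -> Rabs (t - t0) < d ->
    hs_le s (fun k => fc (u t) k - fc (u t0) k) e.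
Proof.
  intros [Hin Hcont] Ht0 He. destruct (Hcont t0 Ht0 e He) as [d [Hd H]].
  exists d. split; [assumption |]. intros t Ht Htd. specialize (H t Ht Htd).
  destruct (In_Hs_spec s _ (Hin t Ht)) as [_ [C1 H1]].
  destruct (In_Hs_spec s _ (Hin t0 Ht0)) as [_ [C2 H2]].
  pose proof (hs_le_minus s _ _ _ _ H1 H2) as H3.
  rewrite <- (functional_extensionality _ _ (fun k => fcoef_minus l0 (u t) (u t0) k C1 C2)) in *.
  eapply hs_le_weaken; [| eapply hs_norm_bound; exact H3]. lra.
Qed.

(** Continuity gives local bounds; real induction on boundedness over [[a, t]] takes the place of a
    covering argument. *)
Lemma CtHs_bounded (s : nat) (a b : R) (u : R -> R -> R) : a <= b -> CtHs l0 s a b u ->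
  exists B, forall t, a <= t <= b -> hs_le s (fc (u t)) B.
Proof.
  intros Hab Hu.
  assert (Hloc : forall t0, a <= t0 <= b -> exists d B, 0 < d /\ forall t, a <= t <= b ->
     Rabs (t - t0) < d -> hs_le s (fc (u t)) B).
  { intros t0 Ht0. destruct (CtHs_close s a b u t0 1 Hu Ht0 ltac:(lra)) as [d [Hd H]].
    exists d, (2 * 1 + 2 * Hs_norm2 l0 s (u t0)). split; [assumption |]. intros t Ht Htd.
    replace (fc (u t)) with (fun k => (fc (u t) k - fc (u t0) k) + fc (u t0) k)
      by (apply functional_extensionality; intro; ring).
    apply hs_le_plus; [now apply H | apply In_Hs_spec; now apply Hu]. }
  assert (H : forall t, a <= t <= b -> exists B, forall r, a <= r <= t -> hs_le s (fc (u r)) B).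
  { apply interval_induction; [assumption | |].
    - intros t Ht Hs. destruct (Hloc t Ht) as [d [B [Hd HB]]].
      destruct (Rle_dec t a) as [Hta | Hta].
      + exists B. intros r Hr. apply HB; [lra |]. replace (r - t) with 0 by lra. now rewrite Rabs_R0.
      + set (q := Rmax a (t - d / 2)).
        assert (Hq : a <= q < t) by (split; [apply Rmax_l | apply Rmax_lub_lt; lra]).
        assert (Hqd : t - d / 2 <= q) by apply Rmax_r.
        destruct (Hs q Hq) as [B' HB']. exists (Rmax B B'). intros r Hr.
        destruct (Rle_dec r q) as [Hrq | Hrq].
        * eapply hs_le_weaken; [apply Rmax_r |]. apply HB'. lra.
        * eapply hs_le_weaken; [apply Rmax_l |]. apply HB; [lra |]. apply Rabs_def1; lra.
    - intros t Ht Hs. destruct (Hloc t ltac:(lra)) as [d [B [Hd HB]]].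
      destruct (Hs t ltac:(lra)) as [B' HB'].
      exists d. split; [assumption |]. intros q Hq Hqb. exists (Rmax B B'). intros r Hr.
      destruct (Rle_dec r t) as [Hrt | Hrt].
      + eapply hs_le_weaken; [apply Rmax_r |]. apply HB'. lra.
      + eapply hs_le_weaken; [apply Rmax_l |]. apply HB; [lra |]. apply Rabs_def1; lra. }
  destruct (H b ltac:(lra)) as [B HB]. now exists B.
Qed.

(** A coefficient is controlled by the [L^2] norm, so [L^2] convergence of the difference quotients
    differentiates every mode. *)
Lemma fcoef_wder (a b : R) (u ut : R -> R -> R) (t0 : R) (k : nat) :
  (forall t, a <= t <= b -> cts (u t)) -> cts (ut t0) -> C1tL2 l0 a b u ut -> a <= t0 <= b ->
  wder a b (fun t => fc (u t) k) (fc (ut t0) k) t0.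
Proof.
  intros Hu Hut [HC _] Ht0 e He. destruct (HC t0 Ht0 (e ^ 2) ltac:(nra)) as [d [Hd H]].
  exists d. split; [assumption |]. intros t Ht Htd.
  destruct (Req_dec t t0) as [-> | Hne].
  - rewrite !Rminus_diag, Rmult_0_r, Rminus_0_r, Rabs_R0. lra.
  - assert (Hpos : 0 < Rabs (t - t0)) by (apply Rabs_pos_lt; lra).
    specialize (H t Ht (conj Hpos Htd)).
    pose proof (Hu t Ht) as Ct. pose proof (Hu t0 Ht0) as Ct0.
    set (v := fun x => / (t - t0) * (u t x - u t0 x) - ut t0 x).
    assert (Hv : cts v) by (unfold v; auto with cts).
    assert (HL : period_int l0 (fun x => v x ^ 2) < e ^ 2).
    { eapply Rle_lt_trans; [| exact H]. right. unfold L2norm2.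
      rewrite Rint_RInt by auto 10 with cts. apply pint_ext. intro x. unfold v. f_equal. field. lra. }
    pose proof (fcoef_sqr_le l0 l0_pos v k Hv) as Hk.
    assert (Hfc : fc v k = / (t - t0) * (fc (u t) k - fc (u t0) k) - fc (ut t0) k).
    { unfold v. now rewrite fcoef_minus, fcoef_scal, fcoef_minus by auto with cts. }
    assert (Habs : Rabs (fc v k) <= e).
    { apply Rabs_le. split; nra. }
    replace (fc (u t) k - fc (u t0) k - fc (ut t0) k * (t - t0)) with (fc v k * (t - t0))
      by (rewrite Hfc; field; lra).
    rewrite Rabs_mult. apply Rmult_le_compat_r; lra.
Qed.

Lemma fcoef_dx_sqr_le (h : R -> R) (B : R) (k : nat) : periodic l0 h -> cts h -> hs_le 2 (fc h) B ->
  fc (dx h) k ^ 2 <= W k * fc h (partner k) ^ 2.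
Proof.
  intros Hp Hc H. destruct (fourier_derivative l0 l0_pos h B Hp Hc H) as [_ [_ [_ Hk]]].
  rewrite Hk, Rpow_mult_distr, dsym_sqr, lam_partner by assumption.
  apply Rmult_le_compat_r; [apply pow2_ge_0 | unfold weight; lra].
Qed.

(** The three smallness conditions each cap one absorbed contribution at a quarter of the
    dissipation: the bounded and the growing part of [Psi * zeta], and [zeta^2]. *)
Lemma energy_rate (n : nat) (C0 P P' kp eps E : R) (psi psit zeta zetat : R -> R) :
  (forall f g F1 F2 G1 G2, periodic l0 f -> cts f -> periodic l0 g -> cts g ->
     hs_le (S n) (fc f) F1 -> hs_le (S (S n)) (fc f) F2 -> hs_le (S n) (fc g) G1 -> hs_le (S (S n)) (fc g) G2 ->
     hs_le (S (S n)) (fc (fun x => f x * g x)) (C0 * (F2 * G1 + F1 * G2))) ->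
  0 <= C0 -> 0 < eps <= 1 -> 0 < kp ->
  periodic l0 psi -> cts psi -> hs_le (S (S n)) (fc psi) P -> hs_le (S (S n)) (fc psit) P' ->
  In_Hs l0 (S (S n)) zeta ->
  (forall N, sum_f_R0 (fun k => W k ^ n * b_sym l0 eps k * fc zeta k ^ 2) N <= E) ->
  (forall k, b_sym l0 eps k * fc zetat k + h_sym l0 eps k * fc psit k
    = s_sym l0 k * fc zeta k
      + m_sym l0 eps k * fc (dx (fun x => psi x ^ 2)) k
      + eps * f_sym l0 eps k * fc (dx (fun x => zeta x ^ 2)) k
      + 2 * f_sym l0 eps k * fc (dx (fun x => psi x * zeta x)) k) ->
  200 / kp * (2 * C0 * P) <= / 4 -> 12800 * eps * (2 * C0 * P) <= / 4 ->
  1600 * C0 * eps * E <= / 4 ->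
  forall e, 0 < e -> exists N0, forall N, (N0 <= N)%nat ->
    sum_f_R0 (fun k => W k ^ n * b_sym l0 eps k * (fc zeta k * fc zetat k)) N
    <= (20 + kp / 2) * E + 4 * P' + 256 * C0 * P ^ 2 + e.
Proof.
  intros Hmult HC0 Heps Hkp Pp Cp Hpsi Hpsit Hz HE Heq S1 S2 S3 e He.
  destruct (In_Hs_spec _ _ Hz) as [Pz [Cz HD]]. set (D := Hs_norm2 l0 (S (S n)) zeta) in *.
  assert (HWn : forall k, 0 <= W k ^ n) by (intro k; apply pow_le; left; now apply W_pos).
  assert (HP0 : 0 <= P) by (eapply hs_le_ge0; [apply l0_pos | exact Hpsi]).
  assert (HD0 : 0 <= D) by (eapply hs_le_ge0; [apply l0_pos | exact HD]).
  assert (Hb : forall k, 0 <= fc zeta k ^ 2) by (intro; apply pow2_ge_0).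
  assert (HEn : hs_le n (fc zeta) E).
  { intro N. eapply Rle_trans; [| apply (HE N)]. apply sum_le_compat. intro k.
    apply Rmult_le_compat_r; [apply Hb |].
    rewrite <- (Rmult_1_r (W k ^ n)) at 1. apply Rmult_le_compat_l; [apply HWn |].
    now apply b_sym_lower. }
  assert (HE0 : 0 <= E) by (eapply hs_le_ge0; [apply l0_pos | exact HEn]).
  (* The second lower bound on [b] gives one more derivative at the cost of [1 / eps]; of the
     [eps^2] in front of the quadratic term, one power survives. *)
  assert (HE1 : hs_le (S n) (fc zeta) (E / eps)).
  { intro N. apply (Rmult_le_reg_l eps); [lra |].
    replace (eps * (E / eps)) with E by (field; lra). rewrite <- sum_mult_l.
    eapply Rle_trans; [| apply (HE N)]. apply sum_le_compat. intro k.
    rewrite <- Rmult_assoc. apply Rmult_le_compat_r; [apply Hb |].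
    replace (eps * W k ^ S n) with (W k ^ n * (eps * W k)) by (cbn [pow]; ring).
    apply Rmult_le_compat_l; [apply HWn |]. now apply b_sym_lower. }
  assert (Hlow : forall f F, hs_le (S (S n)) f F -> hs_le (S n) f F)
    by (intros f F; apply hs_le_mono; [assumption | lia]).
  assert (Hlow2 : forall f F, hs_le (S (S n)) f F -> hs_le 2 f F)
    by (intros f F; apply hs_le_mono; [assumption | lia]).
  pose proof (Hmult psi psi P P P P Pp Cp Pp Cp (Hlow _ _ Hpsi) Hpsi (Hlow _ _ Hpsi) Hpsi) as Q1.
  pose proof (Hmult zeta zeta _ D _ D Pz Cz Pz Cz HE1 HD HE1 HD) as Q2.
  (* Both norms of [zeta] are bounded by [D] here: smallness comes from [kp] and [eps], not from a
     lower norm. *)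
  pose proof (Hmult psi zeta P P D D Pp Cp Pz Cz (Hlow _ _ Hpsi) Hpsi (Hlow _ _ HD) HD) as Q3.
  assert (Esq : forall f : R -> R, (fun x => f x ^ 2) = (fun x => f x * f x))
    by (intro f; apply functional_extensionality; intro; ring).
  assert (Hper : forall f g : R -> R, periodic l0 f -> periodic l0 g -> periodic l0 (fun x => f x * g x))
    by (intros f g Hf Hg x; now rewrite Hf, Hg).
  rewrite (Esq psi), (Esq zeta) in Heq.
  assert (Hterm : forall k, W k ^ n * b_sym l0 eps k * (fc zeta k * fc zetat k) <=
     - (3 / 2) * (W k ^ S (S n) * fc zeta k ^ 2) + (20 + kp / 2) * (W k ^ n * fc zeta k ^ 2)
     + 4 * (W k ^ S (S n) * fc psit k ^ 2)
     + 128 * (W k ^ S (S n) * fc (fun x => psi x * psi x) (partner k) ^ 2)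
     + 800 * eps ^ 2 * (W k ^ S (S n) * fc (fun x => zeta x * zeta x) (partner k) ^ 2)
     + (200 / kp + 12800 * eps) * (W k ^ S (S n) * fc (fun x => psi x * zeta x) (partner k) ^ 2)).
  { intro k.
    pose proof (energy_term l0 l0_pos eps kp (fc zeta k) (fc psit k) _ _ _ _ _ _ _ k Heps Hkp
      (fcoef_dx_sqr_le _ _ k (Hper _ _ Pp Pp) (cts_mult _ _ Cp Cp) (Hlow2 _ _ Q1))
      (fcoef_dx_sqr_le _ _ k (Hper _ _ Pz Pz) (cts_mult _ _ Cz Cz) (Hlow2 _ _ Q2))
      (fcoef_dx_sqr_le _ _ k (Hper _ _ Pp Pz) (cts_mult _ _ Cp Cz) (Hlow2 _ _ Q3))
      (Heq k)) as Ht.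
    pose proof (Rmult_le_compat_l _ _ _ (HWn k) Ht) as Ht'.
    replace (W k ^ n * b_sym l0 eps k * (fc zeta k * fc zetat k))
      with (W k ^ n * (fc zeta k * (b_sym l0 eps k * fc zetat k))) by ring.
    eapply Rle_trans; [apply Ht' |]. right. cbn [pow]. ring. }
  (* The products are bounded by the full norm [D], while the sum over [k <= N] contains only part
     of the dissipation. From [N0] on the two differ by less than [e / 2], which costs
     [3 / 4 * e]. *)
  destruct (hs_norm_cv _ _ _ HD (e / 2) ltac:(lra)) as [N0 HN0]. exists N0. intros N HN.
  specialize (HN0 N HN). unfold Rdist in HN0. apply Rabs_def2 in HN0. fold D in HN0.
  eapply Rle_trans; [apply sum_le_compat, Hterm |].
  rewrite !sum_plus, !sum_mult_l.
  pose proof (hs_le_partner l0 l0_pos _ _ _ Q1 N) as B1. pose proof (hs_le_partner l0 l0_pos _ _ _ Q2 N) as B2.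
  pose proof (hs_le_partner l0 l0_pos _ _ _ Q3 N) as B3. specialize (Hpsit N). specialize (HEn N).
  cbv beta in *.
  assert (Hk1 : 0 <= 200 / kp + 12800 * eps).
  { assert (0 < 200 / kp) by (apply Rdiv_lt_0_compat; lra). lra. }
  apply (Rmult_le_compat_l (800 * eps ^ 2)) in B2; [| nra].
  apply (Rmult_le_compat_l _ _ _ Hk1) in B3.
  apply (Rmult_le_compat_l (20 + kp / 2)) in HEn; [| lra].
  assert (C2 : 800 * eps ^ 2 * (C0 * (D * (E / eps) + E / eps * D)) <= / 4 * D).
  { replace (800 * eps ^ 2 * (C0 * (D * (E / eps) + E / eps * D))) with (1600 * C0 * eps * E * D)
      by (field; lra). now apply Rmult_le_compat_r. }
  assert (C3 : (200 / kp + 12800 * eps) * (C0 * (P * D + P * D)) <= / 4 * D + / 4 * D).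
  { replace ((200 / kp + 12800 * eps) * (C0 * (P * D + P * D)))
      with (200 / kp * (2 * C0 * P) * D + 12800 * eps * (2 * C0 * P) * D) by ring.
    apply Rplus_le_compat; now apply Rmult_le_compat_r. }
  lra.
Qed.

Lemma hs_le_max (s : nat) (a : nat -> R) (B B' : R) : hs_le s a B -> hs_le s a (Rmax B B').
Proof. apply hs_le_weaken, Rmax_l. Qed.

(** [K] has a factor 2 from differentiating squares, and both the linear rate and the sources are
    dominated by multiples of [1 + E]. The bound [M] on [E] is then read through the two lower
    bounds on [b]. *)
Lemma energy_bound (n : nat) (C0 P P' kp eps T T1 : R) (Psi Psit zeta zetat : R -> R -> R) :
  (forall f g F1 F2 G1 G2, periodic l0 f -> cts f -> periodic l0 g -> cts g ->
     hs_le (S n) (fc f) F1 -> hs_le (S (S n)) (fc f) F2 -> hs_le (S n) (fc g) G1 -> hs_le (S (S n)) (fc g) G2 ->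
     hs_le (S (S n)) (fc (fun x => f x * g x)) (C0 * (F2 * G1 + F1 * G2))) ->
  0 <= C0 -> 0 < eps <= 1 -> 0 < kp -> 0 < T1 <= T ->
  (forall t, 0 <= t <= T1 -> periodic l0 (Psi t)) -> (forall t, 0 <= t <= T1 -> cts (Psi t)) ->
  (forall t, 0 <= t <= T1 -> hs_le (S (S n)) (fc (Psi t)) P) ->
  (forall t, 0 <= t <= T1 -> hs_le (S (S n)) (fc (Psit t)) P') ->
  Yn l0 n T1 zeta zetat -> (forall x, zeta 0 x = 0) -> eq_star l0 eps T1 Psi Psit zeta zetat ->
  let K := 2 * ((20 + kp / 2) + (4 * P' + 256 * C0 * P ^ 2)) in
  let M := exp ((K + 1) * T) in
  200 / kp * (2 * C0 * P) <= / 4 -> 12800 * eps * (2 * C0 * P) <= / 4 ->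
  1600 * C0 * eps * M <= / 4 ->
  forall t, 0 <= t <= T1 -> hs_le n (fc (zeta t)) M /\ hs_le (S n) (fc (zeta t)) (M / eps).
Proof.
  intros Hmult HC0 Heps Hkp HT HPp HPc HP HP' [HZ [HC1 HZt]] Hinit Hstar K M S1 S2 S3.
  assert (HP0 : 0 <= P) by (eapply hs_le_ge0; [apply l0_pos | apply (HP 0); lra]).
  assert (HP0' : 0 <= P') by (eapply hs_le_ge0; [apply l0_pos | apply (HP' 0); lra]).
  assert (HCP : 0 <= C0 * P ^ 2) by (apply Rmult_le_pos; [assumption | apply pow2_ge_0]).
  assert (HK : 0 <= K) by (unfold K; lra).
  assert (HWn : forall k, 0 <= W k ^ n) by (intro k; apply pow_le; left; now apply W_pos).
  set (rho := fun k => W k ^ n * b_sym l0 eps k).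
  assert (Hrho : forall k, 0 <= rho k <= 12 * W k ^ S n).
  { intro k. destruct (b_sym_lower l0 l0_pos eps k Heps) as [Hb1 _].
    pose proof (b_sym_upper l0 l0_pos eps k Heps) as Hb2. unfold rho. split.
    - apply Rmult_le_pos; [apply HWn | lra].
    - replace (12 * W k ^ S n) with (W k ^ n * (12 * W k)) by (cbn [pow]; ring).
      now apply Rmult_le_compat_l. }
  (* The order [max 4 (2 n)] is at least [n + 2], the order of the dissipation, for every [n]. *)
  assert (Zin : forall t, 0 <= t <= T1 -> periodic l0 (zeta t) /\ cts (zeta t) /\
     exists Z, hs_le (S n) (fc (zeta t)) Z /\ hs_le (S (S n)) (fc (zeta t)) Z).
  { intros t Ht. destruct (In_Hs_spec _ _ (proj1 HZ t Ht)) as [Hp [Hc H]].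
    split; [assumption |]. split; [assumption |]. eexists.
    split; (eapply hs_le_mono; [apply l0_pos | | exact H]); lia. }
  assert (Ztin : forall t, 0 <= t <= T1 -> cts (zetat t) /\ exists Z, hs_le (S n) (fc (zetat t)) Z).
  { intros t Ht. destruct (In_Hs_spec _ _ (proj1 HZt t Ht)) as [_ [Hc H]].
    split; [assumption |]. eexists. eapply hs_le_mono; [apply l0_pos | | exact H]. lia. }
  set (En := fun N t => sum_f_R0 (fun k => rho k * fc (zeta t) k ^ 2) N).
  set (Gn := fun N t => 2 * sum_f_R0 (fun k => rho k * (fc (zeta t) k * fc (zetat t) k)) N).
  set (E := fun t => series_lim (fun k => rho k * fc (zeta t) k ^ 2)).
  assert (Hterm : forall t k, 0 <= rho k * fc (zeta t) k ^ 2).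
  { intros t k. apply Rmult_le_pos; [apply Hrho | apply pow2_ge_0]. }
  assert (HEb : forall t, 0 <= t <= T1 -> exists B, forall N, En N t <= B).
  { intros t Ht. destruct (Zin t Ht) as [_ [_ [Z [H _]]]]. exists (12 * Z). intro N.
    eapply Rle_trans; [| apply Rmult_le_compat_l; [lra | apply (H N)]]. rewrite <- sum_mult_l.
    apply sum_le_compat. intro k. rewrite <- Rmult_assoc.
    apply Rmult_le_compat_r; [apply pow2_ge_0 | apply Hrho]. }
  assert (HEle : forall t N, 0 <= t <= T1 -> En N t <= E t).
  { intros t N Ht. destruct (HEb t Ht) as [B HB]. exact (sum_le_series_lim _ B N (Hterm t) HB). }
  assert (HE0 : forall t, 0 <= t <= T1 -> 0 <= E t).
  { intros t Ht. eapply Rle_trans; [| apply (HEle t O Ht)]. apply Hterm. }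
  assert (HE : forall t, 0 <= t <= T1 -> 1 + E t <= exp ((K + 1) * t)).
  { apply (bootstrap T1 K En Gn E); trivial; try lra.
    - intros t c N0 Ht Hc. apply series_lim_le; [apply Hterm |]. intro N.
      apply Rle_trans with (En (max N0 N) t); [apply sum_le_index; [apply Hterm | lia] |].
      apply Hc. lia.
    - apply (energy_increment l0 l0_pos 0 T1 12 (S n) rho (fun t => fc (zeta t)) (fun t => fc (zetat t)));
        trivial; try lra.
      + intros t k Ht. apply (fcoef_wder 0 T1 zeta zetat); trivial.
        * intros s Hs. now apply Zin.
        * now apply Ztin.
      + intros t Ht. destruct (Zin t Ht) as [_ [_ [Z [H _]]]]. destruct (Ztin t Ht) as [_ [Z' H']].
        exists (Rmax Z Z'). split; [now apply hs_le_max | rewrite Rmax_comm; now apply hs_le_max].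
      + intros t0 e Ht0 He.
        destruct (CtHs_close _ _ _ _ t0 e HZ Ht0 He) as [d1 [Hd1 H1]].
        destruct (CtHs_close _ _ _ _ t0 e HZt Ht0 He) as [d2 [Hd2 H2]].
        exists (Rmin d1 d2). split; [now apply Rmin_glb_lt |]. intros t Ht Htd.
        specialize (H1 t Ht (Rlt_le_trans _ _ _ Htd (Rmin_l _ _))).
        specialize (H2 t Ht (Rlt_le_trans _ _ _ Htd (Rmin_r _ _))).
        split; (eapply hs_le_mono; [apply l0_pos | | eassumption]); lia.
    - intros t Ht. destruct (Zin t Ht) as [_ [_ [Z [H _]]]]. destruct (Ztin t Ht) as [_ [Z' H']].
      exists (12 * (Z + Z')). intro N. unfold Gn. rewrite <- sum_mult_l.
      eapply Rle_trans; [apply Rsum_abs |].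
      apply Rle_trans with (sum_f_R0 (fun k => 12 * (W k ^ S n * fc (zeta t) k ^ 2 + W k ^ S n * fc (zetat t) k ^ 2)) N).
      + apply sum_le_compat. intro k.
        replace (12 * (W k ^ S n * fc (zeta t) k ^ 2 + W k ^ S n * fc (zetat t) k ^ 2))
          with (12 * W k ^ S n * (fc (zeta t) k ^ 2 + fc (zetat t) k ^ 2)) by ring.
        replace (2 * (rho k * (fc (zeta t) k * fc (zetat t) k)))
          with (rho k * (2 * (fc (zeta t) k * fc (zetat t) k))) by ring.
        rewrite Rabs_mult, (Rabs_pos_eq (rho k)) by apply Hrho.
        apply Rmult_le_compat; [apply Hrho | apply Rabs_pos | apply Hrho |].
        pose proof (pow2_ge_0 (fc (zeta t) k - fc (zetat t) k)).
        pose proof (pow2_ge_0 (fc (zeta t) k + fc (zetat t) k)). apply Rabs_le. split; lra.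
      + rewrite sum_mult_l, sum_plus. specialize (H N). specialize (H' N). cbv beta in *. lra.
    - intros t e Ht Et EM He.
      (* Below the bootstrap threshold [E <= M], so smallness assumed for [M] yields the smallness
         of [eps * E] that [energy_rate] needs. *)
      assert (HEM : E t <= M).
      { apply Rle_trans with (exp ((K + 1) * T1)); [lra |]. unfold M.
        destruct (Req_dec T1 T) as [-> | Hne]; [lra |].
        left. apply exp_increasing, Rmult_lt_compat_l; lra. }
      destruct (Zin t Ht) as [Hpz [Hcz _]].
      assert (Hz2 : In_Hs l0 (S (S n)) (zeta t)).
      { destruct (Zin t Ht) as [_ [_ [Z [_ H]]]]. split; [assumption |]. split; [assumption |].
        exists (Hs_norm2 l0 (S (S n)) (zeta t)). exact (hs_norm_cv _ _ _ H). }
      (* [Gn] is twice the sum treated there, hence the halved tolerance. *)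
      destruct (energy_rate n C0 P P' kp eps (E t) (Psi t) (Psit t) (zeta t) (zetat t)) with (e := e / 2)
        as [N0 HN]; trivial; try lra; auto.
      + intro N. exact (HEle t N Ht).
      + eapply Rle_trans; [| apply S3]. apply Rmult_le_compat_l; [| assumption].
        apply Rmult_le_pos; lra.
      + exists N0. intros N HNN. specialize (HN N HNN). unfold Gn, rho.
        assert (0 <= (20 + kp / 2) * 1) by lra. unfold K.
        assert (0 <= (4 * P' + 256 * C0 * P ^ 2) * E t) by (apply Rmult_le_pos; lra). lra.
    - apply series_lim_le; [apply Hterm |]. intro N. right. apply sum_eq_R0. intros k _.
      assert (H0 : fc (zeta 0) k = 0); [| rewrite H0; ring].
      rewrite (functional_extensionality _ _ Hinit), fcoef_pint by auto with cts.
      rewrite (pint_ext l0 _ (fun _ => 0)) by (intro; ring). rewrite pint_const by assumption. ring. }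
  intros t Ht.
  assert (HEM : E t <= M).
  { specialize (HE t Ht). apply Rle_trans with (exp ((K + 1) * t)); [lra |]. unfold M.
    destruct (Req_dec t T) as [-> | Hne]; [lra |].
    left. apply exp_increasing, Rmult_lt_compat_l; lra. }
  split; intro N.
  - eapply Rle_trans; [| apply HEM]. eapply Rle_trans; [| apply (HEle t N Ht)].
    apply sum_le_compat. intro k. apply Rmult_le_compat_r; [apply pow2_ge_0 |]. unfold rho.
    rewrite <- (Rmult_1_r (W k ^ n)) at 1. apply Rmult_le_compat_l; [apply HWn |].
    now apply b_sym_lower.
  - apply (Rmult_le_reg_l eps); [lra |]. replace (eps * (M / eps)) with M by (field; lra).
    eapply Rle_trans; [| apply HEM]. eapply Rle_trans; [| apply (HEle t N Ht)].
    rewrite <- sum_mult_l. apply sum_le_compat. intro k.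
    rewrite <- Rmult_assoc. apply Rmult_le_compat_r; [apply pow2_ge_0 |]. unfold rho.
    replace (eps * W k ^ S n) with (W k ^ n * (eps * W k)) by (cbn [pow]; ring).
    apply Rmult_le_compat_l; [apply HWn |]. now apply b_sym_lower.
Qed.

(** The strict inequality leaves one derivative in reserve: [dxn m f] is still in [H^1], where its
    Fourier series converges uniformly and Parseval applies. *)
Lemma dxn_sqr_integral_le (m : nat) (f : R -> R) (s : nat) (B : R) : (m < s)%nat ->
  In_Hs l0 s f -> hs_le m (fc f) B ->
  Rint (fun x => dxn m f x ^ 2) (- l0 / 2) (l0 / 2) <= B.
Proof.
  intros Hs Hf HB. destruct (In_Hs_spec _ _ Hf) as [Hp [Hc H]].
  set (D := Hs_norm2 l0 s f) in *.
  assert (H1 : hs_le (S m) (fc f) D) by (apply (hs_le_mono l0 l0_pos s); [lia | assumption]).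
  destruct (fourier_dxn l0 l0_pos m f D Hp Hc H1) as [Hpm [Hcm Hm]].
  rewrite Rint_RInt by auto with cts.
  apply (Parseval_le l0 l0_pos (dxn m f) D B Hpm Hcm); apply Hm.
  - now rewrite Nat.add_1_r.
  - now rewrite Nat.add_0_r.
Qed.

End Energy.

Theorem theorem5p3 (l0 : R) (n : nat) (T : R) (Phi Psi Psit : R -> R -> R) :
  0 < l0 -> 0 < T ->
  KS_solution l0 T Phi Psi ->
  CtHs l0 (n + 4) 0 T Psi ->
  C1tL2 l0 0 T Psi Psit ->
  CtHs l0 (n + 2) 0 T Psit ->
  exists eps1 : R, 0 < eps1 < 1 /\
  exists Kn : R, 0 < Kn /\
  forall (eps T1 : R) (zeta zetat : R -> R -> R),
    0 < eps <= eps1 ->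
    0 < T1 <= T ->
    Yn l0 n T1 zeta zetat ->
    (forall t, 0 <= t <= T1 -> Rint (zeta t) (- l0 / 2) (l0 / 2) = 0) ->
    (forall x, zeta 0 x = 0) ->
    eq_star l0 eps T1 Psi Psit zeta zetat ->
    forall t1 t2, 0 <= t1 <= T1 -> 0 <= t2 <= T1 ->
      Rint (fun x => (dxn n (zeta t1) x) ^ 2) (- l0 / 2) (l0 / 2)
      + eps * Rint (fun x => (dxn (n + 1) (zeta t2) x) ^ 2) (- l0 / 2) (l0 / 2)
      <= Kn.
Proof.
  intros Hl0 HT _ HPsi _ HPsit.
  destruct (fcoef_mult_bound l0 Hl0 n) as [C0 [HC0 Hmult]].
  destruct (CtHs_bounded l0 Hl0 _ 0 T Psi ltac:(lra) HPsi) as [P HP].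
  destruct (CtHs_bounded l0 Hl0 _ 0 T Psit ltac:(lra) HPsit) as [P' HP'].
  assert (HP0 : 0 <= P) by (eapply hs_le_ge0; [apply Hl0 | apply (HP 0); lra]).
  set (C1 := 2 * C0 * P). assert (HC1 : 0 <= C1) by (apply Rmult_le_pos; lra).
  (* Chosen so that [200 / kp * C1 <= / 4]; it depends on [Psi] but not on [eps]. *)
  set (kp := 800 * (C1 + 1)). assert (Hkp : 0 < kp) by (unfold kp; lra).
  set (K := 2 * ((20 + kp / 2) + (4 * P' + 256 * C0 * P ^ 2))).
  set (M := exp ((K + 1) * T)). assert (HM : 0 < M) by apply exp_pos.
  assert (HCM : 0 <= C0 * M) by (apply Rmult_le_pos; lra).
  (* The coefficients are four times 12800 and 1600, turning [eps * q <= 1] into the two remaining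
     smallness conditions; the 2 forces [eps1 < 1]. *)
  set (q := 2 + 51200 * C1 + 6400 * (C0 * M)).
  exists (/ q). split.
  { split; [apply Rinv_0_lt_compat; unfold q; lra |].
    rewrite <- Rinv_1. apply Rinv_lt_contravar; unfold q; lra. }
  (* One [M] for each term; they are bounded at independent times [t1] and [t2], which yields the
     sum of the two suprema. *)
  exists (2 * M). split; [lra |].
  intros eps T1 zeta zetat Heps HT1 HY _ Hinit Hstar t1 t2 Ht1 Ht2.
  assert (Hq : eps * q <= 1).
  { rewrite <- (Rinv_l q) by (unfold q; lra). apply Rmult_le_compat_r; [unfold q; lra | lra]. }
  assert (He1 : 0 <= eps * C1) by (apply Rmult_le_pos; lra).
  assert (He2 : 0 <= eps * (C0 * M)) by (apply Rmult_le_pos; lra).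
  unfold q in Hq.
  assert (Hbound : forall t, 0 <= t <= T1 ->
    hs_le l0 n (fcoef l0 (zeta t)) M /\ hs_le l0 (S n) (fcoef l0 (zeta t)) (M / eps)).
  { apply (energy_bound l0 Hl0 n C0 P P' kp eps T T1 Psi Psit zeta zetat); trivial; try lra.
    - intros t Ht. apply HPsi. lra.
    - intros t Ht. apply (In_Hs_spec l0 Hl0 (n + 4)), HPsi. lra.
    - intros t Ht. apply (hs_le_mono l0 Hl0 (n + 4)); [lia | apply HP; lra].
    - intros t Ht. apply (hs_le_mono l0 Hl0 (n + 2)); [lia | apply HP'; lra].
    - fold C1. apply (Rmult_le_reg_r kp); [assumption |].
      replace (200 / kp * C1 * kp) with (200 * C1) by (field; lra). unfold kp. lra.
    - fold C1. lra.
    - fold K. fold M. lra. }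
  assert (Hin : forall t, 0 <= t <= T1 -> In_Hs l0 (Nat.max 4 (2 * n)) (zeta t)) by apply HY.
  assert (H1 : Rint (fun x => dxn n (zeta t1) x ^ 2) (- l0 / 2) (l0 / 2) <= M).
  { eapply dxn_sqr_integral_le; [assumption | | now apply Hin | now apply Hbound]. lia. }
  assert (H2 : Rint (fun x => dxn (n + 1) (zeta t2) x ^ 2) (- l0 / 2) (l0 / 2) <= M / eps).
  (* The arithmetic goal is [n + 1 < max 4 (2 n)]: the 4 settles [n <= 2], the other entry
     [n >= 2]. *)
  { eapply dxn_sqr_integral_le; [assumption | | now apply Hin |]; [lia |].
    rewrite Nat.add_1_r. now apply Hbound. }
  apply (Rmult_le_compat_l eps) in H2; [| lra].
  replace (eps * (M / eps)) with M in H2 by (field; lra). lra.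
Qed.
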